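(* Let $M$ be a Frölicher space that is microlinear and Weil exponentiable, and let $p,q,r$ be natural numbers. If $\xi_1$ is a tangent-vector-valued $p$-form on $M$, $\xi_2$ is a tangent-vector-valued $q$-form on $M$ and $\xi_3$ is a tangent-vector-valued $r$-form on $M$, then the following graded Jacobi identity for the Frölicher-Nijenhuis bracket holds: $$[\xi_1,[\xi_2,\xi_3]_{FN}]_{FN}+(-1)^{p(q+r)}[\xi_2,[\xi_3,\xi_1]_{FN}]_{FN}+(-1)^{r(p+q)}[\xi_3,[\xi_1,\xi_2]_{FN}]_{FN}=0 .$$
   Context: Frölicher spaces and Weil prolongations. $\mathbf{FS}$ is the cartesian closed category of Frölicher spaces and smooth maps; $[X\to Y]=Y^X$ is the Frölicher space of smooth maps. A Weil algebra is a finite-dimensional commutative unital local $\mathbb{R}$-algebra with residue field $\mathbb{R}$. The Weil prolongation $X\otimes W$ of a Frölicher space $X$ by $W=C^\infty(\mathbb{R}^n)/I$ is the set of classes of smooth maps $f:\mathbb{R}^n\to X$, where $f\sim g$ iff $f(0)=g(0)$ and $h\circ f-h\circ g\in I$ for all smooth $h:X\to\mathbb{R}$, with the initial Frölicher structure for the induced maps $X\otimes W\to\mathbb{R}\otimes W=W$; this is a bifunctor and $\cdot\otimes W$ preserves products. Weil algebras are named by ''infinitesimal objects'': $D=\{d: d^2=0\}$, $D^n$, $D(2)=\{(d_1,d_2)\in D^2: d_1d_2=0\}$, $D^2\oplus D=\{(d_1,d_2,e)\in D^3: d_1e=d_2e=0\}$, with $\mathcal{W}_{D^n}=\mathbb{R}[X_1,\dots,X_n]/(X_1^2,\dots,X_n^2)$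 ($\mathcal W_{D^0}=\mathbb R$), $\mathcal{W}_{D(2)}=\mathbb{R}[X,Y]/(X^2,Y^2,XY)$, $\mathcal{W}_{D^2\oplus D}=\mathbb{R}[X,Y,Z]/(X^2,Y^2,Z^2,XZ,YZ)$. A polynomial map $f:E\to E'$ of these objects induces contravariantly $\mathcal{W}_f:\mathcal{W}_{E'}\to\mathcal{W}_E$, hence $\mathrm{id}_X\otimes\mathcal{W}_f:X\otimes\mathcal{W}_{E'}\to X\otimes\mathcal{W}_E$. $\otimes_\infty$ is the tensor product of Weil algebras; $\mathcal{W}_{D^{m+n}}=\mathcal{W}_{D^m}\otimes_\infty\mathcal{W}_{D^n}$. $X$ is microlinear if every finite limit diagram $\mathbb{D}$ of Weil algebras yields a limit diagram $X\otimes\mathbb{D}$ in $\mathbf{FS}$. $X$ is Weil exponentiable if $(X\otimes(W_1\otimes_\infty W_2))^Y=(X\otimes W_1)^Y\otimes W_2$ naturally for all Frölicher spaces $Y$ and Weil algebras $W_1,W_2$. Such spaces form a cartesian closed category. $\pi:X\otimes W\to X$ is the canonical projection. For $X$ microlinear, tangent vectors $t_1,t_2\in X\otimes\mathcal{W}_D$ with the same foot point $\pi(t_1)=\pi(t_2)$ are added as follows: there is a unique $\gamma\in X\otimes\mathcal{W}_{D(2)}$ with pullbacks $t_1,t_2$ along $d\mapsto(d,0)$, $d\mapsto(0,d)$, and $t_1+t_2$ is its pullback along $d\mapsto(d,d)$; $\alpha t$ is the pullback of $t$ along $d\mapsto\alpha d$. Strong difference. Let $X$ be microlinear and $\gamma_1,\gamma_2\in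 X\otimes\mathcal{W}_{D^2}$ have the same pullback along the inclusion $D(2)\to D^2$. Let $\varphi(d_1,d_2)=(d_1,d_2,0)$, $\psi(d_1,d_2)=(d_1,d_2,d_1d_2)$ be maps $D^2\to D^2\oplus D$. There is a unique $\gamma\in X\otimes\mathcal{W}_{D^2\oplus D}$ with $(\mathrm{id}_X\otimes\mathcal{W}_\psi)(\gamma)=\gamma_1$, $(\mathrm{id}_X\otimes\mathcal{W}_\varphi)(\gamma)=\gamma_2$; define $\gamma_1\overset{\cdot}{-}\gamma_2\in X\otimes\mathcal{W}_D$ as the pullback of $\gamma$ along $d\mapsto(0,0,d)$. Icons and forms. $\delta_M^p:M\otimes\mathcal{W}_{D^p}\to M$ is the canonical projection. A $(1,p)$-icon on $M$ is an element $\xi\in[M\otimes\mathcal{W}_{D^p}\to M]\otimes\mathcal{W}_D$ with foot point $\pi(\xi)=\delta_M^p$. For $\gamma\in M\otimes\mathcal{W}_{D^p}$, $\alpha\in\mathbb{R}$, $1\le i\le p$, let $\alpha\underset{i}{\cdot}\gamma$ be the pullback of $\gamma$ along $(d_1,\dots,d_p)\mapsto(d_1,\dots,\alpha d_i,\dots,d_p)$; for $\sigma\in\mathbb{S}_p$ let $\gamma^\sigma$ be the pullback along $(d_1,\dots,d_p)\mapsto(d_{\sigma(1)},\dots,d_{\sigma(p)})$. For $\eta\in[M\otimes\mathcal{W}_{D^p}\to M]$ let $\eta^\sigma(\gamma)=\eta(\gamma^\sigma)$, and for $\xi\in[M\otimes\mathcal{W}_{D^p}\to M]\otimes\mathcal{W}_D$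 let $\xi^\sigma$ be the image of $\xi$ under $((\ )^\sigma)\otimes\mathrm{id}_{\mathcal{W}_D}$. A tangent-vector-valued $p$-semiform on $M$ is a $(1,p)$-icon $\xi$ such that $(((\alpha\underset{i}{\cdot})^* )\otimes\mathrm{id}_{\mathcal{W}_D})(\xi)=\alpha\xi$ for all $\alpha,i$ (where $(\alpha\underset{i}{\cdot})^*$ is precomposition with $\gamma\mapsto\alpha\underset{i}{\cdot}\gamma$); it is a tangent-vector-valued $p$-form if moreover $\xi^\sigma=\varepsilon_\sigma\xi$ for all $\sigma\in\mathbb{S}_p$, $\varepsilon_\sigma$ being the sign. Brackets. For $\eta_1\in[M\otimes\mathcal{W}_{D^p}\to M]$, $\eta_2\in[M\otimes\mathcal{W}_{D^q}\to M]$: $\eta_1*\eta_2\in[M\otimes\mathcal{W}_{D^{p+q}}\to M]$ is $M\otimes\mathcal{W}_{D^{p+q}}=M\otimes(\mathcal{W}_{D^q}\otimes_\infty\mathcal{W}_{D^p})=(M\otimes\mathcal{W}_{D^q})\otimes\mathcal{W}_{D^p}\xrightarrow{\eta_2\otimes\mathrm{id}}M\otimes\mathcal{W}_{D^p}\xrightarrow{\eta_1}M$ (the first $p$ coordinates of $D^{p+q}$ being the $\mathcal{W}_{D^p}$ factor, the last $q$ the $\mathcal{W}_{D^q}$ factor), and $\eta_1\widetilde{*}\eta_2$ is $M\otimes\mathcal{W}_{D^{p+q}}=(M\otimes\mathcal{W}_{D^p})\otimes\mathcal{W}_{D^q}\xrightarrow{\eta_1\otimes\mathrm{id}}M\otimes\mathcal{W}_{D^q}\xrightarrow{\eta_2}M$.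 For a $(1,p)$-icon $\xi_1$ and a $(1,q)$-icon $\xi_2$, let $\xi_1\circledast\xi_2$ and $\xi_1\widetilde{\circledast}\xi_2$ in $[M\otimes\mathcal{W}_{D^{p+q}}\to M]\otimes\mathcal{W}_{D^2}$ be obtained by pulling $\xi_1$ back along $(d_1,d_2)\mapsto d_1$, $\xi_2$ along $(d_1,d_2)\mapsto d_2$, and applying $*\otimes\mathrm{id}_{\mathcal{W}_{D^2}}$, resp. $\widetilde{*}\otimes\mathrm{id}_{\mathcal{W}_{D^2}}$. These agree on $D(2)$, and the Lie bracket is the $(1,p+q)$-icon $[\xi_1,\xi_2]_L=\xi_1\widetilde{\circledast}\xi_2\overset{\cdot}{-}\xi_1\circledast\xi_2$. For a $(1,n)$-icon $\xi$, $\mathcal{A}\xi=\sum_{\sigma\in\mathbb{S}_n}\varepsilon_\sigma\xi^\sigma$ (sum of tangent vectors at $\delta^n_M$), and for $n=p+q$, $\mathcal{A}_{p,q}\xi=\frac{1}{p!q!}\mathcal{A}\xi$. For a tangent-vector-valued $p$-form $\xi_1$ and $q$-form $\xi_2$, the Frölicher-Nijenhuis bracket is the tangent-vector-valued $(p+q)$-form $[\xi_1,\xi_2]_{FN}=\mathcal{A}_{p,q}([\xi_1,\xi_2]_L)$. *)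

(* Defs.v *)
(* Written with MathComp-Analysis; the real numbers are any R : realType. *)
From HB Require Import structures.
From mathcomp Require Import all_boot all_order all_algebra perm ring.
From mathcomp Require Import boolp classical_sets functions reals topology.
From mathcomp Require Import normedtype derive.

Set Implicit Arguments.
Unset Strict Implicit.
Unset Printing Implicit Defensive.

Import Order.TTheory GRing.Theory Num.Theory.
Import numFieldNormedType.Exports.

Local Open Scope classical_set_scope.
Local Open Scope ring_scope.
Local Open Scope quotient_scope.

Declare Scope frolicher_scope.
Delimit Scope frolicher_scope with FS.
Local Open Scope frolicher_scope.

Reserved Notation "X ⊗ W" (at level 40, left associativity).

Section SmoothReal.
Variable R : realType.

Definition smooth1 (f : R -> R) : Prop :=
  forall (n : nat) (x : R), derivable (derive1n n f) x 1.

Lemma smooth1_derive f : smooth1 f -> smooth1 (derive1 f).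
Proof. by move=> sf n x; rewrite -derive1Sn; exact: sf. Qed.

Lemma smooth1_derivable f : smooth1 f -> forall x, derivable f x 1.
Proof. by move=> sf; exact: (sf 0%N). Qed.

Lemma smooth1_cst (a : R) : smooth1 (fun=> a).
Proof.
suff H n : exists b : R, derive1n n (fun=> a : R) = (fun=> b).
  by move=> n x; have [b ->] := H n; exact: derivable_cst.
elim: n => [|n [b IH]]; first by exists a.
by exists 0; rewrite derive1nS IH; apply/funext => x; rewrite derive1_cst.
Qed.

Lemma smooth1_id : smooth1 (fun x => x).
Proof.
case=> [|n] x; first exact: derivable_id.
rewrite derive1Sn.
have -> : derive1 (fun x : R => x) = (fun=> 1).
  by apply/funext => y; rewrite derive1E derive_id.
exact: smooth1_cst.
Qed.

Lemma derive1D_fun (f g : R -> R) : smooth1 f -> smooth1 g ->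
  derive1 (fun x => f x + g x) = (fun x => derive1 f x + derive1 g x).
Proof.
move=> sf sg; apply/funext => x; rewrite !derive1E.
by apply: deriveD; exact: smooth1_derivable.
Qed.

Lemma smooth1D (f g : R -> R) :
  smooth1 f -> smooth1 g -> smooth1 (fun x => f x + g x).
Proof.
move=> sf sg n; elim: n f g sf sg => [|n IH] f g sf sg x.
  by apply: derivableD; exact: smooth1_derivable.
rewrite derive1Sn derive1D_fun//; apply: IH; exact: smooth1_derive.
Qed.

Lemma derive1M_fun (f g : R -> R) : smooth1 f -> smooth1 g ->
  derive1 (fun x => f x * g x) = (fun x => f x * derive1 g x + g x * derive1 f x).
Proof.
move=> sf sg; apply/funext => x; rewrite !derive1E.
by apply: deriveM; exact: smooth1_derivable.
Qed.

Lemma derive1nD_fun n (u v : R -> R) :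
  (forall k, (k <= n)%N -> forall x : R, derivable (derive1n k u) x 1) ->
  (forall k, (k <= n)%N -> forall x : R, derivable (derive1n k v) x 1) ->
  forall k, (k <= n)%N ->
    derive1n k (fun x => u x + v x) = (fun x => derive1n k u x + derive1n k v x).
Proof.
move=> du dv; elim=> [//|k IHk] lk; rewrite !derive1nS IHk ?(ltnW lk)//.
apply/funext => y; rewrite !derive1E; apply: deriveD.
  by apply: du; exact: ltnW.
by apply: dv; exact: ltnW.
Qed.

Lemma derivable_nM n (f g : R -> R) : smooth1 f -> smooth1 g ->
  forall m, (m <= n)%N ->
  forall x : R, derivable (derive1n m (fun x => f x * g x)) x 1.
Proof.
elim: n f g => [|n IH] f g sf sg [|m] // lmn x.
- by apply: derivableM; exact: smooth1_derivable.
- by apply: derivableM; exact: smooth1_derivable.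
have dM1 := IH _ _ sf (smooth1_derive sg).
have dM2 := IH _ _ sg (smooth1_derive sf).
rewrite derive1Sn derive1M_fun// (@derive1nD_fun n _ _ dM1 dM2 m lmn).
by apply: derivableD; [exact: (dM1 m lmn)|exact: (dM2 m lmn)].
Qed.

Lemma smooth1M (f g : R -> R) :
  smooth1 f -> smooth1 g -> smooth1 (fun x => f x * g x).
Proof. by move=> sf sg n x; exact: (@derivable_nM n). Qed.

End SmoothReal.

Record frolicher (R : realType) := Frolicher {
  carrier :> Type;
  curves : set (R -> carrier);
  funcs : set (carrier -> R);
  curvesE : forall c, curves c <-> forall f, funcs f -> smooth1 (f \o c);
  funcsE : forall f, funcs f <-> forall c, curves c -> smooth1 (f \o c)
}.
Arguments curves {R} _ _.
Arguments funcs {R} _ _.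

Section Frolicher.
Variable R : realType.
Implicit Types X Y Z : frolicher R.

Definition init_curves (T : Type) (F : set (T -> R)) : set (R -> T) :=
  [set c : R -> T | forall f, F f -> smooth1 (f \o c)].
Definition init_funcs (T : Type) (F : set (T -> R)) : set (T -> R) :=
  [set f : T -> R | forall c, init_curves F c -> smooth1 (f \o c)].

Lemma init_curvesE (T : Type) (F : set (T -> R)) (c : R -> T) :
  init_curves F c <-> forall f, init_funcs F f -> smooth1 (f \o c).
Proof.
by split=> [cc f|H f Ff]; [exact|apply: H => c'; exact].
Qed.

Definition init_frolicher (T : Type) (F : set (T -> R)) : frolicher R :=
  Frolicher (@init_curvesE T F) (fun f => iff_refl (init_funcs F f)).

Definition final_funcs (T : Type) (C : set (R -> T)) : set (T -> R) :=
  [set f : T -> R | forall c, C c -> smooth1 (f \o c)].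
Definition final_curves (T : Type) (C : set (R -> T)) : set (R -> T) :=
  [set c : R -> T | forall f, final_funcs C f -> smooth1 (f \o c)].

Lemma final_funcsE (T : Type) (C : set (R -> T)) (f : T -> R) :
  final_funcs C f <-> forall c, final_curves C c -> smooth1 (f \o c).
Proof.
by split=> [ff c|H c Cc]; [exact|apply: H => f'; exact].
Qed.

Definition final_frolicher (T : Type) (C : set (R -> T)) : frolicher R :=
  Frolicher (fun c => iff_refl (final_curves C c)) (@final_funcsE T C).

Definition is_smooth X Y (f : X -> Y) : Prop :=
  forall c, curves X c -> curves Y (f \o c).

Record smap X Y := SMap { smap_fun :> X -> Y; smapP : is_smooth smap_fun }.
Arguments smapP {X Y} s c _ : rename.

Lemma is_smoothE X Y (f : X -> Y) :
  is_smooth f <-> forall h, funcs Y h -> funcs X (h \o f).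
Proof.
split=> [sf h Yh|H c Xc].
  by apply/funcsE => c Xc; apply: (proj1 (funcsE _) Yh); exact: sf.
by apply/curvesE => h /H Xh; exact: (proj1 (funcsE _) Xh).
Qed.

Arguments is_smoothE : clear implicits.
Lemma funcs_comp X Y (f : smap X Y) (h : Y -> R) :
  funcs Y h -> funcs X (h \o f).
Proof. by case: f => f sf Yh; exact: (proj1 (is_smoothE X Y f) sf). Qed.

Lemma smooth_to_init X (T : Type) (F : set (T -> R)) (f : X -> T) :
  (forall h, F h -> funcs X (h \o f)) -> @is_smooth X (init_frolicher F) f.
Proof. by move=> H c Xc h Fh; exact: (proj1 (funcsE _) (H h Fh)). Qed.

Lemma smooth_from_final Y (T : Type) (C : set (R -> T)) (f : T -> Y) :
  (forall c, C c -> curves Y (f \o c)) -> @is_smooth (final_frolicher C) Y f.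
Proof.
move=> H; apply/is_smoothE => h Yh c Cc.
by apply: (proj1 (funcsE _) Yh); exact: H.
Qed.

Lemma is_smooth_cst X Y (y : Y) : @is_smooth X Y (fun=> y).
Proof. by move=> c _; apply/curvesE => f _; exact (@smooth1_cst R (f y)). Qed.
Definition smap_cst X Y (y : Y) : smap X Y := SMap (@is_smooth_cst X Y y).

Definition smap_id X : smap X X := @SMap X X (fun x => x) (fun c Xc => Xc).

Lemma is_smooth_comp X Y Z (g : smap Y Z) (f : smap X Y) : is_smooth (g \o f).
Proof. by move=> c /(smapP f) /(smapP g). Qed.
Definition smap_comp X Y Z (g : smap Y Z) (f : smap X Y) : smap X Z :=
  SMap (@is_smooth_comp X Y Z g f).

Definition is_iso X Y (f : smap X Y) : Prop :=
  exists g : smap Y X, cancel f g /\ cancel g f.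

(* [smooth_or d f] is [f], bundled as a smooth map; the default [d] is returned
   only if [f] is not smooth.  It is used below for the currying of plots and
   for the operations [star], [stilde], whose smoothness is a consequence of
   Boman's theorem, cartesian closedness and Weil exponentiability. *)
Definition smooth_or X Y (d : smap X Y) (f : X -> Y) : smap X Y :=
  if pselect (is_smooth f) is left sf then SMap sf else d.

Definition prod_frolicher X Y : frolicher R :=
  @init_frolicher (X * Y)%type
    [set k | (exists2 h, funcs X h & k = h \o fst) \/
             (exists2 h, funcs Y h & k = h \o snd)].

Lemma is_smooth_fst X Y : @is_smooth (prod_frolicher X Y) X fst.
Proof.
by move=> c cc; apply/curvesE => h Xh; apply: (cc (h \o fst)); left; exists h.
Qed.

Lemma is_smooth_snd X Y : @is_smooth (prod_frolicher X Y) Y snd.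
Proof.
by move=> c cc; apply/curvesE => h Yh; apply: (cc (h \o snd)); right; exists h.
Qed.

Lemma is_smooth_pair Z X Y (f : smap Z X) (g : smap Z Y) :
  @is_smooth Z (prod_frolicher X Y) (fun z => (f z, g z)).
Proof.
apply: smooth_to_init => k [] [h hh ->].
  exact: funcs_comp.
exact: funcs_comp.
Qed.
Definition smap_pair Z X Y (f : smap Z X) (g : smap Z Y) :
  smap Z (prod_frolicher X Y) := SMap (@is_smooth_pair Z X Y f g).

Definition real_line : frolicher R := @init_frolicher R [set id].

(* The smooth curves of the function space are the c : R -> smap X Y whose
   transpose R * X -> Y is smooth; generating the structure from these curves
   adds no curve (this is the cartesian closedness theorem). *)
Definition hom_frolicher X Y : frolicher R :=
  @final_frolicher (smap X Y)
    [set c | @is_smooth (prod_frolicher real_line X) Y (fun p => c p.1 p.2)].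

Lemma is_smooth_ev X Y (x : X) :
  @is_smooth (hom_frolicher X Y) Y (fun f => f x).
Proof.
apply: smooth_from_final => c cc.
suff /cc : curves (prod_frolicher real_line X) (fun t => (t, x)) by [].
move=> k [] [h hh ->]; last exact: (@smooth1_cst R (h x)).
by apply: (proj1 (funcsE _) hh (fun t => t)) => g ->; exact: smooth1_id.
Qed.
Definition smap_ev X Y (x : X) : smap (hom_frolicher X Y) Y :=
  SMap (@is_smooth_ev X Y x).

Lemma is_smooth_precomp X Y Z (u : smap X Y) :
  @is_smooth (hom_frolicher Y Z) (hom_frolicher X Z)
    (fun f : smap Y Z => smap_comp f u).
Proof.
apply: smooth_from_final => c cc f; apply.
move=> d cd; apply: (cc (fun t => ((d t).1, u (d t).2))).
move=> k [] [h hh ->].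
  by apply: (cd (h \o fst)); left; exists h.
apply: (cd (h \o u \o snd)); right; exists (h \o u) => //.
exact: funcs_comp.
Qed.
Definition smap_precomp X Y (u : smap X Y) Z :
    smap (hom_frolicher Y Z) (hom_frolicher X Z) :=
  SMap (@is_smooth_precomp X Y Z u).

(* the n-th power of the real line; its curves are the componentwise smooth
   ones and, by Boman's theorem, its functions are the C^oo functions. *)
Definition rspace (n : nat) : frolicher R :=
  @init_frolicher 'rV[R]_n [set k | exists i, k = (fun x : 'rV_n => x 0 i)].

Definition Cinf (n : nat) : set ('rV[R]_n -> R) := funcs (rspace n).

Lemma Cinf_cst n (a : R) : @Cinf n (fun=> a).
Proof. by move=> c _; exact: (@smooth1_cst R a). Qed.

Lemma Cinf_coord n (i : 'I_n) : @Cinf n (fun x : 'rV_n => x 0 i).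
Proof. by move=> c cc; apply: cc; exists i. Qed.

Lemma CinfD n (f g : 'rV[R]_n -> R) :
  Cinf f -> Cinf g -> Cinf (fun x => f x + g x).
Proof. by move=> sf sg c cc; apply: smooth1D; [exact: sf|exact: sg]. Qed.

Lemma CinfM n (f g : 'rV[R]_n -> R) :
  Cinf f -> Cinf g -> Cinf (fun x => f x * g x).
Proof. by move=> sf sg c cc; apply: smooth1M; [exact: sf|exact: sg]. Qed.

Lemma Cinf_smap n X (f : smap (rspace n) X) h : funcs X h -> Cinf (h \o f).
Proof. exact: funcs_comp. Qed.

Lemma rspace_smooth X n (f : X -> 'rV[R]_n) :
  (forall i, funcs X (fun x => f x 0 i)) -> @is_smooth X (rspace n) f.
Proof. by move=> H; apply: smooth_to_init => h [i ->]; exact: H. Qed.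

Definition is_ideal n (I : set ('rV[R]_n -> R)) : Prop :=
  [/\ I `<=` @Cinf n, I (fun=> 0),
      forall f g, I f -> I g -> I (fun x => f x + g x) &
      forall a f, Cinf a -> I f -> I (fun x => a x * f x)].

(* C^oo(R^n)/I together with the augmentation "evaluation at 0" *)
Record pres := Pres {
  pdim : nat;
  pideal : set ('rV[R]_pdim -> R);
  pidealP : is_ideal pideal;
  pideal_at0 : forall f, pideal f -> f 0 = 0
}.
Arguments pideal : clear implicits.

(* C^oo(R^n)/I is finite-dimensional and local with residue field R; as I is
   contained in the ideal of 0, the maximal ideal consists of the classes of
   functions vanishing at 0 *)
Definition is_weil (W : pres) : Prop :=
  (exists k, exists b : 'I_k -> 'rV[R]_(pdim W) -> R,
     (forall i, Cinf (b i)) /\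
     forall f, Cinf f -> exists a : 'I_k -> R,
       pideal W (fun x => f x - \sum_i a i * b i x)) /\
  (forall f, Cinf f -> f 0 != 0 ->
     exists2 g, Cinf g & pideal W (fun x => f x * g x - 1)).

(* Morphisms C^oo(R^n)/I -> C^oo(R^m)/J, represented contravariantly by smooth
   maps R^m -> R^n; two representatives are identified by [whom_eq].  Every
   homomorphism of Weil algebras is of this form. *)
Record whom (W W' : pres) := WHom {
  whom_map :> smap (rspace (pdim W')) (rspace (pdim W));
  whom_at0 : whom_map 0 = 0;
  whom_ideal : forall f, pideal W f -> pideal W' (f \o whom_map)
}.

Definition whom_eq (W W' : pres) (u v : whom W W') : Prop :=
  forall f, Cinf f -> pideal W' (fun x => f (u x) - f (v x)).

Definition whom_id (W : pres) : whom W W :=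
  @WHom W W (smap_id _) erefl (fun f If => If).

Lemma whom_comp_at0 W W' W'' (v : whom W' W'') (u : whom W W') :
  smap_comp u v 0 = 0.
Proof. by rewrite /= (whom_at0 v) whom_at0. Qed.

Definition whom_comp W W' W'' (v : whom W' W'') (u : whom W W') : whom W W'' :=
  @WHom W W'' (smap_comp u v) (whom_comp_at0 v u)
    (fun f If => whom_ideal v (whom_ideal u If)).

Lemma pidealN (W : pres) f : pideal W f -> pideal W (fun x => - f x).
Proof.
have [_ _ _ IM] := pidealP W => If.
have -> : (fun x => - f x) = (fun x => (-1) * f x).
  by apply/funext => x; rewrite mulN1r.
by apply: IM => //; exact: Cinf_cst.
Qed.

Definition gen_ideal n (S : set ('rV[R]_n -> R)) : set ('rV[R]_n -> R) :=
  [set f | forall I, is_ideal I -> S `<=` I -> I f].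

Lemma gen_idealP n (S : set ('rV[R]_n -> R)) :
  S `<=` @Cinf n -> is_ideal (gen_ideal S).
Proof.
move=> SC; split=> [f Sf|I [_ I0 _ _] _|f g Sf Sg I II SI|a f Ca Sf I II SI].
- apply: (Sf (@Cinf n) _ SC); split; first exact (fun _ h => h).
  + exact (@Cinf_cst _ 0).
  + exact (@CinfD n).
  + exact (@CinfM n).
- exact I0.
- by have [_ _ ID _] := II; exact (ID _ _ (Sf I II SI) (Sg I II SI)).
- by have [_ _ _ IM] := II; exact (IM _ _ Ca (Sf I II SI)).
Qed.

Lemma gen_ideal_at0 n (S : set ('rV[R]_n -> R)) :
  S `<=` @Cinf n -> (forall f, S f -> f 0 = 0) ->
  forall f, gen_ideal S f -> f 0 = 0.
Proof.
move=> SC S0 f Sf.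
suff [] : [set g | Cinf g /\ g 0 = 0] f by [].
apply: Sf => [|g Sg]; last by split; [exact: SC|exact: S0].
split=> [g [Cg _]||g h [Cg g0] [Ch h0]|a g Ca [Cg g0]].
- exact Cg.
- by split; first exact (@Cinf_cst _ 0).
- by split; [exact (@CinfD _ _ _ Cg Ch)|rewrite g0 h0 addr0].
- by split; [exact (@CinfM _ _ _ Ca Cg)|rewrite g0 mulr0].
Qed.

Definition gen_pres n (S : set ('rV[R]_n -> R)) (SC : S `<=` @Cinf n)
    (S0 : forall f, S f -> f 0 = 0) : pres :=
  Pres (gen_idealP SC) (gen_ideal_at0 SC S0).

Lemma gen_ideal_incl n (S : set ('rV[R]_n -> R)) : S `<=` gen_ideal S.
Proof. by move=> f Sf I _; apply. Qed.

Lemma gen_ideal_comp n (S : set ('rV[R]_n -> R)) (W' : pres)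
    (u : smap (rspace (pdim W')) (rspace n)) :
  S `<=` @Cinf n -> (forall f, S f -> pideal W' (f \o u)) ->
  forall f, gen_ideal S f -> pideal W' (f \o u).
Proof.
move=> SC Su f Sf; have [IC I0 ID IM] := pidealP W'.
suff [] : [set g | Cinf g /\ pideal W' (g \o u)] f by [].
apply: Sf => [|g Sg]; last by split; [exact: SC|exact: Su].
split=> [g [Cg _]||g h [Cg g0] [Ch h0]|a g Ca [Cg g0]].
- exact Cg.
- by split; [exact (@Cinf_cst _ 0)|exact I0].
- by split; [exact (@CinfD _ _ _ Cg Ch)|exact (ID _ _ g0 h0)].
- by split; [exact (@CinfM _ _ _ Ca Cg)|exact (IM _ _ (@Cinf_smap _ _ u _ Ca) g0)].
Qed.

Definition tensor_gens (W1 W2 : pres) :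
    set ('rV[R]_(pdim W1 + pdim W2) -> R) :=
  [set k | (exists2 f, pideal W1 f & k = f \o lsubmx) \/
           (exists2 g, pideal W2 g & k = g \o rsubmx)].

Lemma lsubmx_smooth m n :
  @is_smooth (rspace (m + n)) (rspace m) (lsubmx : 'rV[R]_(m + n) -> 'rV[R]_m).
Proof.
apply: rspace_smooth => i; have := @Cinf_coord (m + n) (lshift n i).
by congr (Cinf _); apply/funext => x; rewrite mxE.
Qed.

Lemma rsubmx_smooth m n :
  @is_smooth (rspace (m + n)) (rspace n) (rsubmx : 'rV[R]_(m + n) -> 'rV[R]_n).
Proof.
apply: rspace_smooth => i; have := @Cinf_coord (m + n) (rshift m i).
by congr (Cinf _); apply/funext => x; rewrite mxE.
Qed.

Lemma tensor_gens_sub W1 W2 : @tensor_gens W1 W2 `<=` @Cinf _.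
Proof.
move=> k [] [f If ->].
  have [IC _ _ _] := pidealP W1.
  exact: (@Cinf_smap _ _ (SMap (@lsubmx_smooth (pdim W1) (pdim W2))) f (IC _ If)).
have [IC _ _ _] := pidealP W2.
exact: (@Cinf_smap _ _ (SMap (@rsubmx_smooth (pdim W1) (pdim W2))) f (IC _ If)).
Qed.

Lemma tensor_gens_at0 W1 W2 f : @tensor_gens W1 W2 f -> f 0 = 0.
Proof. by move=> [] [g /pideal_at0 + ->] /=; rewrite raddf0. Qed.

Definition tensor (W1 W2 : pres) : pres :=
  gen_pres (@tensor_gens_sub W1 W2) (@tensor_gens_at0 W1 W2).

(* C^oo(R^n) modulo the monomials X_i X_j for (i, j) in s; if s contains all the
   (i, i), this is R[X_1, .., X_n] modulo the same monomials *)
Definition quad_gens n (s : seq ('I_n * 'I_n)) : set ('rV[R]_n -> R) :=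
  [set f | exists2 ij, ij \in s & f = (fun x : 'rV_n => x 0 ij.1 * x 0 ij.2)].

Lemma quad_gens_sub n s : @quad_gens n s `<=` @Cinf n.
Proof. by move=> f [ij _ ->]; apply: CinfM; exact: Cinf_coord. Qed.

Lemma quad_gens_at0 n s f : @quad_gens n s f -> f 0 = 0.
Proof. by move=> [ij _ ->]; rewrite mxE mul0r. Qed.

Definition quad_pres n (s : seq ('I_n * 'I_n)) : pres :=
  gen_pres (@quad_gens_sub n s) (@quad_gens_at0 n s).

(* [WD n] is W_{D^n}, [WD_2] is W_{D(2)}, [WD2D] is W_{D^2 (+) D} *)
Definition WD (n : nat) : pres := quad_pres [seq (i, i) | i <- enum 'I_n].
Definition WD_2 : pres := @quad_pres 2 [:: (0, 0); (1, 1); (0, 1)].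
Definition WD2D : pres :=
  @quad_pres 3 [:: (0, 0); (1, 1); (2, 2); (0, 2); (1, 2)].

Section Prolongation.
Variables (X : frolicher R) (W : pres).

Definition plot := smap (rspace (pdim W)) X.

Definition plot_rel : rel {classic plot} := fun f g : plot =>
  `[< f 0 = g 0 /\
      forall h, funcs X h -> pideal W (fun x => h (f x) - h (g x)) >].

Lemma plot_rel_refl : reflexive plot_rel.
Proof.
move=> f; apply/asboolP; split=> // h _.
have -> : (fun x => h ((f : plot) x) - h ((f : plot) x)) = (fun=> 0).
  by apply/funext => x; rewrite subrr.
by have [] := pidealP W.
Qed.

Lemma plot_rel_sym : symmetric plot_rel.
Proof.
suff H f g : plot_rel f g -> plot_rel g f by move=> f g; apply/idP/idP => /H.
move=> /asboolP[e0 eh]; apply/asboolP; split=> // h /eh /pidealN.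
by congr (pideal W _); apply/funext => x; rewrite opprB.
Qed.

Lemma plot_rel_trans : transitive plot_rel.
Proof.
move=> g f k /asboolP[e0 eh] /asboolP[e0' eh']; apply/asboolP.
split=> [|h hh]; first exact: etrans e0'.
have [_ _ + _] := pidealP W => /(_ _ _ (eh h hh) (eh' h hh)).
by congr (pideal W _); apply/funext => x; rewrite addrA subrK.
Qed.

Definition plot_equiv := EquivRel plot_rel plot_rel_refl plot_rel_sym plot_rel_trans.
Canonical plot_equiv.

Definition prol_type : Type := {eq_quot plot_rel}.

Definition pclass (f : plot) : prol_type := \pi_({eq_quot plot_rel}) f.
Definition prepr (u : prol_type) : plot := repr (u : {eq_quot plot_rel}).

Lemma preprK u : pclass (prepr u) = u. Proof. exact: reprK. Qed.

Lemma pclass_eqP (f g : plot) : pclass f = pclass g <->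
  f 0 = g 0 /\ forall h, funcs X h -> pideal W (fun x => h (f x) - h (g x)).
Proof.
rewrite /pclass; split=> [/eqmodP/asboolP|H]; first exact.
by apply/eqmodP/asboolP.
Qed.

Lemma pclassP (f : plot) : prepr (pclass f) 0 = f 0 /\
  forall h, funcs X h -> pideal W (fun x => h (prepr (pclass f) x) - h (f x)).
Proof. by apply/pclass_eqP; exact: preprK. Qed.

Definition is_linform (l : ('rV[R]_(pdim W) -> R) -> R) : Prop :=
  (forall a f g, Cinf f -> Cinf g -> l (fun x => a * f x + g x) = a * l f + l g)
  /\ forall f, pideal W f -> l f = 0.

(* The initial structure for the maps h (x) W : X (x) W -> W, with h a smooth
   function on X and with the vector space W having the structure generated by
   its linear forms. *)
Definition prol_funcs : set (prol_type -> R) :=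
  [set k | exists h l, [/\ funcs X h, is_linform l &
    forall f : plot, k (pclass f) = l (h \o f)]].

Definition prol : frolicher R := init_frolicher prol_funcs.

Lemma linform_eq l (f g : 'rV[R]_(pdim W) -> R) : is_linform l ->
  Cinf f -> Cinf g -> pideal W (fun x => f x - g x) -> l f = l g.
Proof.
move=> [lD lI] Cf Cg /lI.
have -> : (fun x => f x - g x) = (fun x => (-1) * g x + f x).
  by apply/funext => x; rewrite mulN1r addrC.
by rewrite lD// mulN1r addrC => /eqP; rewrite subr_eq0 => /eqP.
Qed.

Lemma prol_funcP k : prol_funcs k <-> exists h l,
  [/\ funcs X h, is_linform l & forall u, k u = l (h \o prepr u)].
Proof.
split=> -[h [l [hh ll kE]]]; exists h, l; split=> // u.
  by rewrite -{1}(preprK u) kE.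
rewrite kE; apply: linform_eq => //; [exact: Cinf_smap|exact: Cinf_smap|].
by have [_] := pclassP u; exact.
Qed.

Lemma prol_proj_smooth : @is_smooth prol X (fun u => prepr u 0).
Proof.
apply/is_smoothE => h Xh c cc; apply: cc; apply/prol_funcP.
exists h, (fun f => f 0); split=> //; split=> // f; exact: pideal_at0.
Qed.
Definition prol_proj : smap prol X := SMap prol_proj_smooth.

Lemma prol_cst_smooth : @is_smooth X prol (fun x => pclass (smap_cst _ x)).
Proof.
apply: smooth_to_init => k [h [l [Xh ll kE]]]; apply/funcsE => c Xc.
have -> : k \o (fun x => pclass (smap_cst _ x)) \o c =
          (fun t => h (c t) * l (fun=> 1)).
  apply/funext => t /=; rewrite kE; case: ll => lD lI.
  have l0 : l (fun=> 0) = 0 by apply: lI; have [] := pidealP W.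
  have := lD (h (c t)) _ _ (@Cinf_cst _ 1) (@Cinf_cst _ 0).
  rewrite l0 !addr0 => <-; congr l; apply/funext => x /=.
  by rewrite mulr1.
apply: smooth1M; first exact: (proj1 (funcsE _) Xh).
exact: (@smooth1_cst R (l (fun=> 1))).
Qed.
Definition prol_cst : smap X prol := SMap prol_cst_smooth.

End Prolongation.
Arguments pclass {X W} f.
Arguments prepr {X W} u.
Notation "X ⊗ W" := (prol X W) : frolicher_scope.

Lemma prol_map_smooth X Y (g : smap X Y) W :
  @is_smooth (X ⊗ W) (Y ⊗ W) (fun u => pclass (smap_comp g (prepr u))).
Proof.
apply: smooth_to_init => k [h [l [Yh ll kE]]] c cc; apply: cc.
apply/prol_funcP; exists (h \o g), l; split=> [||u]//; first exact: funcs_comp.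
by rewrite /= kE.
Qed.
Definition prol_map X Y (g : smap X Y) W : smap (X ⊗ W) (Y ⊗ W) :=
  SMap (@prol_map_smooth X Y g W).

Lemma prol_whom_smooth X W W' (u : whom W W') :
  @is_smooth (X ⊗ W) (X ⊗ W') (fun a => pclass (smap_comp (prepr a) u)).
Proof.
apply: smooth_to_init => k [h [l [Xh [lD lI] kE]]] c cc; apply: cc.
apply/prol_funcP; exists h, (fun f => l (f \o u)); split=> // [|a].
  split=> [a f g Cf Cg|f If]; last by apply: lI; exact: whom_ideal.
  exact (lD a (f \o u) (g \o u) (@Cinf_smap _ _ u _ Cf) (@Cinf_smap _ _ u _ Cg)).
by rewrite /= kE.
Qed.
Definition prol_whom X W W' (u : whom W W') : smap (X ⊗ W) (X ⊗ W') :=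
  SMap (@prol_whom_smooth X W W' u).

Lemma prol_mapE X Y (g : smap X Y) W (f : plot X W) :
  prol_map g W (pclass f) = pclass (smap_comp g f).
Proof.
have [f0 fh] := pclassP f; apply/pclass_eqP; split=> [|h Yh] /=.
  by rewrite f0.
exact: (fh (h \o g) (funcs_comp g Yh)).
Qed.

Lemma prol_whomE X W W' (u : whom W W') (f : plot X W) :
  prol_whom X u (pclass f) = pclass (smap_comp f u).
Proof.
have [f0 fh] := pclassP f; apply/pclass_eqP; split=> [|h Xh] /=.
  by rewrite whom_at0.
exact: (whom_ideal u (fh h Xh)).
Qed.

(* the isomorphism (X (x) W) * (Y (x) W) -> (X * Y) (x) W; for a Weil algebra W
   it does not depend on the chosen representatives *)
Definition prol_pair X Y W (a : X ⊗ W) (b : Y ⊗ W) : prod_frolicher X Y ⊗ W :=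
  pclass (smap_pair (prepr a) (prepr b)).

(* The canonical map X (x) (W1 (x) W2) -> (X (x) W1) (x) W2, which sends the
   class of f to the class of t |-> class of (s |-> f (s, t)).  It is used for X
   Weil exponentiable, where it is an isomorphism. *)
Section Currying.
Variables (X : frolicher R) (W1 W2 : pres).

Lemma row_mx_smooth m n (t : 'rV[R]_n) :
  @is_smooth (rspace m) (rspace (m + n)) (fun s => row_mx s t).
Proof.
apply: rspace_smooth => i; rewrite -(fintype.splitK i); case: (fintype.split i) => j /=.
  have := @Cinf_coord m j; congr (Cinf _); apply/funext => s.
  by rewrite row_mxEl.
have := @Cinf_cst m (t 0 j); congr (Cinf _); apply/funext => s.
by rewrite row_mxEr.
Qed.

Definition slice (f : plot X (tensor W1 W2)) (t : 'rV[R]_(pdim W2)) : X ⊗ W1 :=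
  pclass (smap_comp f (SMap (@row_mx_smooth (pdim W1) (pdim W2) t))
            : plot X W1).

Definition curry_plot (f : plot X (tensor W1 W2)) : plot (X ⊗ W1) W2 :=
  @smooth_or (rspace (pdim W2)) (X ⊗ W1) (smap_cst _ (slice f 0)) (slice f).

Definition prol_curry : smap (X ⊗ tensor W1 W2) ((X ⊗ W1) ⊗ W2) :=
  @smooth_or (X ⊗ tensor W1 W2) ((X ⊗ W1) ⊗ W2)
    (smap_comp (prol_cst _ _) (smap_comp (prol_cst _ _) (prol_proj _ _)))
    (fun u => pclass (curry_plot (prepr u))).

End Currying.

Record fincat := FinCat {
  fob : finType;
  fhom : fob -> fob -> finType;
  fid : forall i, fhom i i;
  fcomp : forall i j k, fhom j k -> fhom i j -> fhom i k;
  fidl : forall i j (a : fhom i j), fcomp (fid j) a = a;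
  fidr : forall i j (a : fhom i j), fcomp a (fid i) = a;
  fcompA : forall i j k l (c : fhom k l) (b : fhom j k) (a : fhom i j),
    fcomp c (fcomp b a) = fcomp (fcomp c b) a
}.

Record wdiagram (J : fincat) := WDiagram {
  dob :> fob J -> pres;
  dmap : forall i j, fhom i j -> whom (dob i) (dob j);
  dweil : forall i, is_weil (dob i);
  dmap_id : forall i, whom_eq (dmap (fid i)) (whom_id _);
  dmap_comp : forall i j k (b : fhom j k) (a : fhom i j),
    whom_eq (dmap (fcomp b a)) (whom_comp (dmap b) (dmap a))
}.

Definition is_cone (J : fincat) (D : wdiagram J) (L : pres)
    (leg : forall i, whom L (D i)) : Prop :=
  forall i j (a : fhom i j), whom_eq (whom_comp (dmap D a) (leg i)) (leg j).

(* homomorphisms of unital R-algebras A -> C^oo(R^n)/I, given by a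
   representative of each value *)
Definition is_alghom (A : comAlgType R) (W : pres)
    (phi : A -> 'rV[R]_(pdim W) -> R) : Prop :=
  [/\ forall a, Cinf (phi a),
      forall (k : R) a b,
        pideal W (fun x => phi (k *: a + b) x - (k * phi a x + phi b x)),
      pideal W (fun x => phi 1 x - 1) &
      forall a b, pideal W (fun x => phi (a * b) x - phi a x * phi b x)].

(* Limits are taken in the category of commutative R-algebras.  (In the full
   subcategory of Weil algebras the empty and the disconnected diagrams would
   also have limits, which no nontrivial X (x) - preserves.) *)
Definition is_weil_limit (J : fincat) (D : wdiagram J) (L : pres)
    (leg : forall i, whom L (D i)) : Prop :=
  [/\ is_weil L, is_cone leg &
   forall (A : comAlgType R) (phi : forall i, A -> 'rV[R]_(pdim (D i)) -> R),
     (forall i, is_alghom (W := D i) (phi i)) ->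
     (forall i j (b : fhom i j) a,
        pideal (D j) (fun x => phi i a (dmap D b x) - phi j a x)) ->
     exists psi : A -> 'rV[R]_(pdim L) -> R,
       let factors psi := is_alghom (W := L) psi /\
         forall i a, pideal (D i) (fun x => psi a (leg i x) - phi i a x) in
       factors psi /\
       forall psi', factors psi' ->
         forall a, pideal L (fun x => psi a x - psi' a x)].

Definition is_frolicher_limit (J : fincat) (D : fob J -> frolicher R)
    (Dmap : forall i j, fhom i j -> smap (D i) (D j))
    (L : frolicher R) (leg : forall i, smap L (D i)) : Prop :=
  (forall i j (a : fhom i j), Dmap i j a \o leg i =1 leg j) /\
  forall (Z : frolicher R) (z : forall i, smap Z (D i)),
    (forall i j (a : fhom i j), Dmap i j a \o z i =1 z j) ->
    exists u : smap Z L,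
      (forall i, leg i \o u =1 z i) /\
      forall u' : smap Z L, (forall i, leg i \o u' =1 z i) -> u =1 u'.

Definition microlinear X : Prop :=
  forall (J : fincat) (D : wdiagram J) (L : pres) (leg : forall i, whom L (D i)),
    is_weil_limit leg ->
    is_frolicher_limit (fun i j (a : fhom i j) => prol_whom X (dmap D a))
      (fun i => prol_whom X (leg i)).

(* (X (x) W1)^Y (x) W2 and (X (x) (W1 (x) W2))^Y are identified by an
   isomorphism [Phi] which, at each point y of Y, is inverse to the canonical
   assignment: if [Phi u] takes at y the value "class of f", then u evaluated
   at y is the class of t |-> class of (s |-> f (s, t)).  This determines [Phi]
   and makes it natural in Y, W1 and W2. *)
Definition weil_exponentiable X : Prop :=
  forall (Y : frolicher R) (W1 W2 : pres), is_weil W1 -> is_weil W2 ->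
    exists Phi : smap (hom_frolicher Y (X ⊗ W1) ⊗ W2)
                      (hom_frolicher Y (X ⊗ tensor W1 W2)),
      is_iso Phi /\
      forall u y (f : plot X (tensor W1 W2)), Phi u y = pclass f ->
        prol_map (smap_ev (X ⊗ W1) y) W2 u = pclass (curry_plot f).

(* A polynomial map E -> E' of infinitesimal objects gives a morphism
   [whom W_{E'} W_E]. *)

Lemma pideal_eq (W : pres) f g : f =1 g -> pideal W g -> pideal W f.
Proof. by move=> /funext ->. Qed.

Lemma pideal0 (W : pres) : pideal W (fun=> 0).
Proof. by have [] := pidealP W. Qed.

Lemma pidealMl (W : pres) a f :
  Cinf a -> pideal W f -> pideal W (fun x => a x * f x).
Proof. by have [_ _ _ H] := pidealP W; exact: H. Qed.

Lemma quad_mem n (s : seq ('I_n * 'I_n)) (i j : 'I_n) :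
  (i, j) \in s -> pideal (quad_pres s) (fun x => x 0 i * x 0 j).
Proof. by move=> ijs; apply: gen_ideal_incl; exists (i, j). Qed.

Lemma WD_mem n (i : 'I_n) : pideal (WD n) (fun x => x 0 i * x 0 i).
Proof. by apply: quad_mem; apply/mapP; exists i; rewrite ?mem_enum. Qed.

Section PolynomialMap.
Variables (n : nat) (s : seq ('I_n * 'I_n)) (W' : pres).
Variable theta : 'rV[R]_(pdim W') -> 'rV[R]_n.
Hypothesis theta_smooth : forall i, Cinf (fun x => theta x 0 i).
Hypothesis theta_at0 : theta 0 = 0.
Hypothesis theta_ideal : forall i j, (i, j) \in s ->
  pideal W' (fun x => theta x 0 i * theta x 0 j).

Definition polymap_smap : smap (rspace (pdim W')) (rspace n) :=
  SMap (@rspace_smooth (rspace (pdim W')) n theta theta_smooth).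

Lemma polymap_ideal f :
  pideal (quad_pres s) f -> pideal W' (f \o polymap_smap).
Proof.
apply: gen_ideal_comp; first exact: quad_gens_sub.
by move=> _ [[i j] ijs ->]; exact: theta_ideal.
Qed.

Definition polymap : whom (quad_pres s) W' :=
  @WHom (quad_pres s) W' polymap_smap theta_at0 polymap_ideal.
End PolynomialMap.

Lemma WD_memP n (i j : 'I_n) :
  (i, j) \in [seq (i, i) | i <- enum 'I_n] -> i = j.
Proof. by move=> /mapP[k _ [-> ->]]. Qed.

(* (d_1, .., d_p) |-> (d_1, .., a d_i, .., d_p) *)
Section Scale.
Variables (p : nat) (i : 'I_p) (a : R).
Definition scale_fun (x : 'rV[R]_p) : 'rV[R]_p :=
  \row_j (if j == i then a * x 0 j else x 0 j).
Lemma scale_smooth j : Cinf (fun x => scale_fun x 0 j).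
Proof.
have [ji|ji] := eqVneq j i.
  have := CinfM (@Cinf_cst p a) (@Cinf_coord p j); congr (Cinf _).
  by apply/funext => x; rewrite mxE ji eqxx.
have := @Cinf_coord p j; congr (Cinf _).
by apply/funext => x; rewrite mxE (negbTE ji).
Qed.
Lemma scale_at0 : scale_fun 0 = 0.
Proof. by apply/rowP => j; rewrite !mxE mulr0 if_same. Qed.
Lemma scale_ideal j k : (j, k) \in [seq (i, i) | i <- enum 'I_p] ->
  pideal (WD p) (fun x => scale_fun x 0 j * scale_fun x 0 k).
Proof.
move=> /WD_memP <-.
apply: (@pideal_eq (WD p) _ (fun x : 'rV_p => (if j == i then a * a else 1) *
                                 (x 0 j * x 0 j))).
  by move=> x; rewrite mxE; case: ifP => _; rewrite ?mul1r// mulrACA.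
by apply: pidealMl; [exact: Cinf_cst|exact: WD_mem].
Qed.
Definition D_scale : whom (WD p) (WD p) :=
  @polymap p _ (WD p) scale_fun scale_smooth scale_at0 scale_ideal.
End Scale.

(* (d_1, .., d_p) |-> (d_sigma(1), .., d_sigma(p)) *)
Section Perm.
Variables (p : nat) (sigma : 'S_p).
Definition perm_fun (x : 'rV[R]_p) : 'rV[R]_p := \row_j x 0 (sigma j).
Lemma perm_smooth j : Cinf (fun x => perm_fun x 0 j).
Proof.
have := @Cinf_coord p (sigma j); congr (Cinf _).
by apply/funext => x; rewrite mxE.
Qed.
Lemma perm_at0 : perm_fun 0 = 0.
Proof. by apply/rowP => j; rewrite !mxE. Qed.
Lemma perm_ideal j k : (j, k) \in [seq (i, i) | i <- enum 'I_p] ->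
  pideal (WD p) (fun x => perm_fun x 0 j * perm_fun x 0 k).
Proof.
move=> /WD_memP <-; apply: pideal_eq (WD_mem (sigma j)) => x.
by rewrite mxE.
Qed.
Definition D_perm : whom (WD p) (WD p) :=
  @polymap p _ (WD p) perm_fun perm_smooth perm_at0 perm_ideal.
End Perm.

Lemma Cinf_row m n (s : 'rV[R]_m -> seq R) :
  (forall i, (i < n)%N -> Cinf (fun x => (s x)`_i)) ->
  forall j, Cinf (fun x => (\row_(i < n) (s x)`_i) 0 j).
Proof.
move=> H j; have := H j (ltn_ord j); congr (Cinf _).
by apply/funext => x; rewrite mxE.
Qed.

(* D -> D(2) : d |-> (b d, c d) *)
Section Line2.
Variables (b c : R).
Definition line2_fun (x : 'rV[R]_1) : 'rV[R]_2 :=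
  \row_i [:: b * x 0 0; c * x 0 0]`_i.
Lemma line2_smooth j : Cinf (fun x => line2_fun x 0 j).
Proof.
apply: Cinf_row; case=> [|[|//]] _ /=;
  by apply: CinfM; [exact: Cinf_cst|exact: Cinf_coord].
Qed.
Lemma line2_at0 : line2_fun 0 = 0.
Proof.
apply/rowP => j; rewrite !mxE !mulr0.
by case: j => [[|[|//]]].
Qed.
Lemma line2_ideal j k : (j, k) \in [:: (0, 0); (1, 1); (0, 1)] ->
  pideal (WD 1) (fun x => line2_fun x 0 j * line2_fun x 0 k).
Proof.
move=> _.
apply: (@pideal_eq (WD 1) _ (fun x : 'rV_1 => ([:: b; c]`_j * [:: b; c]`_k) *
                                 (x 0 0 * x 0 0))).
  move=> x; rewrite !mxE mulrACA.
  by case: j => [[|[|//]]] ?; case: k => [[|[|//]]] ? /=.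
by apply: pidealMl; [exact: Cinf_cst|exact: WD_mem].
Qed.
Definition D_line2 : whom WD_2 (WD 1) :=
  @polymap 2 _ (WD 1) line2_fun line2_smooth line2_at0 line2_ideal.
End Line2.

(* D^2 -> D^2 (+) D : (d_1, d_2) |-> (d_1, d_2, c d_1 d_2); this is phi for
   c = 0 and psi for c = 1 *)
Section Graph.
Variable c : R.
Definition graph_fun (x : 'rV[R]_2) : 'rV[R]_3 :=
  \row_i [:: x 0 0; x 0 1; c * (x 0 0 * x 0 1)]`_i.
Lemma graph_smooth j : Cinf (fun x => graph_fun x 0 j).
Proof.
apply: Cinf_row; case=> [|[|[|//]]] _ /=; [exact: Cinf_coord..|].
apply: CinfM; [exact: Cinf_cst|].
by apply: CinfM; exact: Cinf_coord.
Qed.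
Lemma graph_at0 : graph_fun 0 = 0.
Proof.
apply/rowP => j; rewrite !mxE !mulr0.
by case: j => [[|[|[|//]]]].
Qed.
Lemma graph_ideal j k :
  (j, k) \in [:: (0, 0); (1, 1); (2, 2); (0, 2); (1, 2)] ->
  pideal (WD 2) (fun x => graph_fun x 0 j * graph_fun x 0 k).
Proof.
pose sq (i : 'I_2) := @WD_mem 2 i.
have C0 := @Cinf_coord 2 0; have C1 := @Cinf_coord 2 1.
rewrite !inE => /or4P[|||/orP[]] /eqP[-> ->].
- by apply: pideal_eq (sq 0) => x; rewrite mxE.
- by apply: pideal_eq (sq 1) => x; rewrite mxE.
- apply: pideal_eq (@pidealMl (WD 2) _ _
    (CinfM (@Cinf_cst 2 (c * c)) (CinfM C1 C1)) (sq 0)) => x.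
  by rewrite mxE /=; ring.
- apply: pideal_eq (@pidealMl (WD 2) _ _ (CinfM (@Cinf_cst 2 c) C1) (sq 0)) => x.
  by rewrite !mxE /=; ring.
- apply: pideal_eq (@pidealMl (WD 2) _ _ (CinfM (@Cinf_cst 2 c) C0) (sq 1)) => x.
  by rewrite !mxE /=; ring.
Qed.
Definition D2_graph : whom WD2D (WD 2) :=
  @polymap 3 _ (WD 2) graph_fun graph_smooth graph_at0 graph_ideal.
End Graph.

(* D -> D^2 (+) D : d |-> (0, 0, d) *)
Definition axis3_fun (x : 'rV[R]_1) : 'rV[R]_3 := \row_i [:: 0; 0; x 0 0]`_i.
Lemma axis3_smooth j : Cinf (fun x => axis3_fun x 0 j).
Proof.
apply: Cinf_row; case=> [|[|[|//]]] _ /=; [exact: Cinf_cst..|].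
exact: Cinf_coord.
Qed.
Lemma axis3_at0 : axis3_fun 0 = 0.
Proof.
apply/rowP => j; rewrite !mxE.
by case: j => [[|[|[|//]]]].
Qed.
Lemma axis3_ideal j k :
  (j, k) \in [:: (0, 0); (1, 1); (2, 2); (0, 2); (1, 2)] ->
  pideal (WD 1) (fun x => axis3_fun x 0 j * axis3_fun x 0 k).
Proof.
rewrite !inE => /or4P[|||/orP[]] /eqP[-> ->].
- by apply: pideal_eq (pideal0 _) => x; rewrite mxE /= mulr0.
- by apply: pideal_eq (pideal0 _) => x; rewrite mxE /= mulr0.
- by apply: pideal_eq (@WD_mem 1 0) => x; rewrite mxE.
- by apply: pideal_eq (pideal0 _) => x; rewrite !mxE /= mul0r.
- by apply: pideal_eq (pideal0 _) => x; rewrite !mxE /= mul0r.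
Qed.
Definition D_axis3 : whom WD2D (WD 1) :=
  @polymap 3 _ (WD 1) axis3_fun axis3_smooth axis3_at0 axis3_ideal.

(* D^2 -> D : (d_1, d_2) |-> d_i *)
Section Coordinate.
Variable i : 'I_2.
Definition coord_fun (x : 'rV[R]_2) : 'rV[R]_1 := \row_j x 0 i.
Lemma coord_smooth j : Cinf (fun x => coord_fun x 0 j).
Proof.
have := @Cinf_coord 2 i; congr (Cinf _).
by apply/funext => x; rewrite mxE.
Qed.
Lemma coord_at0 : coord_fun 0 = 0.
Proof. by apply/rowP => j; rewrite !mxE. Qed.
Lemma coord_ideal j k : (j, k) \in [seq (i, i) | i <- enum 'I_1] ->
  pideal (WD 2) (fun x => coord_fun x 0 j * coord_fun x 0 k).
Proof. by move=> _; apply: pideal_eq (WD_mem i) => x; rewrite !mxE. Qed.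
Definition D2_coord : whom (WD 1) (WD 2) :=
  @polymap 1 _ (WD 2) coord_fun coord_smooth coord_at0 coord_ideal.
End Coordinate.

(* The identifications of W_{D^(p+q)} with W_{D^p} (x) W_{D^q} and with
   W_{D^q} (x) W_{D^p}; the first p coordinates of D^(p+q) always belong to the
   factor W_{D^p}. *)
Section Split.
Variables p q : nat.

Lemma tensor_meml (W1 W2 : pres) f :
  pideal W1 f -> pideal (tensor W1 W2) (f \o lsubmx).
Proof. by move=> If; apply: gen_ideal_incl; left; exists f. Qed.

Lemma tensor_memr (W1 W2 : pres) f :
  pideal W2 f -> pideal (tensor W1 W2) (f \o rsubmx).
Proof. by move=> If; apply: gen_ideal_incl; right; exists f. Qed.

Lemma split_ideal (j k : 'I_(p + q)) :
  (j, k) \in [seq (i, i) | i <- enum 'I_(p + q)] ->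
  pideal (tensor (WD p) (WD q)) (fun x => x 0 j * x 0 k).
Proof.
move=> /WD_memP <-; rewrite -(fintype.splitK j); case: (fintype.split j) => i.
  apply: (@pideal_eq (tensor (WD p) (WD q)) _ _ _ (tensor_meml (WD_mem i))).
  by move=> x /=; rewrite mxE.
apply: (@pideal_eq (tensor (WD p) (WD q)) _ _ _ (tensor_memr (WD_mem i))).
by move=> x /=; rewrite mxE.
Qed.
Definition D_split : whom (WD (p + q)) (tensor (WD p) (WD q)) :=
  @polymap (p + q) _ (tensor (WD p) (WD q)) (fun x => x)
    (@Cinf_coord (p + q)) erefl split_ideal.

Definition swap_fun (x : 'rV[R]_(q + p)) : 'rV[R]_(p + q) :=
  row_mx (rsubmx x) (lsubmx x).
Lemma swap_smooth j : Cinf (fun x => swap_fun x 0 j).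
Proof.
rewrite -(fintype.splitK j); case: (fintype.split j) => i /=.
  have := @Cinf_coord (q + p) (rshift q i); congr (Cinf _).
  by apply/funext => x; rewrite row_mxEl mxE.
have := @Cinf_coord (q + p) (lshift p i); congr (Cinf _).
by apply/funext => x; rewrite row_mxEr mxE.
Qed.
Lemma swap_at0 : swap_fun 0 = 0.
Proof. by rewrite /swap_fun !raddf0 row_mx0. Qed.
Lemma swap_ideal (j k : 'I_(p + q)) :
  (j, k) \in [seq (i, i) | i <- enum 'I_(p + q)] ->
  pideal (tensor (WD q) (WD p)) (fun x => swap_fun x 0 j * swap_fun x 0 k).
Proof.
move=> /WD_memP <-; rewrite -(fintype.splitK j); case: (fintype.split j) => i.
  apply: (@pideal_eq (tensor (WD q) (WD p)) _ _ _ (tensor_memr (WD_mem i))).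
  by move=> x /=; rewrite row_mxEl mxE.
apply: (@pideal_eq (tensor (WD q) (WD p)) _ _ _ (tensor_meml (WD_mem i))).
by move=> x /=; rewrite row_mxEr mxE.
Qed.
Definition D_swap_split : whom (WD (p + q)) (tensor (WD q) (WD p)) :=
  @polymap (p + q) _ (tensor (WD q) (WD p)) swap_fun
    swap_smooth swap_at0 swap_ideal.
End Split.

Section Tangent.
Variable X : frolicher R.

Definition tangent : frolicher R := X ⊗ WD 1.

Definition tzero (x : X) : tangent := prol_cst X (WD 1) x.

Definition tscale (a : R) (t : tangent) : tangent :=
  prol_whom X (D_scale ord0 a) t.

(* meaningful for X microlinear and t1, t2 with the same foot point: the g below
   is then unique *)
Definition tadd (t1 t2 : tangent) : tangent :=
  prol_whom X (D_line2 1 1)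
    (xget (prol_cst X WD_2 (prol_proj X (WD 1) t1) : {classic X ⊗ WD_2})
      [set g | prol_whom X (D_line2 1 0) g = t1 /\
               prol_whom X (D_line2 0 1) g = t2]).

(* meaningful for X microlinear and g1, g2 which agree on D(2): the g below is
   then unique *)
Definition strong_diff (g1 g2 : X ⊗ WD 2) : tangent :=
  prol_whom X D_axis3
    (xget (prol_cst X WD2D (prol_proj X (WD 2) g1) : {classic X ⊗ WD2D})
      [set g | prol_whom X (D2_graph 1) g = g1 /\
               prol_whom X (D2_graph 0) g = g2]).

End Tangent.

Section Forms.
Variable M : frolicher R.

Definition ops (p : nat) : frolicher R := hom_frolicher (M ⊗ WD p) M.

Definition delta (p : nat) : ops p := prol_proj M (WD p).

Definition is_icon (p : nat) (xi : tangent (ops p)) : Prop :=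
  prol_proj (ops p) (WD 1) xi = delta p.

Definition op_scale (p : nat) (i : 'I_p) (a : R) : smap (ops p) (ops p) :=
  smap_precomp (prol_whom M (D_scale i a)) M.

Definition op_perm (p : nat) (sigma : 'S_p) : smap (ops p) (ops p) :=
  smap_precomp (prol_whom M (D_perm sigma)) M.

Definition icon_perm (p : nat) (sigma : 'S_p) (xi : tangent (ops p)) :
    tangent (ops p) :=
  prol_map (op_perm sigma) (WD 1) xi.

Definition is_semiform (p : nat) (xi : tangent (ops p)) : Prop :=
  is_icon xi /\
  forall (a : R) (i : 'I_p), prol_map (op_scale i a) (WD 1) xi = tscale a xi.

Definition is_form (p : nat) (xi : tangent (ops p)) : Prop :=
  is_semiform xi /\
  forall sigma : 'S_p, icon_perm sigma xi = tscale ((-1) ^+ sigma) xi.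

Definition star (p q : nat) (eta1 : ops p) (eta2 : ops q) : ops (p + q) :=
  smap_comp eta1 (smap_comp (prol_map eta2 (WD p))
    (smap_comp (prol_curry M (WD q) (WD p)) (prol_whom M (D_swap_split p q)))).

Definition stilde (p q : nat) (eta1 : ops p) (eta2 : ops q) : ops (p + q) :=
  smap_comp eta2 (smap_comp (prol_map eta1 (WD q))
    (smap_comp (prol_curry M (WD p) (WD q)) (prol_whom M (D_split p q)))).

Definition star_smap (p q : nat) :
    smap (prod_frolicher (ops p) (ops q)) (ops (p + q)) :=
  @smooth_or (prod_frolicher (ops p) (ops q)) (ops (p + q))
    (smap_cst _ (delta (p + q))) (fun eta => star eta.1 eta.2).

Definition stilde_smap (p q : nat) :
    smap (prod_frolicher (ops p) (ops q)) (ops (p + q)) :=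
  @smooth_or (prod_frolicher (ops p) (ops q)) (ops (p + q))
    (smap_cst _ (delta (p + q))) (fun eta => stilde eta.1 eta.2).

Definition icon_pair (p q : nat)
    (xi1 : tangent (ops p)) (xi2 : tangent (ops q)) :
    prod_frolicher (ops p) (ops q) ⊗ WD 2 :=
  prol_pair (prol_whom (ops p) (D2_coord 0) xi1)
            (prol_whom (ops q) (D2_coord 1) xi2).

Definition circledast (p q : nat)
    (xi1 : tangent (ops p)) (xi2 : tangent (ops q)) : ops (p + q) ⊗ WD 2 :=
  prol_map (star_smap p q) (WD 2) (icon_pair xi1 xi2).

Definition tcircledast (p q : nat)
    (xi1 : tangent (ops p)) (xi2 : tangent (ops q)) : ops (p + q) ⊗ WD 2 :=
  prol_map (stilde_smap p q) (WD 2) (icon_pair xi1 xi2).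

Definition lie_bracket (p q : nat)
    (xi1 : tangent (ops p)) (xi2 : tangent (ops q)) : tangent (ops (p + q)) :=
  strong_diff (tcircledast xi1 xi2) (circledast xi1 xi2).

Definition alternate (n : nat) (xi : tangent (ops n)) : tangent (ops n) :=
  \big[@tadd (ops n)/tzero (X := ops n) (delta n)]_(sigma : 'S_n)
    tscale ((-1) ^+ sigma) (icon_perm sigma xi).

Definition fn_bracket (p q : nat)
    (xi1 : tangent (ops p)) (xi2 : tangent (ops q)) : tangent (ops (p + q)) :=
  tscale ((p`! * q`!)%:R^-1) (alternate (lie_bracket xi1 xi2)).

Definition icon_cast (m n : nat) (e : m = n) (xi : tangent (ops m)) :
    tangent (ops n) :=
  ecast k (tangent (ops k)) e xi.

End Forms.

Lemma addn_rot (a b c : nat) : (b + (c + a) = a + (b + c))%N.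
Proof. by rewrite addnA addnC. Qed.

End Frolicher.

Notation "X ⊗ W" := (prol X W) : frolicher_scope.

(* Main.v *)
Require Import Defs.
From HB Require Import structures.
From mathcomp Require Import all_boot all_order all_algebra perm ring lra.
From mathcomp Require Import boolp classical_sets functions reals topology.
From mathcomp Require Import normedtype derive realfun sequences exp.

(** Let eta : M (x) W_{D^p} -> M be an operator and let w be a smooth map on R^p.
    Write eta[t |-> w t] for the value of eta at the class of w. The two products of
    operators are the two orders of composition,

      (star e1 e2) [w]   = e1[t |-> e2[s |-> w (t, s)]],
      (stilde e1 e2) [w] = e2[s |-> e1[t |-> w (t, s)]]

    ([star_pc], [stilde_pc]), and the Lie bracket of icons is an infinitesimal
    commutator: for a function k of operators, the derivative of k along the
    bracket is the mixed second derivative of k (stilde e1 e2) - k (star e1 e2)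
    when e1 and e2 move along the two icons ([dd_lie]). An iterated bracket is
    therefore a mixed third derivative of four triple composites. In the cyclic
    sum over three icons every order of composition occurs twice with opposite
    signs, as mixed derivatives commute and composition is associative; this is
    [jac_cyclic]. The composites that cancel see the blocks of p, q and r
    variables in rotated order. Alternation absorbs these rotations and leaves
    their signs (-1)^(p (q + r)) and (-1)^(r (p + q)) ([sign_rot],
    [dd_fn_fn_rot]); it also absorbs the inner alternation of a double bracket,
    up to the factor (q + r)! ([dd_fn_fn]).

    What makes this computation legitimate is that tangent vectors of a function
    space M^Y are separated by their base point and by the derivatives of the
    functions f |-> h (f y) ([hom_tangent_ext]), and that sums and strong
    differences of tangent vectors become sums and differences of derivatives
    ([dd_tadd], [dd_strong_diff]). Both rest on three facts.
    - By Taylor expansion, D(2) and D^2 (+) D give pullback squares of algebras,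
      hence of prolongations of the microlinear space M ([square_WD_2],
      [square_WD2D]).
    - By Weil exponentiability, an element of M^Y (x) W is a smooth map from Y to
      M (x) W ([exponential_elements]), so the squares exist for M^Y as well.
    - The two products are smooth in both operators ([star_smooth],
      [stilde_smooth]), by the cartesian closedness of Froelicher spaces
      ([hom_curveP]).

    The analysis concerns functions F of two real variables which are smooth along
    all smooth curves. Their derivatives in every direction are locally bounded,
    since otherwise a special curve would pass through points where they blow up
    ([dirn_locally_bounded]); mixed differences are reduced to pure ones
    ([mixed_bounded]). It follows that partial derivatives and Hadamard quotients
    of F are of the same kind ([smooth2_d2], [smooth2_quotient]), which gives the
    Taylor expansions. Cartesian closedness needs in addition that a family of
    smooth functions is smooth as soon as all smooth functionals of it are; a
    gliding hump argument proves this ([smooth2_of_functionals]). *)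

Set Implicit Arguments.
Unset Strict Implicit.
Unset Printing Implicit Defensive.

Import Order.TTheory GRing.Theory Num.Theory.
Import numFieldNormedType.Exports.

Local Open Scope classical_set_scope.
Local Open Scope ring_scope.
Local Open Scope frolicher_scope.

(** * Smooth functions of one variable *)

Section OneVariable.
Variable R : realType.
Implicit Types f g : R -> R.

Lemma is_derive_epsP f (x a : R) :
  is_derive x 1 f a <->
  forall e, 0 < e -> exists2 d, 0 < d &
    forall h, `|h| < d -> `|f (x + h) - f x - h * a| <= e * `|h|.
Proof.
split=> [[df <-] e e0|H].
  have := df; rewrite /derivable => /cvg_ex[l fl].
  have -> : 'D_1 f x = l by exact: cvg_lim fl.
  move/cvgrPdist_le : fl => /(_ e e0).
  rewrite near_withinE => /nbhs_ballP[d /= d0 H].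
  exists d => // h hd; have [->|h0] := eqVneq h 0.
    by rewrite addr0 subrr mul0r subr0 normr0 mulr0.
  have := H h; rewrite /ball/= sub0r normrN => /(_ hd h0).
  rewrite -(ler_pM2r (_ : 0 < `|h|)) ?normr_gt0// -normrM.
  rewrite mulrBl [_ *: _]/(_ * _) mulrAC mulVf// mul1r distrC /= [h *: 1]mulr1.
  by rewrite [h + x]addrC [l * h]mulrC.
have fa : (fun h => h^-1 *: ((f \o shift x) (h *: 1) - f x)) @ 0^' --> a.
  apply/cvgrPdist_le => e e0; have [d d0 {}H] := H e e0.
  near=> h; have h0 : h != 0 by near: h; exact: nbhs_dnbhs_neq.
  have hd : `|h| < d by near: h; exact: dnbhs0_lt.
  have := H h hd; rewrite -ler_pdivrMr ?normr_gt0// -normfV -normrM.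
  rewrite mulrBl mulrAC mulfV// mul1r distrC /= [h *: 1]mulr1.
  by rewrite [h^-1 *: _]mulrC [h + x]addrC.
split; first by apply/cvg_ex; exists a.
exact: cvg_lim fa.
Unshelve. all: by end_near. Qed.

Lemma is_derive_derive1 f (x a : R) : is_derive x 1 f a -> derive1 f x = a.
Proof. by move=> [_ <-]; rewrite derive1E. Qed.

Lemma smooth1_is_derive f : smooth1 f -> forall x : R, is_derive x 1 f (derive1 f x).
Proof.
by move=> sf x; rewrite derive1E; apply: derivableP; exact: smooth1_derivable.
Qed.

Lemma smooth1_derive1n f n : smooth1 f -> smooth1 (derive1n n f).
Proof. by move=> sf; elim: n => [//|n IH]; rewrite derive1nS; exact: smooth1_derive. Qed.

Lemma smooth1_continuous f : smooth1 f -> continuous f.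
Proof.
move=> sf x; apply: differentiable_continuous; apply/derivable1_diffP.
exact: smooth1_derivable.
Qed.

(** Products with arbitrary smooth functions are allowed so that coinduction
    applies to families closed under differentiation only up to the product
    and chain rules. *)
Inductive alg_closure (C : (R -> R) -> Prop) : (R -> R) -> Prop :=
| alg_incl f of C f : alg_closure C f
| alg_smooth f of smooth1 f : alg_closure C f
| alg_add f g of alg_closure C f & alg_closure C g :
    alg_closure C (fun x => f x + g x)
| alg_mul f g of alg_closure C f & alg_closure C g :
    alg_closure C (fun x => f x * g x).

(** The derivative of an element of the generated algebra stays in it, so
    derivatives of all orders exist. *)
Lemma smooth1_coind (C : (R -> R) -> Prop) :
  (forall f, C f -> exists2 f', alg_closure C f' &
    forall x : R, is_derive x 1 f (f' x)) ->
  forall f, alg_closure C f -> smooth1 f.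
Proof.
move=> HC.
have H f : alg_closure C f -> exists2 f', alg_closure C f' &
    forall x : R, is_derive x 1 f (f' x).
  elim=> [g /HC//|g sg|g h cg [g' cg' dg] ch [h' ch' dh]
      |g h cg [g' cg' dg] ch [h' ch' dh]].
  - exists (derive1 g); first by apply: alg_smooth; exact: smooth1_derive.
    by move=> x; exact: smooth1_is_derive.
  - by exists (fun x => g' x + h' x); [exact: alg_add|move=> x; exact: is_deriveD].
  - exists (fun x => g x * h' x + h x * g' x).
      by apply: alg_add; apply: alg_mul.
    by move=> x; exact: is_deriveM.
move=> f cf n; suff K : alg_closure C (derive1n n f).
  by move=> x; have [g _ /(_ x)[]] := H _ K.
elim: n => [//|n IH]; rewrite derive1nS; have [g cg dg] := H _ IH.
suff -> : derive1 (derive1n n f) = g by [].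
by apply/funext => x; exact: is_derive_derive1.
Qed.

Lemma smooth1_comp f g : smooth1 f -> smooth1 g -> smooth1 (f \o g).
Proof.
move=> sf sg; apply: (@smooth1_coind [set k | exists2 l, smooth1 l & k = l \o g]);
  last by apply: alg_incl; exists f.
move=> _ [l sl ->]; exists (fun x => derive1 l (g x) * derive1 g x).
  apply: alg_mul; last by apply: alg_smooth; exact: smooth1_derive.
  by apply: alg_incl; exists (derive1 l); [exact: smooth1_derive|].
by move=> x; apply: is_derive1_comp; exact: smooth1_is_derive.
Qed.

Lemma smooth1N f : smooth1 f -> smooth1 (fun x => - f x).
Proof.
move=> sf; have := smooth1M (@smooth1_cst R (-1)) sf; congr smooth1.
by apply/funext => x; rewrite mulN1r.
Qed.

Lemma smooth1B f g : smooth1 f -> smooth1 g -> smooth1 (fun x => f x - g x).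
Proof. by move=> sf sg; apply: smooth1D; [exact: sf|exact: smooth1N]. Qed.

Lemma smooth1_sum (I : Type) (r : seq I) (F : I -> R -> R) :
  (forall i, smooth1 (F i)) -> smooth1 (fun x => \sum_(i <- r) F i x).
Proof.
move=> sF; elim: r => [|i r IH].
  have := @smooth1_cst R 0; congr smooth1; apply/funext => x.
  by rewrite big_nil.
have := smooth1D (sF i) IH; congr smooth1; apply/funext => x.
by rewrite big_cons.
Qed.

Lemma smooth1_MVT f (a b : R) : smooth1 f -> a <= b ->
  exists2 c, a <= c <= b & f b - f a = derive1 f c * (b - a).
Proof.
move=> sf ab; have [c] := @MVT_segment R f (derive1 f) a b ab
  (fun x _ => smooth1_is_derive sf x) (continuous_subspaceT (smooth1_continuous sf)).
by rewrite in_itv /= => H E; exists c.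
Qed.

Lemma smooth1_bounded f (K : R) : smooth1 f ->
  exists2 C, 0 < C & forall x, `|x| <= K -> `|f x| <= C.
Proof.
move=> sf; have [K0|K0] := ltP K 0.
  exists 1 => // x xK; have := le_lt_trans xK K0.
  by rewrite normr_lt0.
have KK : - K <= K by lra.
have cf := continuous_subspaceT (A := [set` `[-K, K]]) (smooth1_continuous sf).
have [a _ Ha] := EVT_max KK cf; have [b _ Hb] := EVT_min KK cf.
exists (`|f a| + `|f b| + 1); first by have := normr_ge0 (f a); have := normr_ge0 (f b); lra.
move=> x xK; have xi : x \in `[-K, K]%R by rewrite in_itv /= -ler_norml.
have := Ha x xi; have := Hb x xi.
have := ler_norm (f a); have := lerNnormlW (lexx `|f b|) => h1 h2 h3 h4.
have := normr_ge0 (f a); have := normr_ge0 (f b) => h5 h6.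
by rewrite ler_norml; apply/andP; split; lra.
Qed.

Lemma smooth1_taylor f (K C : R) : smooth1 f ->
  (forall x, `|x| <= K -> `|derive1n 2 f x| <= C) ->
  forall x h, `|x| <= K -> `|x + h| <= K ->
  `|f (x + h) - f x - h * derive1 f x| <= C * h ^+ 2.
Proof.
move=> sf HC.
have sf' := smooth1_derive sf.
have in_seg (x y z : R) : x <= z <= y -> `|x| <= K -> `|y| <= K -> `|z| <= K.
  by rewrite !ler_norml => /andP[? ?] /andP[? ?] /andP[? ?]; apply/andP; split; lra.
have lip x y : x <= y -> `|x| <= K -> `|y| <= K ->
    `|derive1 f y - derive1 f x| <= C * (y - x).
  move=> xy xK yK; have [c cxy ->] := smooth1_MVT sf' xy.
  rewrite normrM (ger0_norm (_ : 0 <= y - x)) ?subr_ge0//.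
  by apply: ler_wpM2r; [rewrite subr_ge0|apply: HC; exact: (in_seg x y)].
move=> x h xK xhK; have [h0|h0] := leP 0 h.
  have le : x <= x + h by rewrite lerDl.
  have [c cx ->] := smooth1_MVT sf le; case/andP: (cx) => c1 c2.
  rewrite (addrC x) addrK mulrC -mulrBr normrM (ger0_norm h0) expr2 mulrCA.
  apply: ler_wpM2l => //; apply: (le_trans (lip _ _ c1 xK (in_seg _ _ _ cx xK xhK))).
  have C0 : 0 <= C by apply: le_trans (HC _ xK).
  by apply: ler_wpM2l => //; lra.
have le : x + h <= x by rewrite gerDl ltW.
have [c cx E] := smooth1_MVT sf le; case/andP: (cx) => c1 c2.
have -> : f (x + h) - f x - h * derive1 f x = - h * (derive1 f x - derive1 f c).
  by rewrite -(opprB (f x)) E; ring.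
rewrite normrM normrN expr2.
have -> : C * (h * h) = `|h| * (C * (- h)) by rewrite ltr0_norm//; ring.
apply: ler_wpM2l => //; apply: (le_trans (lip _ _ c2 (in_seg _ _ _ cx xhK xK) xK)).
have C0 : 0 <= C by apply: le_trans (HC _ xK).
by apply: ler_wpM2l => //; lra.
Qed.

(** Differences stand in for derivatives where only values of a function can be
    controlled; [fdiff_MVT] and [derive1n_le_fdiff] pass from one to the other. *)
Fixpoint fdiff (k : nat) (a : R) f (t : R) : R :=
  if k is k'.+1 then fdiff k' a f (t + a) - fdiff k' a f t else f t.

Lemma fdiff_smooth k a f : smooth1 f -> smooth1 (fdiff k a f).
Proof.
move=> sf; elim: k => [|k IH] /=; first exact: sf.
apply: smooth1B; last exact: IH.
apply: (smooth1_comp IH); apply: smooth1D; [exact: smooth1_id|exact (@smooth1_cst R a)].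
Qed.

Lemma derive1_shift f (a : R) : smooth1 f ->
  derive1 (fun t => f (t + a)) = fun t => derive1 f (t + a).
Proof.
move=> sf; apply/funext => t; apply: is_derive_derive1.
rewrite -[X in is_derive _ _ _ X]mulr1; apply: (@is_derive1_comp _ f (fun t => t + a)).
  exact: smooth1_is_derive.
rewrite -[X in is_derive _ _ _ X]addr0; apply: is_deriveD; exact: is_derive_cst.
Qed.

Lemma derive1B_fun (f g : R -> R) : smooth1 f -> smooth1 g ->
  derive1 (fun x => f x - g x) = (fun x => derive1 f x - derive1 g x).
Proof.
move=> sf sg; apply/funext => x; apply: is_derive_derive1.
by apply: is_deriveB; exact: smooth1_is_derive.
Qed.

Lemma derive1_fdiff k a f : smooth1 f ->
  derive1 (fdiff k a f) = fdiff k a (derive1 f).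
Proof.
move=> sf; elim: k => [//|k IH] /=.
have sk := @fdiff_smooth k a _ sf.
rewrite derive1B_fun; [| |exact: sk]; last first.
  by apply: (smooth1_comp sk); apply: smooth1D; [exact: smooth1_id|exact (@smooth1_cst R a)].
by rewrite derive1_shift// IH.
Qed.

Lemma fdiff_MVT k (a : R) f (t : R) : smooth1 f -> 0 <= a ->
  exists2 c, t <= c <= t + a *+ k & fdiff k a f t = a ^+ k * derive1n k f c.
Proof.
elim: k f t => [|k IH] f t sf a0.
  by exists t; rewrite ?mulr0n ?addr0 ?lexx// mul1r.
have sk := @fdiff_smooth k a _ sf.
have le : t <= t + a by rewrite lerDl.
have [c /andP[c1 c2] /= ->] := smooth1_MVT sk le; rewrite derive1_fdiff//.
have [d /andP[d1 d2] ->] := IH (derive1 f) c (smooth1_derive sf) a0.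
exists d; last by rewrite -derive1nS derive1Sn exprS; ring.
by rewrite mulrS; apply/andP; split; lra.
Qed.

Lemma cvgn_epsP (u : nat -> R) (l : R) : u @ \oo --> l <->
  forall e, 0 < e -> exists N, forall n, (N <= n)%N -> `|u n - l| <= e.
Proof.
split=> [/cvgrPdist_le H e e0|H].
  by have [N _ HN] := H e e0; exists N => n Nn; rewrite distrC; exact: HN.
apply/cvgrPdist_le => e e0; have [N HN] := H e e0.
by exists N => // n Nn; rewrite distrC; exact: HN.
Qed.

Lemma smooth1_eps f (x : R) : smooth1 f -> forall e, 0 < e ->
  exists2 d, 0 < d & forall y, `|y - x| < d -> `|f y - f x| < e.
Proof.
move=> sf e e0; have /cvgrPdist_lt/(_ _ e0) := smooth1_continuous sf (x := x).
move=> /nbhs_ballP[d /= d0 H]; exists d => // y yd; rewrite distrC; apply: H.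
by rewrite /ball/= distrC.
Qed.

Lemma derive1n_le_fdiff k f (t C : R) : smooth1 f ->
  (forall d, 0 < d -> exists2 a, 0 < a < d & `|fdiff k a f t| <= C * a ^+ k) ->
  `|derive1n k f t| <= C.
Proof.
move=> sf H; apply/ler_addgt0Pr => e e0.
have [d d0 Hd] := smooth1_eps t (@smooth1_derive1n _ k sf) e0.
have k0 : 0 < d / k.+1%:R by rewrite divr_gt0.
have [a /andP[a0 ad]] := H _ k0.
have [c /andP[c1 c2] ->] := fdiff_MVT k t sf (ltW a0).
rewrite normrM (gtr0_norm (exprn_gt0 k a0)) mulrC ler_pM2r ?exprn_gt0// => cC.
have := Hd c; have -> : `|c - t| < d.
  rewrite ger0_norm ?subr_ge0// ltrBlDl; apply: (le_lt_trans c2).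
  rewrite ltrD2l -mulr_natr; move: ad; rewrite ltr_pdivlMr//; apply: le_lt_trans.
  by rewrite ler_pM2l// ler_nat.
move=> /(_ isT) H1; rewrite -(subrK (derive1n k f c) (derive1n k f t)) addrC.
apply: (le_trans (ler_normD _ _)); rewrite distrC; lra.
Qed.

Definition equibounded (Q : nat -> R -> R) :=
  forall k (K : R), exists C, forall n x, `|x| <= K -> `|derive1n k (Q n) x| <= C.

Lemma equibounded_derive Q : equibounded Q -> equibounded (fun n => derive1 (Q n)).
Proof.
move=> H k K; have [C HC] := H k.+1 K; exists C => n x xK.
by rewrite -derive1Sn; exact: HC.
Qed.

(** The second order Taylor estimate is uniform in n: it makes the derivatives
    at each point a Cauchy sequence, and it survives in the limit. *)
Lemma is_derive_limit Q (psi : R -> R) :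
  (forall n, smooth1 (Q n)) -> equibounded Q ->
  (forall x, Q n x @[n --> \oo] --> psi x) ->
  exists psi', (forall x, derive1 (Q n) x @[n --> \oo] --> psi' x) /\
    forall x : R, is_derive x 1 psi (psi' x).
Proof.
move=> sQ bQ cQ.
have tay x : exists2 C, 0 < C & forall n h, `|h| <= 1 ->
    `|Q n (x + h) - Q n x - h * derive1 (Q n) x| <= C * h ^+ 2.
  have [C HC] := bQ 2%N (`|x| + 1); exists (`|C| + 1).
    by have := normr_ge0 C; lra.
  move=> n h h1; apply: (@smooth1_taylor (Q n) (`|x| + 1)) => //.
  - move=> y yx; apply: (le_trans (HC n y yx)).
    by have := ler_norm C; lra.
  - by lra.
  - by apply: (le_trans (ler_normD _ _)); lra.
have cvd x : cvgn (fun n => derive1 (Q n) x).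
  have [C C0 HC] := tay x.
  apply/cauchy_cvgP/cauchy_exP => e e0.
  pose h := Num.min 1 (e / (8 * C)).
  have h0 : 0 < h by rewrite lt_min ltr01 divr_gt0// mulr_gt0.
  have h1 : `|h| <= 1 by rewrite gtr0_norm// /h ge_min lexx.
  have hC : C * h <= e / 8.
    have : h <= e / (8 * C) by rewrite /h ge_min lexx orbT.
    by rewrite ler_pdivlMr ?mulr_gt0// => H; lra.
  have eh : 0 < e * h / 8 by rewrite !mulr_gt0// invr_gt0.
  have [N1 HN1] := (cvgn_epsP _ _).1 (cQ x) _ eh.
  have [N2 HN2] := (cvgn_epsP _ _).1 (cQ (x + h)) _ eh.
  pose N := maxn N1 N2; exists (derive1 (Q N) x); exists N => // n /= Nn.
  rewrite /ball /= -(ltr_pM2l h0) -{1}(gtr0_norm h0) -normrM.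
  have l1 : (N1 <= N)%N by rewrite leq_maxl.
  have l2 : (N2 <= N)%N by rewrite leq_maxr.
  move: (HC n h h1) (HC N h h1) (HN1 n (leq_trans l1 Nn)) (HN1 N l1)
    (HN2 n (leq_trans l2 Nn)) (HN2 N l2).
  have hh : C * h ^+ 2 <= e * h / 8.
    have H := ler_wpM2r (ltW h0) hC.
    by rewrite expr2 mulrA [e * h / 8]mulrAC.
  rewrite !ler_norml ltr_norml => /andP[? ?] /andP[? ?] /andP[? ?] /andP[? ?] /andP[? ?] /andP[? ?].
  by apply/andP; split; lra.
exists (fun x => limn (fun n => derive1 (Q n) x)).
have cvd' x := cvd x : derive1 (Q n) x @[n --> \oo] --> limn (fun n => derive1 (Q n) x).
split=> // x.
have [C C0 HC] := tay x.
apply/is_derive_epsP => e e0; exists (Num.min 1 (e / C)).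
  by rewrite lt_min ltr01 divr_gt0.
move=> h; rewrite lt_min => /andP[/ltW h1 hC].
apply: (@le_trans _ _ (C * h ^+ 2)).
  apply: (cvgr_to_le (F := \oo) (f := fun n =>
    `|Q n (x + h) - Q n x - h * derive1 (Q n) x|)).
    apply: cvg_norm; apply: cvgB; first by apply: cvgB; exact: cQ.
    by apply: cvgM; [exact: cvg_cst|exact: cvd'].
  by apply: nearW => n; exact: HC.
rewrite -(real_normK (num_real h)) expr2 mulrA ler_wpM2r//.
by move: hC; rewrite ltr_pdivlMr// mulrC => /ltW.
Qed.

(** The derivatives form a sequence with the same properties, so coinduction
    reaches all orders. *)
Lemma smooth1_limit Q (psi : R -> R) :
  (forall n, smooth1 (Q n)) -> equibounded Q ->
  (forall x, Q n x @[n --> \oo] --> psi x) -> smooth1 psi.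
Proof.
move=> sQ bQ cQ.
pose C := [set f : R -> R | exists Q : nat -> R -> R, [/\ forall n, smooth1 (Q n), equibounded Q &
  forall x, Q n x @[n --> \oo] --> f x]].
apply: (@smooth1_coind C); last by apply: alg_incl; exists Q.
move=> f [P [sP bP cP]]; have [f' [cf' df']] := is_derive_limit sP bP cP.
exists f'; last exact: df'.
apply: alg_incl; exists (fun n => derive1 (P n)); split; last exact: cf'.
  by move=> n; exact: smooth1_derive.
exact: equibounded_derive.
Qed.

Lemma is_derive_local f g (x a d : R) : 0 < d ->
  (forall h, `|h| < d -> f (x + h) = g (x + h)) ->
  is_derive x 1 g a -> is_derive x 1 f a.
Proof.
move=> d0 fg /is_derive_epsP H; apply/is_derive_epsP => e /H[d' d'0 {}H].
exists (Num.min d d'); first by rewrite lt_min d0.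
move=> h; rewrite lt_min => /andP[hd hd']; rewrite fg// -[in f x](addr0 x).
by rewrite fg ?normr0// addr0; exact: H.
Qed.

(** This family contains the classical exp(-1/x) and is closed under
    differentiation: P(1/x) exp(-1/x) has the derivative Q(1/x) exp(-1/x) with
    Q = X^2 (P - P'). *)
Definition flat (P : {poly R}) (x : R) : R :=
  if 0 < x then P.[x^-1] * expR (- x^-1) else 0.

Lemma poly_growth (P : {poly R}) : exists2 A, 0 <= A &
  forall y : R, 1 <= y -> `|P.[y]| <= A * y ^+ size P.
Proof.
exists (\sum_(i < size P) `|P`_i|); first exact: sumr_ge0.
move=> y y1; rewrite horner_coef mulr_suml; apply: (le_trans (ler_norm_sum _ _ _)).
apply: ler_sum => i _; rewrite normrM ler_wpM2l// normrX ger0_norm; last by lra.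
by apply: ler_weXn2l => //; exact: ltnW.
Qed.

(** The exponential series beats every power of 1/x; the quadratic bound makes
    the derivative at 0 vanish. *)
Lemma flat_near0 P : exists2 A, 0 <= A &
  forall h, `|h| <= 1 -> `|flat P h| <= A * h ^+ 2.
Proof.
have [A A0 HA] := poly_growth P; pose n := size P.
exists (A * (n.+2)`!%:R); first by rewrite mulr_ge0.
move=> h h1; rewrite /flat; case: ifPn => [h0|_]; last first.
  by rewrite normr0 mulr_ge0 ?sqr_ge0 ?mulr_ge0.
have y1 : 1 <= h^-1 by rewrite invf_ge1// (le_trans (ler_norm h)).
set y := h^-1 in y1 *; have y0 : 0 < y by rewrite invr_gt0.
have -> : h = y^-1 by rewrite invrK.
rewrite normrM (gtr0_norm (expR_gt0 _)) expRN.
rewrite ler_pdivrMr ?expR_gt0//; apply: (le_trans (HA y y1)).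
suff E2 : y ^+ n <= (n.+2)`!%:R * (y^-1 ^+ 2 * expR y).
  by apply: (le_trans (ler_wpM2l A0 E2)); rewrite !mulrA.
have E := expR_ge1Dxn n.+1 (ltW y0).
have F : y ^+ n.+2 <= (n.+2)`!%:R * expR y.
  rewrite -ler_pdivrMl ?ltr0n ?fact_gt0// mulrC.
  by apply: le_trans E; rewrite lerDr.
have -> : y ^+ n = y^-1 ^+ 2 * y ^+ n.+2.
  by rewrite -(addn2 n) exprD mulrCA -exprMn mulVf ?gt_eqF// expr1n mulr1.
by rewrite [leRHS]mulrCA ler_wpM2l// exprn_ge0// invr_ge0 ltW.
Qed.

Lemma is_derive_flat P (x : R) :
  is_derive x 1 (flat P) (flat ('X^2 * (P - P^`())) x).
Proof.
have [x0|x0|->] := ltgtP x 0.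
- have -> : flat ('X^2 * (P - P^`())) x = 0 by rewrite /flat ltNge (ltW x0).
  apply: (@is_derive_local _ (fun=> 0) _ _ (- x)); first by lra.
  move=> h; rewrite ltr_norml => /andP[_ h1]; rewrite /flat; case: ifPn => // H; lra.
- pose g (x : R) := P.[x^-1] * expR (- x^-1).
  apply: (@is_derive_local _ g _ _ x) => //.
    move=> h; rewrite ltr_norml => /andP[h1 _]; rewrite /flat; case: ifPn => // H; lra.
  have di : is_derive x 1 (fun x : R => x^-1) (- x^-2).
    apply: is_derive_eq; first by apply: is_deriveV; rewrite gt_eqF.
    by rewrite -[_ *: _]/(_ * _) mulr1.
  have dP : is_derive x 1 (fun x : R => P.[x^-1]) (P^`().[x^-1] * - x^-2).
    exact: (@is_derive1_comp _ (horner P)).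
  have dE : is_derive x 1 (fun x : R => expR (- x^-1)) (expR (- x^-1) * - - x^-2).
    by apply: (@is_derive1_comp _ expR).
  apply: (is_derive_eq (is_deriveM dP dE)).
  rewrite /flat x0 !hornerE -!exprVn -![_ *: _]/(_ * _); ring.
have [A A0 HA] := flat_near0 P.
have -> : flat ('X^2 * (P - P^`())) 0 = 0 by rewrite /flat ltxx.
apply/is_derive_epsP => e e0; exists (Num.min 1 (e / (A + 1))).
  by rewrite lt_min ltr01 divr_gt0//; lra.
move=> h; rewrite lt_min => /andP[/ltW h1 hA].
rewrite add0r mulr0 subr0 (_ : flat P 0 = 0) ?subr0; last by rewrite /flat ltxx.
apply: (le_trans (HA h h1)); rewrite -(real_normK (num_real h)) expr2 mulrA ler_wpM2r//.
move: hA; rewrite ltr_pdivlMr; last by lra.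
by move=> /ltW; apply: le_trans; rewrite mulrC ler_wpM2l//; lra.
Qed.

Lemma smooth1_flat P : smooth1 (flat P).
Proof.
apply: (@smooth1_coind (range flat)); last by apply: alg_incl; exists P.
move=> _ [Q _ <-]; exists (flat ('X^2 * (Q - Q^`()))).
  by apply: alg_incl; exists ('X^2 * (Q - Q^`())).
by move=> x; exact: is_derive_flat.
Qed.

(** b is supported in [-1, 1] and at least c = b(1/2) on [-1/2, 1/2]; composing
    it with J, which is 1 above c and 0 at 0, turns the hump into a plateau. *)
Lemma bump_exists : exists2 chi : R -> R, smooth1 chi &
  (forall x, `|x| <= 2^-1 -> chi x = 1) /\ (forall x, 1 <= `|x| -> chi x = 0).
Proof.
have fE (x : R) : flat 1 x = if 0 < x then expR (- x^-1) else 0.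
  by rewrite /flat hornerC mul1r.
have s1 := @smooth1_flat 1; pose c : R := flat 1 (3 / 4).
have c0 : 0 < c by rewrite /c fE ifT ?expR_gt0//; lra.
have fc0 : 0 < flat 1 c by rewrite fE c0 expR_gt0.
pose b (x : R) := flat 1 (1 - x * x).
have sb : smooth1 b.
  apply: (smooth1_comp s1); apply: smooth1B; first exact (@smooth1_cst R 1).
  by apply: smooth1M; exact: smooth1_id.
pose J (y : R) := 1 - (flat 1 c)^-1 * flat 1 (c - y).
have sJ : smooth1 J.
  apply: smooth1B; first exact (@smooth1_cst R 1).
  apply: smooth1M; first exact (@smooth1_cst R (flat 1 c)^-1).
  apply: (smooth1_comp s1 (g := fun y => c - y)); apply: smooth1B; last exact: smooth1_id.
  exact (@smooth1_cst R c).
exists (J \o b); first exact: smooth1_comp.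
split=> x xH /=; rewrite /J.
  rewrite (_ : flat 1 (c - b x) = 0) ?mulr0 ?subr0//.
  rewrite fE ifN// -leNgt subr_le0 /c /b !fE.
  have x2 : x * x <= 1 / 4.
    by move: xH; rewrite ler_norml => /andP[? ?]; nra.
  rewrite !ifT; [|lra..].
  by rewrite ler_expR lerN2 lef_pV2 ?posrE; lra.
rewrite (_ : b x = 0) ?subr0 ?mulVf ?subrr ?gt_eqF//.
rewrite /b fE ifN// -leNgt subr_le0.
by rewrite -expr2 -(real_normK (num_real x)) expr2; nra.
Qed.

Lemma derive1n_sum (u : nat -> R -> R) k N : (forall i, smooth1 (u i)) ->
  derive1n k (fun x => \sum_(0 <= i < N) u i x) =
  fun x => \sum_(0 <= i < N) derive1n k (u i) x.
Proof.
move=> su; elim: k => [//|k IH]; rewrite derive1nS IH.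
apply/funext => x; apply: is_derive_derive1; clear IH; elim: N => [|N IHN].
  rewrite (_ : (fun _ => _) = fun=> 0); last by apply/funext => y; rewrite big_geq.
  by rewrite big_geq//; exact: is_derive_cst.
rewrite (_ : (fun _ => _) = fun y => \sum_(0 <= i < N) derive1n k (u i) y + derive1n k (u N) y).
  rewrite big_nat_recr//=; apply: is_deriveD => //.
  by apply: smooth1_is_derive; exact: smooth1_derive1n.
by apply/funext => y; rewrite big_nat_recr.
Qed.

Lemma summable_cvg (a : nat -> R) (C : R) :
  (forall N, \sum_(0 <= i < N) `|a i| <= C) -> cvgn (series a).
Proof.
move=> H; apply: normed_cvg; apply: nondecreasing_is_cvgn.
  by apply: nondecreasing_series => i _ _; exact: normr_ge0.
by exists C => _ [N _ <-]; exact: H.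
Qed.

(** Weierstrass's test for all derivatives at once. *)
Lemma smooth1_series (u : nat -> R -> R) : (forall i, smooth1 (u i)) ->
  (forall k (K : R), exists2 b : nat -> R,
     forall i x, `|x| <= K -> `|derive1n k (u i) x| <= b i &
     exists C, forall N, \sum_(0 <= i < N) b i <= C) ->
  smooth1 (fun x => limn (series (fun i => u i x))).
Proof.
move=> su H; apply: (@smooth1_limit (fun N x => \sum_(0 <= i < N) u i x)).
- by move=> N; apply: smooth1_sum.
- move=> k K; have [b bu [C HC]] := H k K; exists C => N x xK.
  rewrite derive1n_sum//; apply: (le_trans (ler_norm_sum _ _ _)).
  by apply: le_trans (HC N); apply: ler_sum => i _; exact: bu.
move=> x; have [b bu [C HC]] := H 0%N `|x|.
suff : cvgn (series (fun i => u i x)) by [].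
apply: (@summable_cvg _ C) => N; apply: le_trans (HC N).
by apply: ler_sum => i _; exact: (bu i).
Qed.

Lemma smooth1_boundedn f n (K : R) : smooth1 f -> exists2 M, 0 < M &
  forall k x, (k <= n)%N -> `|x| <= K -> `|derive1n k f x| <= M.
Proof.
move=> sf; elim: n => [|n [M M0 HM]].
  have [M M0 HM] := smooth1_bounded K sf; exists M => // k x.
  by rewrite leqn0 => /eqP ->; exact: HM.
have [M' M'0 HM'] := smooth1_bounded K (@smooth1_derive1n f n.+1 sf).
exists (M + M'); first exact: addr_gt0.
move=> k x; rewrite leq_eqVlt => /orP[/eqP ->|kn] xK.
  by apply: (le_trans (HM' x xK)); rewrite lerDr ltW.
by apply: (le_trans (HM k x kn xK)); rewrite lerDl ltW.
Qed.

Lemma derive1nZ (a : R) f k : smooth1 f ->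
  derive1n k (fun x => a * f x) = fun x => a * derive1n k f x.
Proof.
move=> sf; elim: k => [//|k IH]; rewrite derive1nS IH; apply/funext => x.
rewrite -[a * _]/(a *: derive1n k.+1 f x); apply: is_derive_derive1.
apply: is_deriveZ; rewrite derive1nS; apply: smooth1_is_derive.
exact: smooth1_derive1n.
Qed.

Lemma sum_geo_half N : \sum_(0 <= i < N) (2^-1 : R) ^+ i <= 2.
Proof.
suff -> : \sum_(0 <= i < N) (2^-1 : R) ^+ i = 2 - 2 * 2^-1 ^+ N.
  by rewrite gerBl mulr_ge0// exprn_ge0// invr_ge0.
elim: N => [|N IH]; first by rewrite big_geq// expr0; lra.
by rewrite big_nat_recr//= IH exprS; lra.
Qed.

Lemma sum_trunc_le (b c : nat -> R) n N : (forall i, 0 <= c i) ->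
  (forall i, (n <= i)%N -> b i <= c i) ->
  \sum_(0 <= i < N) b i <= \sum_(0 <= i < n) `|b i| + \sum_(0 <= i < N) c i.
Proof.
move=> c0 bc; elim: N => [|N IH].
  by rewrite !(big_geq (leqnn 0)) addr0 sumr_ge0.
rewrite !(@big_nat_recr _ _ _ N)//= addrA.
have [nN|Nn] := leqP n N; first by apply: lerD => //; exact: bc.
have H : \sum_(0 <= i < N.+1) b i <= \sum_(0 <= i < n) `|b i|.
  rewrite (big_cat_nat (n := N.+1) (p := n))//=.
  apply: ler_wpDr; first exact: sumr_ge0.
  by apply: ler_sum => i _; exact: ler_norm.
rewrite -(big_nat_recr N 0)//=; apply: (le_trans H).
by rewrite -addrA lerDl addr_ge0// sumr_ge0.
Qed.

(** The i-th constant bounds the derivatives of order at most i by 2^-i on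
    [-i, i]; for a fixed order and a fixed segment only finitely many terms
    escape this bound. *)
Lemma smooth1_small_series (phi : nat -> R -> R) : (forall i, smooth1 (phi i)) ->
  exists2 eps : nat -> R, forall i, 0 < eps i &
  forall A : nat -> R, (forall i, `|A i| <= eps i) ->
    smooth1 (fun x => limn (series (fun i => A i * phi i x))).
Proof.
move=> sphi.
have /choice[M HM] i : exists M, 0 < M /\ forall k x, (k <= i)%N -> `|x| <= i%:R ->
    `|derive1n k (phi i) x| <= M.
  by have [M M0 H] := @smooth1_boundedn (phi i) i i%:R (sphi i); exists M.
exists (fun i => 2^-1 ^+ i / M i) => [i|A HA].
  by rewrite divr_gt0 ?exprn_gt0 ?invr_gt0//; have [] := HM i.
apply: smooth1_series => [i|k K].
  by apply: smooth1M => //; exact (@smooth1_cst R (A i)).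
have /choice[B HB] i : exists B, forall x, `|x| <= K -> `|derive1n k (phi i) x| <= B.
  by have [B _ H] := smooth1_bounded K (@smooth1_derive1n _ k (sphi i)); exists B.
have [n Kn] : exists n : nat, K <= n%:R.
  exists (Num.truncn `|K|).+1; apply: (le_trans (ler_norm K)).
  by apply: ltW; rewrite truncnS_gt.
pose m := maxn n k.
exists (fun i => if (i < m)%N then `|A i| * B i else 2^-1 ^+ i).
  move=> i x xK; rewrite derive1nZ// normrM; case: ifPn => [_|].
    by rewrite ler_wpM2l//; exact: HB.
  rewrite -leqNgt geq_max => /andP[ni ki]; have [M0 H] := HM i.
  have H' : `|derive1n k (phi i) x| <= M i.
    by apply: H => //; apply: (le_trans xK); apply: (le_trans Kn); rewrite ler_nat.
  apply: (le_trans (ler_pM _ _ (HA i) H')) => //.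
  by rewrite divfK ?gt_eqF.
eexists => N; apply: (le_trans (sum_trunc_le (c := fun i => 2^-1 ^+ i) (n := m) _ _ _)).
- by move=> i; rewrite exprn_ge0// invr_ge0.
- by move=> i mi; rewrite ltnNge mi.
by apply: lerD; [exact: lexx|exact: sum_geo_half].
Qed.

Lemma lim_series_single (a : nat -> R) n : (forall i, i != n -> a i = 0) ->
  limn (series a) = a n.
Proof.
move=> a0; apply/cvg_lim => //; apply/cvgn_epsP => e e0; exists n.+1 => N nN.
rewrite /series/= (bigD1_seq n) ?mem_index_iota ?iota_uniq//= big1 ?addr0 ?subrr ?normr0 ?ltW//.
Qed.

(** the times at which a special curve visits its prescribed points *)
Definition visit (n : nat) : R := 2^-1 ^+ n.

Lemma visit_gt0 n : 0 < visit n.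
Proof. by rewrite exprn_gt0// invr_gt0. Qed.

Lemma visit_le n m : (n < m)%N -> visit m <= visit n / 2.
Proof.
move=> nm; rewrite /visit -exprSr; apply: ler_wiXn2l => //; first by rewrite invr_ge0.
by rewrite invf_le1// ler1n.
Qed.

Lemma visit_le1 n : visit n <= 1.
Proof. by rewrite /visit exprn_ile1 ?invr_ge0// invf_le1// ler1n. Qed.

(** The special curve lemma. Bumps around the times 2^-n, of width proportional
    to 2^-n, carry the prescribed line elements A n + B n s, and
    [smooth1_small_series] says how small these must be for the sum to be
    smooth at 0 too. *)
Lemma special_curve : exists2 eps : nat -> R, (forall n, 0 < eps n) &
  forall A B : nat -> R, (forall n, `|A n| <= eps n) -> (forall n, `|B n| <= eps n) ->
  exists2 c : R -> R, smooth1 c &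
    forall n, exists2 rho, 0 < rho &
      forall s, `|s| < rho -> c (visit n + s) = A n + B n * s.
Proof.
have [chi schi [chi1 chi0]] := bump_exists.
pose rho n := visit n / 4.
have rho0 n : 0 < rho n by rewrite divr_gt0// visit_gt0.
pose p1 n (s : R) := chi ((rho n)^-1 * (s - visit n)).
pose p2 n (s : R) := p1 n s * (s - visit n).
have sl n : smooth1 (fun s => s - visit n).
  by apply: smooth1B; [exact: smooth1_id|exact (@smooth1_cst R (visit n))].
have sp1 n : smooth1 (p1 n).
  apply: (smooth1_comp schi (g := fun s => (rho n)^-1 * (s - visit n))).
  by apply: smooth1M; [exact (@smooth1_cst R (rho n)^-1)|exact: sl].
have sp2 n : smooth1 (p2 n) by apply: smooth1M; [exact: sp1|exact: sl].
have [e1 e10 H1] := smooth1_small_series sp1.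
have [e2 e20 H2] := smooth1_small_series sp2.
exists (fun n => Num.min (e1 n) (e2 n)) => [n|A B HA HB].
  by rewrite lt_min e10 e20.
exists (fun x => limn (series (fun i => A i * p1 i x)) +
                 limn (series (fun i => B i * p2 i x))).
  apply: smooth1D; [apply: H1|apply: H2] => i.
    by apply: (le_trans (HA i)); rewrite ge_min lexx.
  by apply: (le_trans (HB i)); rewrite ge_min lexx orbT.
move=> n; exists (rho n / 2) => [|s sr]; first by rewrite divr_gt0.
have z i : i != n -> p1 i (visit n + s) = 0.
  move=> ni; apply: chi0; rewrite normrM gtr0_norm ?invr_gt0//.
  rewrite ler_pdivlMl// mulr1.
  move: sr; rewrite /rho ltr_norml => /andP[s1 s2].
  have vi := visit_gt0 i; have vn := visit_gt0 n.
  case: (ltngtP i n) ni => // [/visit_le h|/visit_le h] _.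
    by rewrite ler_normr; apply/orP; right; lra.
  by rewrite ler_normr; apply/orP; left; lra.
rewrite (@lim_series_single _ n) => [|i ni]; last by rewrite z ?mulr0.
rewrite (@lim_series_single _ n) => [|i ni]; last by rewrite /p2 z ?mul0r ?mulr0.
rewrite /p2 (addrC (visit n)) addrK (_ : p1 n _ = 1) ?mulr1 ?mul1r//.
apply: chi1; rewrite addrK normrM gtr0_norm ?invr_gt0//.
by rewrite ler_pdivrMl//; apply: ltW; rewrite mulrC; lra.
Qed.
End OneVariable.

(** * Functions of two variables that are smooth along smooth curves *)

Section TwoVariables.
Variable R : realType.
Implicit Types F : R -> R -> R.

(** Boman's theorem identifies these with the C^oo functions on the plane, but
    the spaces at hand are only tested by curves, so that the theory of partial
    derivatives is built on this form. *)
Definition smooth2 F := forall t u : R -> R, smooth1 t -> smooth1 u ->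
  smooth1 (fun s => F (t s) (u s)).

Definition along F (a b t u : R) (s : R) := F (t + s * a) (u + s * b).

Lemma smooth1_affine (t a : R) : smooth1 (fun s => t + s * a).
Proof.
apply: smooth1D; first exact (@smooth1_cst R t).
by apply: smooth1M; [exact: smooth1_id|exact (@smooth1_cst R a)].
Qed.

Lemma smooth1_along F a b t u : smooth2 F -> smooth1 (along F a b t u).
Proof. by move=> sF; apply: sF; exact: smooth1_affine. Qed.

Lemma fdiff_eq k (a b : R) f g (t t' : R) :
  (forall i, (i <= k)%N -> f (t + a *+ i) = g (t' + b *+ i)) ->
  fdiff k a f t = fdiff k b g t'.
Proof.
elim: k t t' => [|k IH] t t' H /=; first by have := H 0%N isT; rewrite !mulr0n !addr0.
congr (_ - _); apply: IH => i ik; last by apply: H; exact: leqW.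
by have := H i.+1 ik; rewrite !mulrS !addrA.
Qed.

Lemma fdiff_le k (a C t : R) f : smooth1 f -> 0 <= a ->
  (forall c, t <= c <= t + a *+ k -> `|derive1n k f c| <= C) ->
  `|fdiff k a f t| <= C * a ^+ k.
Proof.
move=> sf a0 H; have [c /H cC ->] := fdiff_MVT k t sf a0.
by rewrite normrM ger0_norm ?exprn_ge0// mulrC ler_wpM2r// exprn_ge0.
Qed.

(** Otherwise F would fail to be smooth along a special curve through points at
    which the k-th derivative in the direction (a, b) blows up. *)
Lemma dirn_locally_bounded F k a b t0 u0 : smooth2 F ->
  exists2 d : R, 0 < d & exists C, forall t u,
    `|t - t0| < d -> `|u - u0| < d -> `|derive1n k (along F a b t u) 0| <= C.
Proof.
move=> sF; have [eps e0 Hc] := @special_curve R.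
(* the n-th line element has velocity mu n (a, b), small enough in both
   coordinates *)
pose mu n := eps n / (`|a| + `|b| + 1).
have ab0 : 0 < `|a| + `|b| + 1 by have := normr_ge0 a; have := normr_ge0 b; lra.
have mu0 n : 0 < mu n by rewrite divr_gt0.
have mua n : `|mu n * a| <= eps n.
  rewrite normrM gtr0_norm// /mu mulrAC ler_pdivrMr// ler_wpM2l ?ltW//.
  by have := normr_ge0 b; lra.
have mub n : `|mu n * b| <= eps n.
  rewrite normrM gtr0_norm// /mu mulrAC ler_pdivrMr// ler_wpM2l ?ltW//.
  by have := normr_ge0 a; lra.
apply: contrapT => H.
have /choice[x Hx] n : exists x : R * R, [/\ `|x.1 - t0| < eps n, `|x.2 - u0| < eps n &
    n%:R / mu n ^+ k < `|derive1n k (along F a b x.1 x.2) 0|].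
  apply: contrapT => Hn; apply: H; exists (eps n) => //.
  exists (n%:R / mu n ^+ k) => t u ht hu; rewrite leNgt; apply/negP => h.
  by apply: Hn; exists (t, u).
have Ax n : `|(x n).1 - t0| <= eps n by apply: ltW; have [] := Hx n.
have Ay n : `|(x n).2 - u0| <= eps n by apply: ltW; have [] := Hx n.
have [c1 sc1 Hc1] := Hc (fun n => (x n).1 - t0) (fun n => mu n * a) Ax mua.
have [c2 sc2 Hc2] := Hc (fun n => (x n).2 - u0) (fun n => mu n * b) Ay mub.
pose G s := F (t0 + c1 s) (u0 + c2 s).
have sG : smooth1 G.
  apply: sF; apply: smooth1D; [|exact: sc1| |exact: sc2].
    exact (@smooth1_cst R t0).
  exact (@smooth1_cst R u0).
have [C C0 HC] := smooth1_bounded 2 (@smooth1_derive1n _ _ k sG).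
suff K n : n%:R <= C.
  have := K (Num.truncn C).+1; apply/negP; rewrite -ltNge truncnS_gt//.
have [_ _] := Hx n; rewrite ltNge => /negP h; rewrite leNgt; apply/negP => nC; apply: h.
apply: derive1n_le_fdiff; first exact: smooth1_along.
move=> d d0; have [r1 r10 Hr1] := Hc1 n; have [r2 r20 Hr2] := Hc2 n.
have mn := mu0 n.
pose e := Num.min (Num.min r1 r2) (Num.min 1 (d / mu n)) / k.+2%:R.
have e_gt0 : 0 < e by rewrite divr_gt0// !lt_min r10 r20 ltr01 divr_gt0.
have ek : e *+ k.+2 = Num.min (Num.min r1 r2) (Num.min 1 (d / mu n)).
  by rewrite -mulr_natr divfK ?pnatr_eq0.
have ei i : (i <= k)%N -> e *+ i < Num.min (Num.min r1 r2) (Num.min 1 (d / mu n)).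
  by move=> ik; rewrite -ek ltr_pMn2l// ltnS leqW.
have e1 : e < Num.min (Num.min r1 r2) (Num.min 1 (d / mu n)).
  by rewrite -ek -[ltLHS]mulr1n ltr_pMn2l.
exists (mu n * e).
  rewrite mulr_gt0//= -ltr_pdivlMl// mulrC.
  by move: e1; rewrite !lt_min => /andP[_ /andP[_]].
have -> : fdiff k (mu n * e) (along F a b (x n).1 (x n).2) 0 = fdiff k e G (visit R n).
  apply: fdiff_eq => i ik; rewrite /along /G.
  have := ei i ik; rewrite !lt_min => /andP[/andP[h1 h2] _].
  have ei0 : 0 <= e *+ i by rewrite mulrn_wge0// ltW.
  rewrite Hr1 ?ger0_norm// Hr2 ?ger0_norm// add0r.
  by congr F; rewrite addrA (addrC _ (_ - _)) subrK -mulrnAr; ring.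
have ek1 : e *+ k < 1 by have := ei k (leqnn k); rewrite !lt_min => /andP[_ /andP[]].
apply: (@le_trans _ _ (C * e ^+ k)).
  apply: fdiff_le => //; first exact: ltW.
  move=> c /andP[c_ge c_le]; apply: HC.
  have := visit_gt0 R n; have := visit_le1 R n => v1 v0.
  by rewrite ger0_norm; lra.
have -> : n%:R / mu n ^+ k * (mu n * e) ^+ k = n%:R * e ^+ k.
  by rewrite [(mu n * e) ^+ k]exprMn mulrA divfK//; exact: lt0r_neq0 (exprn_gt0 k mn).
by apply: ler_wpM2r; [apply: exprn_ge0|]; exact: ltW.
Qed.

Lemma box_bound F (K : R) :
  (forall t0 u0, exists2 d : R, 0 < d & exists C, forall t u,
    `|t - t0| < d -> `|u - u0| < d -> `|F t u| <= C) ->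
  exists2 C, 0 < C & forall t u, `|t| <= K -> `|u| <= K -> `|F t u| <= C.
Proof.
move=> H.
have cK : compact (`[- K, K] `*` `[- K, K] : set (R * R)).
  by apply: compact_setX; exact: segment_compact.
have /compact_near_coveringP/(_ nat \oo (fun N x => `|F x.1 x.2| <= N%:R)) := cK.
case=> [|N _ HN].
  move=> [t0 u0] _; have [d d0 [C HC]] := H t0 u0.
  exists ([set x | `|x.1 - t0| < d /\ `|x.2 - u0| < d], [set N | C <= N%:R]).
    split=> /=.
      apply/nbhs_ballP; exists d => // x [] /=; rewrite /ball/= => h1 h2.
      by rewrite distrC (distrC x.2).
    exists (Num.truncn `|C|).+1 => // n /= Cn; apply: (le_trans (ler_norm C)).
    by apply: (le_trans (ltW (truncnS_gt _))); rewrite ler_nat.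
  by move=> [[t u] n] [/= [h1 h2] Cn]; apply: (le_trans (HC _ _ h1 h2)).
exists N.+1%:R => // t u tK uK; have := HN N (leqnn N) (t, u).
move=> /(_ _)/le_trans; apply; last by rewrite ler_nat.
by split; rewrite /= in_itv /= -ler_norml.
Qed.

Lemma dirn_bounded F k a b (K : R) : smooth2 F ->
  exists2 C, 0 < C & forall t u, `|t| <= K -> `|u| <= K ->
    `|derive1n k (along F a b t u) 0| <= C.
Proof.
by move=> sF; apply: box_bound => t0 u0; exact: dirn_locally_bounded.
Qed.

Lemma fdiffB k (a t : R) f g :
  fdiff k a (fun s => f s - g s) t = fdiff k a f t - fdiff k a g t.
Proof. by elim: k t => [//|k IH] t /=; rewrite !IH; ring. Qed.

Lemma fdiffD k (a t : R) f g :
  fdiff k a (fun s => f s + g s) t = fdiff k a f t + fdiff k a g t.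
Proof. by elim: k t => [//|k IH] t /=; rewrite !IH; ring. Qed.

Lemma fdiff_eq0 k (a t : R) f : (forall i, (i <= k)%N -> f (t + a *+ i) = 0) ->
  fdiff k a f t = 0.
Proof.
move=> H; have -> : fdiff k a f t = fdiff k a (fun=> 0) t by exact: fdiff_eq.
by elim: k t {H} => [//|k IH] t /=; rewrite !IH subrr.
Qed.

Lemma fdiff_delta k (a t : R) f :
  (forall i, (0 < i <= k)%N -> f (t + a *+ i) = 0) ->
  fdiff k a f t = (-1) ^+ k * f t.
Proof.
elim: k t => [|k IH] t H /=; first by rewrite mul1r.
rewrite fdiff_eq0 => [|i ik]; last first.
  by rewrite -addrA -mulrS; exact: H.
rewrite sub0r IH => [|i /andP[i0 ik]]; last by apply: H; rewrite i0 leqW.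
by rewrite exprS mulN1r mulNr.
Qed.

(** A product of difference operators in the directions v, with steps
    (1 - s / j) a: for s = 0 it is a mixed difference, while for s = j a factor
    vanishes. This is Djokovic's reduction of mixed to pure differences. *)
Fixpoint mixd (s a : R) (l : seq (R * (R * R))) F (t u : R) : R :=
  if l is (j, v) :: l' then
    mixd s a l' F t u -
    mixd s a l' F (t + (1 - s / j) * a * v.1) (u + (1 - s / j) * a * v.2)
  else F t u.

Lemma mixd_eq0 s a l F t u : s != 0 -> s \in map fst l -> mixd s a l F t u = 0.
Proof.
move=> s0; elim: l t u => [//|[j v] l IH] t u /=; rewrite inE => /orP[/eqP <-|sl].
  by rewrite divff// subrr !mul0r !addr0 subrr.
by rewrite !IH// subrr.
Qed.

(** Each term moves on a line when s varies, so the n-th difference in s is a sum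
    of pure differences of F. *)
Lemma mixd_bounded n l F (y w : R * R) (K : R) : smooth2 F ->
  exists2 C, 0 <= C & forall t u a, `|t| <= K -> `|u| <= K -> 0 <= a <= 1 ->
   `|fdiff n 1 (fun s => mixd s a l F (t + a * (y.1 + s * w.1))
                                      (u + a * (y.2 + s * w.2))) 0| <= C * a ^+ n.
Proof.
move=> sF; elim: l y w => [|[j v] l IH] y w /=.
  have [C C0 HC] := @dirn_bounded F n w.1 w.2
    (K + `|y.1| + `|y.2| + n%:R * (`|w.1| + `|w.2|)) sF.
  exists C; first exact: ltW.
  move=> t u a tK uK /andP[a0 a1].
  have -> : fdiff n 1 (fun s => F (t + a * (y.1 + s * w.1)) (u + a * (y.2 + s * w.2))) 0
      = fdiff n a (along F w.1 w.2 (t + a * y.1) (u + a * y.2)) 0.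
    by apply: fdiff_eq => i _; rewrite /along -(mulr_natr a); congr F; ring.
  apply: fdiff_le => //; first exact: smooth1_along.
  rewrite !add0r => c /andP[c0 cn].
  have -> : derive1n n (along F w.1 w.2 (t + a * y.1) (u + a * y.2)) c =
            derive1n n (along F w.1 w.2 (t + a * y.1 + c * w.1) (u + a * y.2 + c * w.2)) 0.
    set f := along _ _ _ _ _; have sf : smooth1 f by exact: smooth1_along.
    rewrite -[in LHS](add0r c).
    suff -> : along F w.1 w.2 (t + a * y.1 + c * w.1) (u + a * y.2 + c * w.2) =
             (fun s => f (s + c)).
      elim: n f sf {HC cn} => [//|n IHn] f sf; rewrite !derive1Sn (derive1_shift c sf).
      by rewrite -(IHn _ (smooth1_derive sf)).
    by apply/funext => s; rewrite /f /along; congr F; ring.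
  have cn' : c <= n%:R.
    by apply: (le_trans cn); rewrite -[leLHS]mulr_natl ler_piMr.
  have bound (x z p : R) : `|x| <= K ->
      `|x + a * z + c * p| <= K + `|z| + n%:R * `|p|.
    move=> xK; apply: (le_trans (ler_normD _ _)); apply: lerD.
      apply: (le_trans (ler_normD _ _)); apply: lerD => //.
      by rewrite normrM (ger0_norm a0) ler_piMl.
    by rewrite normrM (ger0_norm c0) ler_wpM2r.
  have y1 := normr_ge0 y.1; have y2 := normr_ge0 y.2.
  have w1 := mulr_ge0 (ler0n R n) (normr_ge0 w.1).
  have w2 := mulr_ge0 (ler0n R n) (normr_ge0 w.2).
  by apply: HC; [apply: (le_trans (bound _ _ _ tK))|apply: (le_trans (bound _ _ _ uK))];
    rewrite mulrDr; move: y1 y2 w1 w2; clear; lra.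
have [C1 C10 H1] := IH y w.
have [C2 C20 H2] := IH (y.1 + v.1, y.2 + v.2) (w.1 - v.1 / j, w.2 - v.2 / j).
exists (C1 + C2) => [|t u a tK uK a01]; first exact: addr_ge0.
rewrite fdiffB mulrDl; apply: (le_trans (ler_normB _ _)).
apply: lerD; first exact: H1.
apply: le_trans (H2 t u a tK uK a01); rewrite le_eqVlt; apply/orP; left.
apply/eqP; congr (`|_|); apply: fdiff_eq => i _ /=.
by congr mixd; ring.
Qed.

Lemma mixd_fdiff a l F t u : all (fun v => v.2 == (1, 0)) l ->
  mixd 0 a l F t u = (-1) ^+ size l * fdiff (size l) a (F^~ u) t.
Proof.
elim: l t => [|[j v] l IH] t /=; first by rewrite mul1r.
move=> /andP[/eqP -> al] /=; rewrite mul0r subr0 !mul1r mulr1 mulr0 addr0.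
by rewrite !IH// exprS; ring.
Qed.

(** The mixed difference is controlled by pure differences in finitely many
    directions: the parameters j of [l] run through 1, ..., k + 1, so that in the
    difference of order k + 1 in s only the term s = 0 survives. *)
Lemma mixed_bounded F k (K : R) : smooth2 F ->
  exists2 C, 0 <= C & forall t u a, `|t| <= K -> `|u| <= K -> 0 <= a <= 1 ->
    `|fdiff k a (fun t => F t (u + a) - F t u) t| <= C * a ^+ k.+1.
Proof.
move=> sF.
pose l0 := [seq (i.+1%:R, (1, 0)) | i <- iota 0 k] : seq (R * (R * R)).
pose l : seq (R * (R * R)) := (k.+1%:R, (0, 1)) :: l0.
have [C C0 HC] := @mixd_bounded k.+1 l F (0, 0) (0, 0) K sF.
exists C => // t u a tK uK a01; have := HC t u a tK uK a01.
under [X in fdiff _ _ X _]funext do rewrite /= mulr0 addr0 mulr0 !addr0.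
have al0 : all (fun v => v.2 == (1, 0)) l0 by apply/allP => _ /mapP[i _ ->] /=.
rewrite fdiff_delta => [|i /andP[i0 ik]]; last first.
  rewrite add0r; apply: (@mixd_eq0 _ _ l); first by rewrite pnatr_eq0 -lt0n.
  rewrite /= inE; have [->|ik'] := eqVneq i k.+1; first by rewrite eqxx.
  apply/orP; right; apply/mapP; exists (i%:R, (1, 0)) => //.
  apply/mapP; exists i.-1; last by rewrite prednK.
  by rewrite mem_iota add0n /= prednK// -ltnS ltn_neqAle ik' ik.
rewrite normrM normrX normrN1 expr1n mul1r /=.
rewrite mul0r subr0 mul1r mulr0 addr0 mulr1 !mixd_fdiff// -mulrBr normrM normrX.
by rewrite normrN1 expr1n mul1r size_map size_iota distrC fdiffB.
Qed.

Lemma smooth2_fst F u : smooth2 F -> smooth1 (F^~ u).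
Proof.
by move=> sF; apply: (sF (fun s => s) (fun=> u));
  [exact: smooth1_id|exact (@smooth1_cst R u)].
Qed.

Lemma smooth2_snd F t : smooth2 F -> smooth1 (F t).
Proof.
by move=> sF; apply: (sF (fun=> t) (fun s => s));
  [exact (@smooth1_cst R t)|exact: smooth1_id].
Qed.

(** A large step b is the sum of b / a small steps; letting a tend to 0 then
    turns differences in the first variable into derivatives. *)
Lemma mixed_bounded_step F k (K : R) : smooth2 F ->
  exists2 C, 0 <= C & forall t u b, `|t| <= K -> `|u| <= K -> 0 < b <= 1 ->
    `|derive1n k (fun t => F t (u + b) - F t u) t| <= C * b.
Proof.
move=> sF; have [C C0 HC] := mixed_bounded k (K + 1) sF; exists C => //.
move=> t u b tK uK /andP[b0 b1].
have H m (a : R) : 0 <= a <= 1 -> a *+ m <= 1 ->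
    `|fdiff k a (fun t => F t (u + a *+ m) - F t u) t| <= C * (a *+ m) * a ^+ k.
  move=> /andP[a0 a1]; elim: m => [|m IH] am.
    rewrite mulr0n mulr0 mul0r fdiff_eq0 ?normr0// => i _.
    by rewrite addr0 subrr.
  have am' : a *+ m <= 1 by apply: le_trans am; rewrite mulrS lerDr.
  have am0 : 0 <= a *+ m by rewrite mulrn_wge0.
  have -> : fdiff k a (fun t => F t (u + a *+ m.+1) - F t u) t =
     fdiff k a (fun t => F t (u + a *+ m + a) - F t (u + a *+ m)) t +
     fdiff k a (fun t => F t (u + a *+ m) - F t u) t.
    by rewrite -fdiffD; apply: fdiff_eq => i _; rewrite mulrSr (addrA u) addrA subrK.
  have -> : C * (a *+ m.+1) * a ^+ k = C * a ^+ k.+1 + C * (a *+ m) * a ^+ k.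
    by rewrite mulrS exprS; ring.
  apply: (le_trans (ler_normD _ _)); apply: lerD; last exact: IH.
  apply: HC; rewrite ?a0//; first by lra.
  by apply: (le_trans (ler_normD _ _)); rewrite (ger0_norm am0); lra.
apply: derive1n_le_fdiff => [|d d0].
  by apply: smooth1B; exact: smooth2_fst.
pose m := (Num.truncn (b / d)).+1.
have m0 : 0 < m%:R :> R by rewrite ltr0n.
have bm : b / m%:R *+ m = b by rewrite -mulr_natr divfK// gt_eqF.
exists (b / m%:R).
  rewrite divr_gt0//= ltr_pdivrMr// mulrC -ltr_pdivrMr//.
  exact: truncnS_gt.
have a1 : 0 <= b / m%:R <= 1.
  rewrite divr_ge0 ?(ltW b0)//= ler_pdivrMr// mul1r; apply: (le_trans b1).
  by rewrite ler1n.
by have := H m _ a1; rewrite bm => /(_ b1).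
Qed.

Definition d2 F (t u : R) : R := derive1 (F t) u.

(** The difference quotients converge to the partial derivative, with
    derivatives bounded by [mixed_bounded_step]. *)
Lemma d2_smooth_fst F : smooth2 F -> smooth1 (fun t => d2 F t 0).
Proof.
move=> sF; pose Q n t := n.+1%:R * (F t n.+1%:R^-1 - F t 0).
have sQ n : smooth1 (fun t => F t n.+1%:R^-1 - F t 0).
  by apply: smooth1B; exact: smooth2_fst.
apply: (@smooth1_limit _ Q).
- by move=> n; apply: smooth1M; [exact (@smooth1_cst R n.+1%:R)|exact: sQ].
- move=> k K; have [C C0 HC] := mixed_bounded_step k `|K| sF; exists C => n x xK.
  rewrite derive1nZ; last exact: sQ.
  have n0 : 0 < n.+1%:R :> R by rewrite ltr0n.
  rewrite normrM ger0_norm; last exact: ltW.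
  rewrite -ler_pdivlMl// mulrC.
  have := HC x 0 n.+1%:R^-1; rewrite add0r; apply.
  + by apply: (le_trans xK); exact: ler_norm.
  + by rewrite normr0.
  + by rewrite invr_gt0 n0 invf_le1// ler1n.
move=> t; have /is_derive_epsP H := smooth1_is_derive (@smooth2_snd F t sF) 0.
apply/cvgn_epsP => e e0; have [d d0 Hd] := H e e0.
exists (Num.truncn d^-1) => n nd.
have n0 : 0 < n.+1%:R :> R by rewrite ltr0n.
have := Hd n.+1%:R^-1; rewrite add0r.
have -> : `|n.+1%:R^-1 : R| = n.+1%:R^-1 by rewrite ger0_norm// invr_ge0.
have dn : n.+1%:R^-1 < d.
  rewrite invf_plt ?posrE//; apply: (lt_le_trans (truncnS_gt _)).
  by rewrite ler_nat ltnS.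
move=> /(_ dn); rewrite ler_pdivlMr// => H1.
have -> : Q n t - d2 F t 0 = (F t n.+1%:R^-1 - F t 0 - n.+1%:R^-1 * derive1 (F t) 0) * n.+1%:R.
  rewrite /Q /d2 [RHS]mulrBl [n.+1%:R^-1 * _ * _]mulrAC mulVf ?gt_eqF// mul1r.
  by rewrite [n.+1%:R * _]mulrC.
by rewrite normrM (ger0_norm (ltW n0)).
Qed.

(** Translating along the curve moves the point of differentiation to 0. *)
Lemma smooth2_d2 F : smooth2 F -> smooth2 (d2 F).
Proof.
move=> sF t u st su.
have -> : (fun s => d2 F (t s) (u s)) = fun s => d2 (fun s v => F (t s) (u s + v)) s 0.
  apply/funext => s; rewrite /d2.
  rewrite (_ : (fun v => F (t s) (u s + v)) = fun v => F (t s) (v + u s)); last first.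
    by apply/funext => v; rewrite addrC.
  by rewrite (derive1_shift (u s) (smooth2_snd (t:=t s) sF)) add0r.
apply: d2_smooth_fst => t' u' st' su'; apply: (sF (t \o t') (fun s => u (t' s) + u' s)).
  exact: smooth1_comp.
by apply: smooth1D; [exact: (smooth1_comp su st')|exact: su'].
Qed.

Lemma derive1n_shift k (f : R -> R) (t : R) : smooth1 f ->
  derive1n k (fun s => f (t + s)) 0 = derive1n k f t.
Proof.
elim: k f => [|k IH] f sf; first by rewrite /= addr0.
rewrite !derive1Sn -IH; last exact: smooth1_derive.
congr (derive1n k _ 0); rewrite (_ : (fun s => f (t + s)) = fun s => f (s + t)).
  by rewrite derive1_shift//; apply/funext => s; rewrite addrC.
by apply/funext => s; rewrite addrC.
Qed.

Lemma derive1n_along10 k F (t u : R) : smooth2 F ->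
  derive1n k (along F 1 0 t u) 0 = derive1n k (F^~ u) t.
Proof.
move=> sF; rewrite -[RHS]derive1n_shift; last exact: smooth2_fst.
by congr (derive1n k _ 0); apply/funext => s; rewrite /along mulr0 addr0 mulr1.
Qed.

Lemma smooth2_bounded_fst F k (K : R) : smooth2 F ->
  exists2 C, 0 < C & forall t u, `|t| <= K -> `|u| <= K ->
    `|derive1n k (F^~ u) t| <= C.
Proof.
move=> sF; have [C C0 HC] := dirn_bounded k 1 0 K sF; exists C => // t u tK uK.
by rewrite -derive1n_along10//; exact: HC.
Qed.

(** The difference quotient is a limit of averages of f', and averages of a
    smooth family are smooth: hence the Hadamard quotient below is. *)
Lemma riemann_sum f (u : R) : smooth1 f -> u != 0 ->
  n.+1%:R^-1 * (\sum_(0 <= i < n.+1) derive1 f (i%:R / n.+1%:R * u)) @[n --> \oo]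
    --> (f u - f 0) / u.
Proof.
move=> sf u0.
have [C C0 HC] := smooth1_bounded `|u| (@smooth1_derive1n _ f 2 sf).
apply/cvgn_epsP => e e0; exists (Num.truncn (C * `|u| / e)) => n nN.
have n0 : 0 < n.+1%:R :> R by rewrite ltr0n.
pose h := u / n.+1%:R.
have hle (i : nat) : (i <= n.+1)%N -> `|i%:R * h| <= `|u|.
  move=> le_i; rewrite normrM /h normrM normfV ger0_norm// (gtr0_norm n0).
  by rewrite mulrCA ler_piMr// ler_pdivrMr// mul1r ler_nat.
have -> : f u - f 0 = \sum_(0 <= i < n.+1) (f (i.+1%:R * h) - f (i%:R * h)).
  rewrite telescope_sumr// mul0r; congr (f _ - _).
  by rewrite /h mulrCA divff ?mulr1// gt_eqF.
have -> : n.+1%:R^-1 * \sum_(0 <= i < n.+1) derive1 f (i%:R / n.+1%:R * u) =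
   (\sum_(0 <= i < n.+1) (h * derive1 f (i%:R * h))) / u.
  rewrite -mulr_sumr /h [RHS]mulrC mulrA mulrA mulVf// mul1r; congr (_ * _).
  by apply: eq_bigr => i _; congr (derive1 f _); ring.
rewrite -mulrBl normrM normfV ler_pdivrMr ?normr_gt0// -sumrB.
apply: (le_trans (ler_norm_sum _ _ _)).
apply: (@le_trans _ _ (\sum_(0 <= i < n.+1) C * h ^+ 2)).
  rewrite big_nat [leRHS]big_nat; apply: ler_sum => i /andP[_ lei].
  rewrite distrC.
  have -> : i.+1%:R * h = i%:R * h + h by rewrite -natr1 mulrDl mul1r.
  have := @smooth1_taylor _ f `|u| C sf HC (i%:R * h) h; apply; first exact/hle/ltnW.
  by have := hle i.+1 lei; rewrite -natr1 mulrDl mul1r.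
rewrite sumr_const_nat subn0 -mulr_natr /h expr_div_n -(real_normK (num_real u)).
have -> : C * (`|u| ^+ 2 / n.+1%:R ^+ 2) * n.+1%:R = (C * `|u| / n.+1%:R) * `|u|.
  by field; rewrite addrC natr1 gt_eqF.
rewrite ler_wpM2r// ler_pdivrMr// [leRHS]mulrC -ler_pdivrMr//.
apply: (le_trans (ltW (truncnS_gt _))).
by rewrite ler_nat ltnS.
Qed.

(** Hadamard's lemma; at u = 0 the quotient has to be the partial derivative. *)
Lemma smooth2_quotient F : smooth2 F ->
  exists2 G, smooth2 G & forall t u, F t u = F t 0 + u * G t u.
Proof.
move=> sF; pose G t u := if u == 0 then d2 F t 0 else (F t u - F t 0) / u.
exists G; last first.
  move=> t u; rewrite /G; case: eqVneq => [->|u0]; first by rewrite mul0r addr0.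
  by rewrite mulrCA divff// mulr1 addrC subrK.
move=> t u st su; have sd := smooth2_d2 sF.
pose H (s v : R) := d2 F (t s) (v * u s).
have sH : smooth2 H.
  move=> a b sa sb; apply: (sd (t \o a) (fun s => b s * u (a s))).
    exact: smooth1_comp.
  by apply: smooth1M; [exact: sb|exact: (smooth1_comp su sa)].
pose Q n s := n.+1%:R^-1 * \sum_(0 <= i < n.+1) H s (i%:R / n.+1%:R).
have sQ n : smooth1 (fun s => \sum_(0 <= i < n.+1) H s (i%:R / n.+1%:R)).
  by apply: smooth1_sum => i; exact: smooth2_fst.
apply: (@smooth1_limit _ Q).
- move=> n; apply: smooth1M; [exact (@smooth1_cst R n.+1%:R^-1)|exact: sQ].
- move=> k K; have [C C0 HC] := smooth2_bounded_fst k (`|K| + 1) sH.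
  exists C => n x xK; rewrite derive1nZ; last exact: sQ.
  rewrite (@derive1n_sum _ (fun i s => H s (i%:R / n.+1%:R))); last first.
    by move=> i; exact: smooth2_fst.
  have n0 : 0 < n.+1%:R :> R by rewrite ltr0n.
  rewrite normrM ger0_norm ?invr_ge0// ler_pdivrMl//.
  apply: (le_trans (ler_norm_sum _ _ _)).
  apply: (@le_trans _ _ (\sum_(0 <= i < n.+1) C)); last first.
    by rewrite sumr_const_nat subn0 mulr_natl.
  rewrite big_nat [leRHS]big_nat; apply: ler_sum => i /andP[_ lei].
  apply: HC; first by apply: (le_trans xK); have := ler_norm K; lra.
  rewrite ger0_norm ?divr_ge0//; apply: (@le_trans _ _ 1); last by rewrite lerDr.
  by rewrite ler_pdivrMr// mul1r ler_nat ltnW.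
move=> s; rewrite /Q /H /G; case: eqVneq => [->|us].
  have -> : (fun n => n.+1%:R^-1 * \sum_(0 <= i < n.+1) d2 F (t s) (i%:R / n.+1%:R * 0)) =
    fun=> d2 F (t s) 0.
    apply/funext => n; under eq_bigr do rewrite mulr0.
    rewrite sumr_const_nat subn0 -[d2 F (t s) 0 *+ _]mulr_natl mulrA mulVf ?mul1r//.
    by rewrite pnatr_eq0.
  exact: cvg_cst.
exact: (riemann_sum (smooth2_snd (t:=t s) sF) us).
Qed.

Lemma is_derive_quad f (x a C : R) :
  (forall h, `|h| <= 1 -> `|f (x + h) - f x - h * a| <= C * h ^+ 2) ->
  is_derive x 1 f a.
Proof.
move=> H; apply/is_derive_epsP => e e0; exists (Num.min 1 (e / (`|C| + 1))).
  by rewrite lt_min ltr01 divr_gt0// ltr_wpDl.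
move=> h; rewrite lt_min => /andP[/ltW h1 hC].
apply: (le_trans (H h h1)); rewrite -(real_normK (num_real h)) expr2 mulrA ler_wpM2r//.
apply: (@le_trans _ _ ((`|C| + 1) * `|h|)).
  by rewrite ler_wpM2r//; have := ler_norm C; lra.
by move: hC; rewrite ltr_pdivlMr ?ltr_wpDl// mulrC => /ltW.
Qed.

Lemma smooth1_quad f (x : R) : smooth1 f -> exists2 C, 0 < C &
  forall h, `|h| <= 1 -> `|f (x + h) - f x - h * derive1 f x| <= C * h ^+ 2 /\
    `|f (x + h) - f x| <= C * `|h|.
Proof.
move=> sf.
have [C C0 HC] := smooth1_bounded (`|x| + 1) (@smooth1_derive1n _ f 2 sf).
have H h : `|h| <= 1 -> `|f (x + h) - f x - h * derive1 f x| <= C * h ^+ 2.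
  move=> h1; apply: (smooth1_taylor sf HC); first by rewrite lerDl.
  by apply: (le_trans (ler_normD _ _)); rewrite lerD2l.
exists (C + `|derive1 f x|); first by rewrite ltr_wpDr.
move=> h h1; split.
  by apply: (le_trans (H h h1)); rewrite ler_wpM2r ?sqr_ge0// lerDl.
rewrite -(subrK (h * derive1 f x) (f (x + h) - f x)) mulrDl.
apply: (le_trans (ler_normD _ _)); apply: lerD; last by rewrite normrM mulrC.
apply: (le_trans (H h h1)); apply: ler_wpM2l; first exact: ltW.
by rewrite -(real_normK (num_real h)) expr2 ler_piMr.
Qed.

(** Locally bounded partial derivatives G k j of all orders suffice for the chain
    rule along curves, hence for smoothness by coinduction. *)
Section PartialDerivatives.
Variable G : nat -> nat -> R -> R -> R.
Hypothesis G1 : forall k j (t s : R), is_derive t 1 (G k j ^~ s) (G k.+1 j t s).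
Hypothesis G2 : forall k j (t s : R), is_derive s 1 (G k j t) (G k j.+1 t s).
Hypothesis Gb : forall k j (K : R), exists2 C, 0 < C & forall t s,
  `|t| <= K -> `|s| <= K -> `|G k j t s| <= C.

Let sG1 k j s : smooth1 (G k j ^~ s).
Proof.
apply: (@smooth1_coind R (fun f => exists k, f = G k j ^~ s)).
  move=> _ [i ->]; exists (G i.+1 j ^~ s); last by move=> t; exact: G1.
  by apply: alg_incl; exists i.+1.
by apply: alg_incl; exists k.
Qed.

Let sG2 k j t : smooth1 (G k j t).
Proof.
apply: (@smooth1_coind R (fun f => exists j, f = G k j t)).
  move=> _ [i ->]; exists (G k i.+1 t); last by move=> s; exact: G2.
  by apply: alg_incl; exists i.+1.
by apply: alg_incl; exists j.
Qed.

Let dG1 k j s : derive1 (G k j ^~ s) = G k.+1 j ^~ s.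
Proof. by apply/funext => t; exact: is_derive_derive1. Qed.

Let dG2 k j t : derive1 (G k j t) = G k j.+1 t.
Proof. by apply/funext => s; exact: is_derive_derive1. Qed.

Lemma taylor2 k j (K : R) : exists2 C, 0 < C & forall t s t' s',
  `|t| <= K -> `|s| <= K -> `|t'| <= K -> `|s'| <= K ->
  `|G k j t' s' - G k j t s - ((t' - t) * G k.+1 j t s + (s' - s) * G k j.+1 t s)|
    <= C * ((t' - t) ^+ 2 + `|t' - t| * `|s' - s| + (s' - s) ^+ 2).
Proof.
have [C1 C10 H1] := Gb k.+2 j K; have [C2 C20 H2] := Gb k j.+2 K.
have [C3 C30 H3] := Gb k.+1 j.+1 K.
exists (C1 + C2 + C3) => [|t s t' s' tK sK t'K s'K]; first by rewrite !addr_gt0.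
have E1 : `|G k j t' s' - G k j t s' - (t' - t) * G k.+1 j t s'| <= C1 * (t' - t) ^+ 2.
  have bd x : `|x| <= K -> `|derive1n 2 (G k j ^~ s') x| <= C1.
    by move=> xK; rewrite !derive1Sn dG1 dG1; exact: H1.
  have tt : t + (t' - t) = t' by rewrite addrC subrK.
  have := @smooth1_taylor R _ K C1 (@sG1 k j s') bd t (t' - t) tK.
  by rewrite tt dG1; apply.
have E2 : `|G k j t s' - G k j t s - (s' - s) * G k j.+1 t s| <= C2 * (s' - s) ^+ 2.
  have bd x : `|x| <= K -> `|derive1n 2 (G k j t) x| <= C2.
    by move=> xK; rewrite !derive1Sn dG2 dG2; exact: H2.
  have ss : s + (s' - s) = s' by rewrite addrC subrK.
  have := @smooth1_taylor R _ K C2 (@sG2 k j t) bd s (s' - s) sK.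
  by rewrite ss dG2; apply.
have lip (x y : R) : x <= y -> `|x| <= K -> `|y| <= K ->
    `|G k.+1 j t y - G k.+1 j t x| <= C3 * `|y - x|.
  move=> xy xK yK; have [c /andP[c1 c2] ->] := smooth1_MVT (@sG2 k.+1 j t) xy.
  rewrite normrM dG2 ler_wpM2r//; apply: H3 => //.
  by move: xK yK; rewrite !ler_norml => /andP[? ?] /andP[? ?]; apply/andP; split; lra.
have E3 : `|G k.+1 j t s' - G k.+1 j t s| <= C3 * `|s' - s|.
  have [ss|/ltW ss] := leP s s'; first exact: lip.
  by rewrite distrC (distrC s'); exact: lip.
have -> : G k j t' s' - G k j t s - ((t' - t) * G k.+1 j t s + (s' - s) * G k j.+1 t s) =
  (G k j t' s' - G k j t s' - (t' - t) * G k.+1 j t s') +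
  (t' - t) * (G k.+1 j t s' - G k.+1 j t s) +
  (G k j t s' - G k j t s - (s' - s) * G k j.+1 t s) by ring.
apply: (le_trans (ler_normD _ _)); rewrite [leRHS]mulrDr; apply: lerD; last first.
  by apply: (le_trans E2); rewrite ler_wpM2r ?sqr_ge0//; lra.
apply: (le_trans (ler_normD _ _)); rewrite [leRHS]mulrDr; apply: lerD.
  by apply: (le_trans E1); rewrite ler_wpM2r ?sqr_ge0//; lra.
rewrite normrM mulrCA ler_wpM2l//; apply: (le_trans E3).
by rewrite ler_wpM2r//; lra.
Qed.

Lemma chain2 k j (t u : R -> R) (x : R) : smooth1 t -> smooth1 u ->
  is_derive x 1 (fun s => G k j (t s) (u s))
    (G k.+1 j (t x) (u x) * derive1 t x + G k j.+1 (t x) (u x) * derive1 u x).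
Proof.
move=> st su; have [Ct Ct0 Ht] := smooth1_quad x st; have [Cu Cu0 Hu] := smooth1_quad x su.
pose K := `|t x| + `|u x| + Ct + Cu.
have nt := normr_ge0 (t x); have nu := normr_ge0 (u x).
have [C C0 HC] := taylor2 k j K.
pose T := G k.+1 j (t x) (u x); pose U := G k j.+1 (t x) (u x).
apply: (@is_derive_quad _ _ _ (C * (Ct ^+ 2 + Ct * Cu + Cu ^+ 2) + (`|T| * Ct + `|U| * Cu))).
move=> h h1; have [Ht1 Ht2] := Ht h h1; have [Hu1 Hu2] := Hu h h1.
have h0 := normr_ge0 h.
have tK : `|t (x + h)| <= K.
  rewrite -(subrK (t x) (t (x + h))); apply: (le_trans (ler_normD _ _)).
  have : Ct * `|h| <= Ct by rewrite ler_piMr// ltW.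
  by rewrite /K; move: Ht2 nu Cu0; lra.
have uK : `|u (x + h)| <= K.
  rewrite -(subrK (u x) (u (x + h))); apply: (le_trans (ler_normD _ _)).
  have : Cu * `|h| <= Cu by rewrite ler_piMr// ltW.
  by rewrite /K; move: Hu2 nt Ct0; lra.
have txK : `|t x| <= K by rewrite /K; move: nu Ct0 Cu0; lra.
have uxK : `|u x| <= K by rewrite /K; move: nt Ct0 Cu0; lra.
have := HC _ _ _ _ txK uxK tK uK.
set a := t (x + h) - t x in Ht1 Ht2 *; set b := u (x + h) - u x in Hu1 Hu2 *.
rewrite -/T -/U => E.
have hh : h ^+ 2 = `|h| * `|h| by rewrite -expr2 real_normK// num_real.
have aa : a ^+ 2 <= Ct ^+ 2 * h ^+ 2.
  rewrite -(real_normK (num_real h)) -exprMn -(real_normK (num_real a)).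
  by rewrite lerXn2r// nnegrE// mulr_ge0// ltW.
have bb : b ^+ 2 <= Cu ^+ 2 * h ^+ 2.
  rewrite -(real_normK (num_real h)) -exprMn -(real_normK (num_real b)).
  by rewrite lerXn2r// nnegrE// mulr_ge0// ltW.
have ab : `|a| * `|b| <= Ct * Cu * h ^+ 2.
  by rewrite hh mulrACA; apply: ler_pM.
have -> : G k j (t (x + h)) (u (x + h)) - G k j (t x) (u x) -
    h * (T * derive1 t x + U * derive1 u x) =
  (G k j (t (x + h)) (u (x + h)) - G k j (t x) (u x) - (a * T + b * U)) +
  (T * (a - h * derive1 t x) + U * (b - h * derive1 u x)) by ring.
apply: (le_trans (ler_normD _ _)); rewrite [leRHS]mulrDl; apply: lerD.
  apply: (le_trans E); rewrite -mulrA; apply: ler_wpM2l; first exact: ltW.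
  rewrite !mulrDl.
  by apply: lerD => //; apply: lerD.
apply: (le_trans (ler_normD _ _)); rewrite [leRHS]mulrDl -!mulrA !normrM.
by apply: lerD; exact: ler_wpM2l.
Qed.

Lemma smooth2_partials : smooth2 (G 0 0).
Proof.
move=> t u st su.
apply: (@smooth1_coind R (fun f => exists k j, f = fun s => G k j (t s) (u s))).
  move=> _ [k [j ->]].
  exists (fun x => G k.+1 j (t x) (u x) * derive1 t x + G k j.+1 (t x) (u x) * derive1 u x).
    have dt := smooth1_derive st; have du := smooth1_derive su.
    apply: alg_add; apply: alg_mul.
    + by apply: alg_incl; exists k.+1, j.
    + exact: alg_smooth.
    + by apply: alg_incl; exists k, j.+1.
    + exact: alg_smooth.
  by move=> x; exact: chain2.
by apply: alg_incl; exists 0%N, 0%N.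
Qed.

End PartialDerivatives.

(** Smoothness on the space C^oo(R), tested on its smooth curves. *)
Definition smooth_functional (L : (R -> R) -> R) : Prop :=
  forall F, smooth2 F -> smooth1 (fun t => L (F t)).

Lemma smooth2_iter_d2 F j : smooth2 F -> smooth2 (fun t s => derive1n j (F t) s).
Proof. by move=> sF; elim: j => [|j IH]; [exact: sF|exact: (smooth2_d2 IH)]. Qed.

(** Weights whose tails are at most half of the preceding term, so that a maximal term
    dominates all later ones in a weighted sum. *)
Definition third (n : nat) : R := 3^-1 ^+ n.

Lemma third_gt0 n : 0 < third n.
Proof. by rewrite exprn_gt0// invr_gt0. Qed.

Lemma thirdS n : third n.+1 = third n / 3.
Proof. by rewrite /third exprSr. Qed.

Lemma sum_third i N : \sum_(i.+1 <= l < N) third l <= third i / 2.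
Proof.
have i0 := third_gt0 i.
have [Ni|iN] := leqP N i.+1; first by rewrite big_geq// divr_ge0// ltW.
suff -> : \sum_(i.+1 <= l < N) third l = (third i - third N.-1) / 2.
  by have := third_gt0 N.-1; lra.
case: N iN => // N; rewrite ltnS => iN /=.
elim: N iN => [//|N IH]; rewrite ltnS leq_eqVlt => /orP[/eqP ->|iN].
  by rewrite big_nat1 thirdS; lra.
rewrite (@big_nat_recr _ _ _ N.+1) /=; last exact: ltnW.
by rewrite (IH iN) (thirdS N); lra.
Qed.

Lemma sum_third0 N : \sum_(0 <= l < N) third l <= 2.
Proof.
case: N => [|N]; first by rewrite big_geq.
rewrite big_nat_recl//= -(big_add1 _ _ 0 N.+1 xpredT third).
by have := sum_third 0 N.+1; rewrite /third expr0; lra.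
Qed.

Definition point_functional (j : nat) (lam s : nat -> R) (phi : R -> R) : R :=
  limn (series (fun n => lam n * derive1n j phi (s n))).
End TwoVariables.

(** * Families of smooth functions tested by functionals *)

Section SmoothFunctionals.
Variable R : realType.
Implicit Types F : R -> R -> R.
Local Notation third := (third R).

Lemma cvg_point_functional j (lam s : nat -> R) (K : R) (phi : R -> R) :
  (forall n, `|lam n| <= third n) -> (forall n, `|s n| <= K) -> smooth1 phi ->
  cvgn (series (fun n => lam n * derive1n j phi (s n))).
Proof.
move=> Hl Hs sphi; have [C C0 HC] := smooth1_bounded K (@smooth1_derive1n _ phi j sphi).
suff H N : \sum_(0 <= i < N) `|lam i * derive1n j phi (s i)| <= C * 2.
  exact: (summable_cvg H).
apply: (@le_trans _ _ (\sum_(0 <= i < N) C * third i)); last first.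
  by rewrite -mulr_sumr ler_wpM2l ?(ltW C0)//; exact: sum_third0.
apply: ler_sum => i _; rewrite normrM mulrC.
by apply: ler_pM => //; exact: HC.
Qed.

Lemma smooth_point_functional j (lam s : nat -> R) (K : R) :
  (forall n, `|lam n| <= third n) -> (forall n, `|s n| <= K) ->
  smooth_functional (point_functional j lam s).
Proof.
move=> Hl Hs F /(@smooth2_iter_d2 R F j) sF; apply: smooth1_series => [i|k K'].
  apply: smooth1M; first exact (@smooth1_cst R (lam i)).
  exact: (smooth2_fst (u:=s i) sF).
have [C C0 HC] := smooth2_bounded_fst k (Num.max K K') sF.
exists (fun i => C * third i) => [i t tK|].
  rewrite derive1nZ; last exact: (smooth2_fst (u:=s i) sF).
  rewrite normrM mulrC; apply: ler_pM => //.
  by apply: HC; rewrite le_max ?tK ?orbT// Hs.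
by exists (C * 2) => N; rewrite -mulr_sumr ler_wpM2l ?(ltW C0)//; exact: sum_third0.
Qed.

Lemma fdiff_lim k (a t : R) (u : nat -> R -> R) :
  (forall t, cvgn (series (fun n => u n t))) ->
  series (fun n => fdiff k a (u n) t) @ \oo -->
    fdiff k a (fun t => limn (series (fun n => u n t))) t.
Proof.
move=> cu; elim: k t => [|k IH] t /=; first exact: cu.
have -> : series (fun n => fdiff k a (u n) (t + a) - fdiff k a (u n) t) =
  series (fun n => fdiff k a (u n) (t + a)) \- series (fun n => fdiff k a (u n) t).
  by apply/funext => N; rewrite /series/= sumrB.
by apply: cvgB; exact: IH.
Qed.

Lemma fdiffZ k (a t c : R) f : fdiff k a (fun s => c * f s) t = c * fdiff k a f t.
Proof. by elim: k t => [//|k IH] t /=; rewrite !IH mulrBr. Qed.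

(** One of the two signs of the diagonal term does not decrease the norm of what
    precedes it. *)
Lemma choose_signs (d : nat -> nat -> R) : exists2 e : nat -> R,
  (forall i, `|e i| = 1) &
  forall i, third i * `|d i i| <= `|\sum_(0 <= l < i.+1) e l * third l * d i l|.
Proof.
pose pick (e : nat -> R) n : R :=
  if third n * `|d n n| <= `|\sum_(0 <= l < n) e l * third l * d n l + third n * d n n|
  then 1 else -1.
pose fix sg n : nat -> R := if n is n'.+1 then
  fun i => if i == n' then pick (sg n') n' else sg n' i else fun=> 1.
have sgE n l : (l < n)%N -> sg n l = sg l.+1 l.
  elim: n => [//|n IH]; rewrite ltnS leq_eqVlt => /orP[/eqP ->//|ln].
  by rewrite /= ltn_eqF// IH//= eqxx.
exists (fun i => sg i.+1 i) => i.
  by rewrite /= eqxx /pick; case: ifP; rewrite ?normrN1 ?normr1.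
rewrite big_nat_recr//=.
have -> : \sum_(0 <= l < i) (if l == l then pick (sg l) l else sg l l) * third l * d i l =
    \sum_(0 <= l < i) sg i l * third l * d i l.
  by rewrite big_nat [RHS]big_nat; apply: eq_bigr => l /andP[_ li]; rewrite (sgE i)// /= eqxx.
rewrite eqxx /pick; set P := \sum_(_ <= _ < _) _.
case: ifPn => [|]; rewrite ?mul1r// -ltNge => H.
rewrite mulN1r mulNr; set y := third i * d i i in H *.
have -> : third i * `|d i i| = `|y| by rewrite normrM gtr0_norm// third_gt0.
have Ey : `|y| = third i * `|d i i| by rewrite normrM gtr0_norm// third_gt0.
rewrite -Ey in H.
have E : 2 * `|y| <= `|P + y| + `|P - y|.
  rewrite -[2 * _](@ger0_norm _ (2 * `|y|)) ?mulr_ge0// normrM normr_id -normrM.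
  rewrite (_ : 2 * y = (P + y) - (P - y)); last by ring.
  exact: ler_normB.
by lra.
Qed.

Lemma fdiff_param k (a t : R) f : (forall t : R, smooth1 (f t)) ->
  smooth1 (fun s => fdiff k a (f^~ s) t) /\
  derive1 (fun s => fdiff k a (f^~ s) t) =
    fun s => fdiff k a (fun t => derive1 (f t) s) t.
Proof.
move=> sf; elim: k t => [|k IH] t /=; first by split; [exact: sf|].
have [s1 d1] := IH (t + a); have [s2 d2] := IH t.
split; first exact: (smooth1B s1 s2).
by rewrite (derive1B_fun s1 s2) d1 d2.
Qed.

Lemma derive1nB k (f h : R -> R) : smooth1 f -> smooth1 h ->
  derive1n k (fun t => f t - h t) = fun t => derive1n k f t - derive1n k h t.
Proof.
elim: k f h => [//|k IH] f h sf sh; rewrite !derive1Sn (derive1B_fun sf sh).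
by rewrite (IH _ _ (smooth1_derive sf) (smooth1_derive sh)).
Qed.

Lemma fdiff_param_n k j (a t : R) f : (forall t : R, smooth1 (f t)) ->
  derive1n j (fun s => fdiff k a (f^~ s) t) =
    fun s => fdiff k a (fun t => derive1n j (f t) s) t.
Proof.
move=> sf; elim: j => [//|j IH]; rewrite derive1nS IH.
have sfj t' : smooth1 (derive1n j (f t')) by exact: smooth1_derive1n.
by have [_ ->] := fdiff_param k a t sfj.
Qed.

Section UniformBoundedness.
Variable g : R -> R -> R.
Hypothesis sg : forall t, smooth1 (g t).
Hypothesis Lg : forall L, smooth_functional L -> smooth1 (fun t => L (g t)).

Let dg j t s := derive1n j (g t) s.

Let sdg j t : smooth1 (dg j t).
Proof. exact: smooth1_derive1n. Qed.

Let sdg1 j s : smooth1 (dg j ^~ s).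
Proof.
apply: (@Lg (fun phi => derive1n j phi s)) => F sF.
exact: (@smooth2_fst R _ s (@smooth2_iter_d2 R F j sF)).
Qed.

(** Gliding hump: otherwise choose points at which the differences grow like
    4^n, with s maximal for the given t and a. The Dirac functionals at these
    points, with weights 3^-n and suitable signs, add up to a smooth functional
    along which the family has unbounded differences. *)
Lemma fdiff_unif_bounded k j (K : R) : exists C, forall t s a,
  `|t| <= K -> `|s| <= K -> 0 < a <= 1 -> `|fdiff k a (dg j ^~ s) t| <= C * a ^+ k.
Proof.
have [K0|K0] := ltP K 0.
  exists 0 => t s a tK; have := le_lt_trans tK K0; by rewrite normr_lt0.
apply: contrapT => H.
have /choice[x Hx] n : exists x : R * R * R, [/\ `|x.1.1| <= K, `|x.2| <= K,
    0 < x.1.2 <= 1, 4 ^+ n * x.1.2 ^+ k < `|fdiff k x.1.2 (dg j ^~ x.2) x.1.1| &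
    forall s, `|s| <= K -> `|fdiff k x.1.2 (dg j ^~ s) x.1.1| <=
                           `|fdiff k x.1.2 (dg j ^~ x.2) x.1.1|].
  apply: contrapT => Hn; apply: H; exists (4 ^+ n) => t s a tK sK a01.
  rewrite leNgt; apply/negP => h; apply: Hn.
  pose D s := `|fdiff k a (dg j ^~ s) t|.
  have cD : continuous D.
    move=> z; apply: cvg_norm.
    have [sD _] := fdiff_param k a t (@sdg j).
    exact: (smooth1_continuous sD).
  have KK : - K <= K by lra.
  have [z zK Hz] := EVT_max KK (continuous_subspaceT (A := [set` `[-K, K]]) cD).
  exists (t, a, z); split=> //=; first by rewrite ler_norml; move: zK; rewrite in_itv.
    by apply: (lt_le_trans h); apply: Hz; rewrite in_itv /= -ler_norml.
  by move=> w wK; apply: Hz; rewrite in_itv /= -ler_norml.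
pose t n := (x n).1.1; pose a n := (x n).1.2; pose s n := (x n).2.
pose d i l := fdiff k (a i) (dg j ^~ (s l)) (t i).
have [e e1 He] := choose_signs d.
pose lam n := e n * third n.
have third0 n : 0 < third n by exact: third_gt0.
have lamE n : `|lam n| = third n by rewrite normrM e1 mul1r gtr0_norm.
have lam_le n : `|lam n| <= third n by rewrite lamE.
have sK n : `|s n| <= K by have [] := Hx n.
have sL := Lg (@smooth_point_functional j _ _ _ lam_le sK).
have [C C0 HC] := smooth1_bounded (K + k%:R) (@smooth1_derive1n _ _ k sL).
have up i : `|fdiff k (a i) (fun t => point_functional j lam s (g t)) (t i)| <= C * a i ^+ k.
  have [tK _ /andP[a0 a1] _ _] := Hx i.
  apply: fdiff_le => //; first exact: ltW.
  move=> c /andP[c1 c2]; apply: HC; rewrite ler_norml.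
  have ak : a i *+ k <= k%:R by rewrite -[leLHS]mulr_natl ler_piMr.
  move: tK; rewrite -/(t i) ler_norml => /andP[t1 t2].
  have k0 := ler0n R k.
  by apply/andP; split; lra.
have low i : `|d i i| * third i / 2 <=
    `|fdiff k (a i) (fun t => point_functional j lam s (g t)) (t i)|.
  have cu t' : cvgn (series (fun n => lam n * dg j t' (s n))).
    exact: (@cvg_point_functional j _ _ _ _ lam_le sK (@sg t')).
  have := @fdiff_lim k (a i) (t i) (fun n t' => lam n * dg j t' (s n)) cu.
  move/cvg_norm => cv; apply: (cvgr_to_ge cv); exists i.+1 => // N /= iN.
  rewrite /series /= (big_cat_nat (n := i.+1))//=.
  rewrite (eq_bigr (fun l => e l * third l * d i l)); last by move=> l _; rewrite fdiffZ.
  set A := \sum_(0 <= l < i.+1) _; set B := \sum_(i.+1 <= l < N) _.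
  have HA : third i * `|d i i| <= `|A| by exact: He.
  have HB : `|B| <= `|d i i| * (third i / 2).
    apply: (le_trans (ler_norm_sum _ _ _)).
    apply: (@le_trans _ _ (\sum_(i.+1 <= l < N) `|d i i| * third l)); last first.
      by rewrite -mulr_sumr ler_wpM2l// sum_third.
    apply: ler_sum => l _; rewrite fdiffZ normrM lamE mulrC ler_wpM2r ?(ltW (third0 _))//.
    by have [_ _ _ _] := Hx i; apply.
  have := lerB_normD A B; lra.
suff E n : (4 / 3) ^+ n <= 2 * C.
  have := E (Num.truncn (6 * C)).+1; apply/negP; rewrite -ltNge.
  have := truncnS_gt (6 * C); set N := (Num.truncn _).+1 => HN.
  apply: (@lt_le_trans _ _ (N%:R / 3)); first by lra.
  rewrite (_ : 4 / 3 = 1 + 1 / 3 :> R); last by lra.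
  elim: N {HN} => [|N IH]; first by rewrite mul0r.
  have h1 : 1 <= (1 + 1 / 3 : R) ^+ N by apply: exprn_ege1; lra.
  by rewrite exprS -natr1; lra.
have [_ _ /andP[a0 _] Hd _] := Hx n.
have ak : 0 < a n ^+ k by rewrite exprn_gt0.
rewrite -(ler_pM2r ak).
have := le_trans (low n) (up n).
have -> : (4 / 3 : R) ^+ n = 4 ^+ n * third n by rewrite expr_div_n /third exprVn.
have : 4 ^+ n * a n ^+ k * third n <= `|d n n| * third n by rewrite ler_wpM2r// ltW.
by rewrite mulrAC; lra.
Qed.

Let G k j t s := derive1n k (dg j ^~ s) t.

(** Dirac functionals give the partial derivatives of the family, and the uniform
    estimate gives their local bounds and lets the derivatives in the two
    variables be exchanged. *)
Lemma smooth2_of_functionals : smooth2 g.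
Proof.
apply: (@smooth2_partials R G).
- move=> k j t s; rewrite /G derive1nS; apply: smooth1_is_derive.
  exact: smooth1_derive1n.
- move=> k j t s; have [C HC] := fdiff_unif_bounded k j.+2 (`|t| + `|s| + 1).
  have ns := normr_ge0 s; have nt := normr_ge0 t.
  apply: (@is_derive_quad _ _ _ _ C) => h h1.
  pose q t := dg j t (s + h) - dg j t s - h * dg j.+1 t s.
  have sq1 : smooth1 (fun t => dg j t (s + h) - dg j t s) by apply: smooth1B; exact: sdg1.
  have sq2 : smooth1 (fun t => h * dg j.+1 t s).
    by apply: smooth1M; [exact (@smooth1_cst R h)|exact: sdg1].
  have -> : G k j t (s + h) - G k j t s - h * G k j.+1 t s = derive1n k q t.
    rewrite /q (derive1nB k sq1 sq2).
    rewrite (derive1nB k (@sdg1 j (s + h)) (@sdg1 j s)).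
    by rewrite (derive1nZ h k (@sdg1 j.+1 s)).
  apply: derive1n_le_fdiff => [|d d0]; first exact: smooth1B.
  exists (Num.min 1 (d / 2)).
    rewrite lt_min ltr01 divr_gt0//= gt_min; apply/orP; right; lra.
  set a := Num.min _ _; have a0 : 0 < a by rewrite lt_min ltr01 divr_gt0.
  have a1 : a <= 1 by rewrite ge_min lexx.
  pose D s := fdiff k a (dg j ^~ s) t.
  have [sD dD] := fdiff_param k a t (@sdg j).
  have -> : fdiff k a q t = D (s + h) - D s - h * derive1 D s.
    by rewrite dD /q fdiffB fdiffB fdiffZ.
  rewrite mulrAC; apply: (@smooth1_taylor R D (`|t| + `|s| + 1)) => //; [|lra|].
    move=> y yK; rewrite (fdiff_param_n k 2 a t (@sdg j)).
    have -> : fdiff k a (fun t => derive1n 2 (dg j t) y) t = fdiff k a (dg j.+2 ^~ y) t.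
      by apply: fdiff_eq => i _; rewrite /dg !derive1nS.
    by apply: HC; rewrite ?a0//; lra.
  by apply: (le_trans (ler_normD _ _)); lra.
move=> k j K; have [C HC] := fdiff_unif_bounded k j K.
exists (`|C| + 1); first by rewrite ltr_wpDl.
move=> t s tK sK; apply: derive1n_le_fdiff => [|d d0]; first exact: sdg1.
exists (Num.min 1 (d / 2)).
  rewrite lt_min ltr01 divr_gt0//= gt_min; apply/orP; right; lra.
set a := Num.min _ _; have a0 : 0 < a by rewrite lt_min ltr01 divr_gt0.
have a1 : a <= 1 by rewrite ge_min lexx.
apply: (le_trans (HC t s a tK sK _)); first by rewrite a0.
by rewrite ler_wpM2r ?exprn_ge0 ?(ltW a0)//; have := ler_norm C; lra.
Qed.

End UniformBoundedness.
End SmoothFunctionals.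

(** * Curves of function spaces *)

Section CartesianClosed.
Variable R : realType.
Implicit Types X Y Z : frolicher R.

Lemma real_line_curveP (c : R -> R) : curves (real_line R) c <-> smooth1 c.
Proof. by split=> [cc|sc f ->]; first exact: (cc id erefl). Qed.

Lemma prod_curveP X Y (c : R -> X * Y) :
  curves (prod_frolicher X Y) c <-> curves X (fst \o c) /\ curves Y (snd \o c).
Proof.
split=> [cc|[c1 c2]].
  by split; apply/curvesE => h hh; [apply: (cc (h \o fst)); left; exists h
                                   |apply: (cc (h \o snd)); right; exists h].
by move=> k [] [h hh ->]; [exact: (proj1 (funcsE _) hh _ c1)|exact: (proj1 (funcsE _) hh _ c2)].
Qed.

Lemma rspace_curveP n (c : R -> 'rV[R]_n) :
  curves (rspace R n) c <-> forall i, smooth1 (fun s => c s 0 i).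
Proof.
split=> [cc i|sc k [i ->]]; last exact: sc.
by apply: (cc (fun x : 'rV_n => x 0 i)); exists i.
Qed.

Lemma curve_reparam X (c : R -> X) (t : R -> R) :
  curves X c -> smooth1 t -> curves X (c \o t).
Proof.
by move=> cc st; apply/curvesE => f ff; exact: (smooth1_comp (proj1 (funcsE _) ff _ cc) st).
Qed.

Lemma curve_cst X (x : X) : curves X (fun=> x).
Proof. by apply/curvesE => f _; exact (@smooth1_cst R (f x)). Qed.

(** Cartesian closedness. A curve of maps, a curve in the source and a function
    on the target yield a family of real functions. Any smooth functional of
    such families defines a function on the space of maps, along which the
    curve is smooth by definition; so [smooth2_of_functionals] applies. *)
Lemma hom_curveP X Y (c : R -> smap X Y) : curves (hom_frolicher X Y) c <->
  @is_smooth R (prod_frolicher (real_line R) X) Y (fun p => c p.1 p.2).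
Proof.
split=> [cc z /prod_curveP[/real_line_curveP st cx]|sc f]; last exact.
apply/curvesE => h hh.
pose g (t s : R) := h (c t ((snd \o z) s)).
suff sg : smooth2 g by exact: (sg _ _ st (@smooth1_id R)).
apply: smooth2_of_functionals => [t|L sL].
  by apply: (proj1 (funcsE _) (funcs_comp (c t) hh)).
apply: (cc (fun eta : smap X Y => L (fun s => h (eta ((snd \o z) s))))) => d sd.
apply: (sL (fun t s => h (d t ((snd \o z) s)))) => t u s1 su.
apply: (proj1 (funcsE _) hh (fun s => d (t s) ((snd \o z) (u s)))).
apply: (sd (fun s => (t s, (snd \o z) (u s)))); apply/prod_curveP; split.
  by apply/real_line_curveP; exact: s1.
exact: curve_reparam.
Qed.

Lemma hom_curve_eval X Y (c : R -> smap X Y) (x : R -> X) :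
  curves (hom_frolicher X Y) c -> curves X x -> curves Y (fun s => c s (x s)).
Proof.
move=> /hom_curveP sc cx; apply: (sc (fun s => (s, x s))); apply/prod_curveP; split=> //.
by apply/real_line_curveP; exact: smooth1_id.
Qed.

Lemma hom_curve_intro X Y (c : R -> smap X Y) :
  (forall (t : R -> R) (x : R -> X), smooth1 t -> curves X x ->
     curves Y (fun s => c (t s) (x s))) -> curves (hom_frolicher X Y) c.
Proof.
move=> H; apply/hom_curveP => z /prod_curveP[/real_line_curveP st cx].
exact: H.
Qed.

Lemma hom_smooth_intro X Y Z (f : Z -> smap X Y) :
  (forall (z : R -> Z) (x : R -> X), curves Z z -> curves X x ->
     curves Y (fun s => f (z s) (x s))) -> @is_smooth R Z (hom_frolicher X Y) f.
Proof.
move=> H c cc; apply: hom_curve_intro => t x st cx.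
by apply: (H (c \o t)) => //; exact: curve_reparam.
Qed.

End CartesianClosed.

(** * Expansion of functions on R^n in one coordinate *)

Section Hadamard.
Variables (R : realType) (n : nat).
Implicit Types (f g : 'rV[R]_n -> R) (x : 'rV[R]_n) (i : 'I_n).

Definition upd i (u : R) x : 'rV[R]_n := \row_j (if j == i then u else x 0 j).

Lemma upd_id i x : upd i (x 0 i) x = x.
Proof. by apply/rowP => j; rewrite mxE; case: eqP => // ->. Qed.

Lemma upd_upd i u v x : upd i u (upd i v x) = upd i u x.
Proof. by apply/rowP => j; rewrite !mxE; case: eqP. Qed.

Lemma updE i u x : upd i u x 0 i = u.
Proof. by rewrite mxE eqxx. Qed.

Lemma Cinf_curve f (c : R -> 'rV[R]_n) : Cinf f ->
  (forall i, smooth1 (fun s => c s 0 i)) -> smooth1 (fun s => f (c s)).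
Proof. by move=> Cf sc; apply: Cf => _ [i ->]; exact: sc. Qed.

Lemma Cinf_intro f :
  (forall c : R -> 'rV[R]_n, (forall i, smooth1 (fun s => c s 0 i)) -> smooth1 (fun s => f (c s))) ->
  Cinf f.
Proof. by move=> H c /rspace_curveP sc; exact: H. Qed.

Lemma Cinf_upd f i : Cinf f -> forall (u : R -> R) (c : R -> 'rV[R]_n), smooth1 u ->
  (forall j, smooth1 (fun s => c s 0 j)) -> smooth1 (fun s => f (upd i (u s) (c s))).
Proof.
move=> Cf u c su sc; apply: (Cinf_curve Cf) => j.
have [ji|ji] := eqVneq j i.
  by move: su; congr smooth1; apply/funext => s; rewrite mxE ji eqxx.
by move: (sc j); congr smooth1; apply/funext => s; rewrite mxE (negbTE ji).
Qed.

Lemma Cinf_line f i x : Cinf f -> smooth1 (fun u => f (upd i u x)).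
Proof.
move=> Cf; apply: (Cinf_upd (c := fun=> x) Cf); first exact: smooth1_id.
by move=> j; exact (@smooth1_cst R (x 0 j)).
Qed.

Definition zero_at i x := upd i 0 x.

(** the coefficient of the i-th coordinate in the Taylor expansion *)
Definition coef i f x : R := derive1 (fun u => f (upd i u x)) 0.

Definition quot i f x : R :=
  if x 0 i == 0 then coef i f x else (f x - f (zero_at i x)) / x 0 i.

Lemma quotE i f x : f x = f (zero_at i x) + x 0 i * quot i f x.
Proof.
rewrite /quot; case: eqP => [x0|/eqP x0]; last by rewrite mulrCA divff// mulr1 addrC subrK.
by rewrite x0 mul0r addr0 /zero_at -x0 upd_id.
Qed.

(** Along a curve this is Hadamard's lemma in two variables. *)
Lemma Cinf_quot i f : Cinf f -> Cinf (quot i f).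
Proof.
move=> Cf; apply: Cinf_intro => c sc.
pose F t u := f (upd i u (c t)).
have sF : smooth2 F.
  move=> t u st su; apply: (@Cinf_upd f i Cf u (c \o t) su) => j.
  exact: (smooth1_comp (sc j) st).
have [G sG FG] := smooth2_quotient sF.
have -> : (fun s => quot i f (c s)) = fun s => G s (c s 0 i).
  apply/funext => s; rewrite /quot; have := FG s (c s 0 i).
  rewrite /F upd_id => ->; case: eqP => [->|/eqP c0]; last first.
    by rewrite /zero_at [X in X - _]addrC addrK mulrAC divff// mul1r.
  apply: is_derive_derive1.
  have -> : (fun u => f (upd i u (c s))) = fun u => F s 0 + u * G s u.
    by apply/funext => u; rewrite -FG.
  have sGs := smooth2_snd (t := s) sG.
  have dG := smooth1_is_derive sGs 0.
  apply: is_derive_eq; rewrite scale0r !add0r mul1r.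
  by rewrite -[_ *: _]/(_ * _) mulr1.
by apply: (sG (fun s => s)); [exact: smooth1_id|exact: sc].
Qed.

Lemma coef_quot i f x : coef i f x = quot i f (zero_at i x).
Proof.
rewrite /quot updE eqxx /coef; congr (derive1 _ 0).
by apply/funext => u; rewrite upd_upd.
Qed.

Lemma Cinf_zero_at i f : Cinf f -> Cinf (fun x => f (zero_at i x)).
Proof.
move=> Cf; apply: Cinf_intro => c sc; apply: Cinf_upd => //.
exact (@smooth1_cst R 0).
Qed.

Lemma Cinf_coef i f : Cinf f -> Cinf (coef i f).
Proof.
move=> Cf; rewrite (_ : coef i f = fun x => quot i f (zero_at i x)).
  exact/Cinf_zero_at/Cinf_quot.
by apply/funext => x; exact: coef_quot.
Qed.

Lemma hadamard2 i f : Cinf f -> exists2 g, Cinf g & forall x,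
  f x = f (zero_at i x) + x 0 i * coef i f x + x 0 i * x 0 i * g x.
Proof.
move=> Cf; exists (quot i (quot i f)); first exact/Cinf_quot/Cinf_quot.
move=> x; rewrite {1}(quotE i f x) (quotE i (quot i f) x) -coef_quot; ring.
Qed.

Lemma coef_lin i f g (a : R) x : Cinf f -> Cinf g ->
  coef i (fun x => a * f x + g x) x = a * coef i f x + coef i g x.
Proof.
move=> Cf Cg; rewrite /coef; apply: is_derive_derive1.
have df := smooth1_is_derive (@Cinf_line _ i x Cf) 0.
have dg := smooth1_is_derive (@Cinf_line _ i x Cg) 0.
by apply: is_deriveD; apply: is_deriveZ.
Qed.

Lemma coef_mul i f g x : Cinf f -> Cinf g ->
  coef i (fun x => f x * g x) x =
  f (zero_at i x) * coef i g x + g (zero_at i x) * coef i f x.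
Proof.
move=> Cf Cg; rewrite /coef; apply: is_derive_derive1.
have df := smooth1_is_derive (@Cinf_line _ i x Cf) 0.
have dg := smooth1_is_derive (@Cinf_line _ i x Cg) 0.
exact: is_deriveM.
Qed.

Lemma coef_coord i j x : coef i (fun x => x 0 j) x = (j == i)%:R.
Proof.
rewrite /coef; apply: is_derive_derive1; have [->|ji] := eqVneq j i.
  rewrite (_ : (fun u => _) = id); first exact: is_derive_id.
  by apply/funext => u; rewrite updE.
rewrite (_ : (fun u => _) = fun=> x 0 j); first exact: is_derive_cst.
by apply/funext => u; rewrite mxE (negbTE ji).
Qed.

Lemma Cinf_sum (I : Type) (r : seq I) (F : I -> 'rV[R]_n -> R) :
  (forall k, Cinf (F k)) -> Cinf (fun x => \sum_(k <- r) F k x).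
Proof.
move=> CF; elim: r => [|i r IH].
  rewrite (_ : (fun x => _) = fun=> 0); first exact (@Cinf_cst R n 0).
  by apply/funext => x; rewrite big_nil.
rewrite (_ : (fun x => _) = fun x => F i x + \sum_(j <- r) F j x).
  exact: (CinfD (CF i) IH).
by apply/funext => x; rewrite big_cons.
Qed.

Lemma Cinf_prod (I : Type) (r : seq I) (P : pred I) (F : I -> 'rV[R]_n -> R) :
  (forall k, Cinf (F k)) -> Cinf (fun x => \prod_(k <- r | P k) F k x).
Proof.
move=> CF; elim: r => [|i r IH].
  rewrite (_ : (fun x => _) = fun=> 1); first exact (@Cinf_cst R n 1).
  by apply/funext => x; rewrite big_nil.
rewrite (_ : (fun x => _) = fun x =>
  (if P i then F i x else 1) * \prod_(j <- r | P j) F j x).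
  apply: CinfM; last exact: IH.
  by case: (P i); [exact: CF|exact (@Cinf_cst R n 1)].
by apply/funext => x; rewrite big_cons; case: (P i) => //; rewrite mul1r.
Qed.

Lemma CinfN f : Cinf f -> Cinf (fun x => - f x).
Proof. by move=> Cf c cc; apply: smooth1N; exact: Cf. Qed.

Lemma CinfB f g : Cinf f -> Cinf g -> Cinf (fun x => f x - g x).
Proof. by move=> Cf Cg; exact: (CinfD Cf (CinfN Cg)). Qed.

Definition keep (P : pred 'I_n) x : 'rV[R]_n := \row_j (if P j then x 0 j else 0).

(** Induction on the set of variables on which f depends, removing a variable by
    its first-order expansion. *)
Lemma Cinf_ind (l : seq 'I_n) (P : pred 'I_n) (Q : ('rV[R]_n -> R) -> Prop) :
  (forall f, Cinf f -> (forall x, f x = f (keep P x)) -> Q f) ->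
  (forall i f, i \in l -> Cinf f -> Q (fun x => f (zero_at i x)) -> Q (coef i f) -> Q f) ->
  forall f, Cinf f -> (forall x, f x = f (keep (fun j => (j \in l) || P j) x)) -> Q f.
Proof.
move=> Q0; elim: l => [|i l IH] Qs f Cf fE; first exact: Q0.
have Qs' j g : j \in l -> Cinf g -> Q (fun x => g (zero_at j x)) -> Q (coef j g) -> Q g.
  by move=> jl; apply: Qs; rewrite inE jl orbT.
have kE u x : keep (fun j => (j \in i :: l) || P j) (upd i u x) =
    keep (fun j => (j \in i :: l) || P j) (upd i u (keep (fun j => (j \in l) || P j) x)).
  apply/rowP => j; rewrite !mxE inE; case: eqVneq => //= _.
  by case: ifP => // ->.
apply: (Qs i); rewrite ?inE ?eqxx//.
  apply: (IH Qs' _ (@Cinf_zero_at i f Cf)).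
  by move=> x; rewrite /= fE kE -fE.
apply: (IH Qs' _ (@Cinf_coef i f Cf)).
move=> x; rewrite /coef; congr (derive1 _ 0); apply/funext => u.
by rewrite fE kE -fE.
Qed.

End Hadamard.

Arguments pideal {R} _ _.

(** * The algebras of infinitesimal objects *)

Section Ideals.
Variable R : realType.
Implicit Types W : pres R.

Lemma pidealD W f g : pideal W f -> pideal W g -> pideal W (fun x => f x + g x).
Proof. by have [_ _ ID _] := pidealP W; exact: ID. Qed.

Lemma Cinf_comp k n (f : 'rV[R]_n -> R) (u : 'rV[R]_k -> 'rV[R]_n) :
  Cinf f -> (forall i, Cinf (fun x => u x 0 i)) -> Cinf (fun x => f (u x)).
Proof.
move=> Cf Cu; apply: Cinf_intro => c sc; apply: (Cinf_curve Cf) => i.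
exact: (Cinf_curve (Cu i) sc).
Qed.

Lemma Cinf_row_mx m n k (u : 'rV[R]_k -> 'rV[R]_m) (v : 'rV[R]_k -> 'rV[R]_n) :
  (forall i, Cinf (fun x => u x 0 i)) -> (forall i, Cinf (fun x => v x 0 i)) ->
  forall i, Cinf (fun x => row_mx (u x) (v x) 0 i).
Proof.
move=> Cu Cv i; rewrite -(fintype.splitK i); case: (fintype.split i) => j /=.
  by rewrite (_ : (fun x => _) = fun x => u x 0 j) //; apply/funext => x; rewrite row_mxEl.
by rewrite (_ : (fun x => _) = fun x => v x 0 j) //; apply/funext => x; rewrite row_mxEr.
Qed.

Lemma Cinf_cst_row m k (x : 'rV[R]_m) (i : 'I_m) : Cinf (fun _ : 'rV[R]_k => x 0 i).
Proof. exact (@Cinf_cst R k (x 0 i)). Qed.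

Lemma Cinf_row_l m n (F : 'rV[R]_(m + n) -> R) t : Cinf F -> Cinf (fun x => F (row_mx x t)).
Proof.
move=> CF; apply: (Cinf_comp CF); apply: Cinf_row_mx; first exact: (@Cinf_coord R m).
exact: Cinf_cst_row.
Qed.

Lemma Cinf_row_r m n (F : 'rV[R]_(m + n) -> R) x : Cinf F -> Cinf (fun t => F (row_mx x t)).
Proof.
move=> CF; apply: (Cinf_comp CF); apply: Cinf_row_mx; last exact: (@Cinf_coord R n).
exact: Cinf_cst_row.
Qed.

Lemma zero_at_row m n (i : 'I_m) (x : 'rV[R]_m) (t : 'rV[R]_n) :
  zero_at (lshift n i) (row_mx x t) = row_mx (zero_at i x) t.
Proof.
apply/rowP => j; rewrite mxE -(fintype.splitK j); case: (fintype.split j) => k /=.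
  by rewrite !row_mxEl mxE eq_lshift.
by rewrite !row_mxEr eq_rlshift.
Qed.

Definition mono m (S : {set 'I_m}) (x : 'rV[R]_m) : R := \prod_(i in S) x 0 i.

Lemma Cinf_mono m (S : {set 'I_m}) : Cinf (mono S).
Proof. by apply: Cinf_prod => i; exact: Cinf_coord. Qed.

Section Quadratic.
Variables (m : nat) (s : seq ('I_m * 'I_m)).
Hypothesis diag : forall i, (i, i) \in s.

Lemma sq_mem (i : 'I_m) (g : 'rV[R]_m -> R) : Cinf g -> pideal (quad_pres R s) (fun x => x 0 i * x 0 i * g x).
Proof.
move=> Cg; have := @pidealMl R (quad_pres R s) g _ Cg (quad_mem (R:=R) (diag i)).
by apply: pideal_eq => x; rewrite mulrC.
Qed.

Definition expands n (F : 'rV[R]_(m + n) -> R) := exists2 a : {set 'I_m} -> 'rV[R]_n -> R,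
  (forall S, Cinf (a S)) & forall t, pideal (quad_pres R s)
    (fun x => F (row_mx x t) - \sum_S a S t * mono S x).

Lemma mono_split (i : 'I_m) (b : {set 'I_m} -> R) (x : 'rV[R]_m) :
  x 0 i * (\sum_S b S * mono S x) =
  \sum_(T : {set 'I_m} | i \in T) b (T :\ i) * mono T x +
  x 0 i * x 0 i * \sum_(S : {set 'I_m} | i \in S) b S * mono (S :\ i) x.
Proof.
rewrite (bigID (fun S : {set 'I_m} => i \in S)) /= mulrDr addrC; congr (_ + _).
  rewrite [RHS](reindex_onto (fun S => i |: S) (fun T => T :\ i)) /=; last first.
    by move=> T iT; rewrite finset.setD1K.
  rewrite mulr_sumr; apply: eq_big => S.
    rewrite finset.setU11 /=; apply/idP/eqP => [iS|<-]; last by rewrite !inE eqxx.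
    by rewrite finset.setU1K.
  move=> iS; rewrite finset.setU1K//; rewrite /mono big_setU1//=; ring.
rewrite -mulrA !mulr_sumr; apply: eq_bigr => S iS.
by rewrite /mono (big_setD1 i)//=; ring.
Qed.

(** Taylor expansion modulo the squares of the first variables, one variable at a
    time; the coefficients depend smoothly on the parameters t. *)
Lemma quad_expand n (F : 'rV[R]_(m + n) -> R) : Cinf F -> expands F.
Proof.
move=> CF.
pose l := [seq lshift n i | i <- enum 'I_m].
pose P := [pred j : 'I_(m + n) | (m <= j)%N].
apply: (@Cinf_ind R (m + n) l P (@expands n)) => //.
- move=> f Cf fE.
  exists (fun S t => if S == finset.set0 then f (row_mx 0 t) else 0).
    by move=> S; case: eqP => _; [exact: Cinf_row_r|exact (@Cinf_cst R n 0)].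
  move=> t; apply: pideal_eq (pideal0 _) => x.
  rewrite (bigD1 finset.set0)//= big1 => [|S /negbTE ->]; last by rewrite mul0r.
  rewrite /mono big_set0 mulr1 addr0 fE eqxx.
  suff -> : keep P (row_mx x t) = row_mx 0 t by rewrite subrr.
  apply/rowP => j; rewrite mxE -(fintype.splitK j); case: (fintype.split j) => k /=.
    by rewrite leqNgt ltn_ord /= row_mxEl mxE.
  by rewrite leq_addr !row_mxEr.
- move=> _ f /mapP[i _ ->] Cf [a Ca Ha] [b Cb Hb].
  have [g Cg gE] := hadamard2 (lshift n i) Cf.
  exists (fun T t => a T t + if i \in T then b (T :\ i) t else 0).
    by move=> T; apply: CinfD; [exact: (Ca T)|case: (i \in T); [exact: (Cb (T :\ i))|exact (@Cinf_cst R n 0)]].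
  move=> t.
  have I1 := Ha t; have I2 := @pidealMl R (quad_pres R s) (fun x => x 0 i) _ (@Cinf_coord R m i) (Hb t).
  have I3 := sq_mem i (@Cinf_row_l m n g t Cg).
  have CS : Cinf (fun x => \sum_(S : {set 'I_m} | i \in S) b S t * mono (S :\ i) x).
    rewrite (_ : (fun x => _) = fun x => \sum_(S : {set 'I_m}) (if i \in S then b S t else 0) * mono (S :\ i) x).
      by apply: Cinf_sum => S; apply: CinfM; [exact: Cinf_cst|exact: Cinf_mono].
    apply/funext => x; rewrite big_mkcond; apply: eq_bigr => S _.
    by case: ifP; rewrite ?mul0r.
  have I4 := sq_mem i CS.
  apply: pideal_eq (pidealD (pidealD I1 I2) (pidealD I3 I4)) => x /=.
  rewrite gE zero_at_row row_mxEl.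
  under [X in _ - X]eq_bigr do rewrite mulrDl.
  rewrite big_split /=.
  have -> : \sum_(T : {set 'I_m}) (if i \in T then b (T :\ i) t else 0) * mono T x =
    \sum_(T : {set 'I_m} | i \in T) b (T :\ i) t * mono T x.
    by rewrite [RHS]big_mkcond; apply: eq_bigr => T _; case: ifP; rewrite ?mul0r.
  by rewrite mulrBr mono_split; ring.
move=> x; congr F; apply/rowP => j; rewrite mxE.
suff -> : (j \in l) || P j by [].
rewrite /= -(fintype.splitK j); case: (fintype.split j) => k /=.
  by rewrite map_f// mem_enum.
by rewrite leq_addr orbT.
Qed.

Lemma quad_idealM (a f : 'rV[R]_m -> R) : Cinf a -> pideal (quad_pres R s) f ->
  pideal (quad_pres R s) (fun x : 'rV[R]_m => a x * f x).
Proof. exact: (@pidealMl R (quad_pres R s) a f). Qed.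

(** An element with an invertible constant term can be multiplied into the
    constants, one variable at a time: modulo the squares,
    (A + x B) (A - x B) = A^2. *)
Lemma quad_invertible (f : 'rV[R]_m -> R) : Cinf f -> f 0 != 0 ->
  exists2 g, Cinf g & pideal (quad_pres R s) (fun x => f x * g x - 1).
Proof.
pose Q (f : 'rV[R]_m -> R) := f 0 != 0 -> exists2 g : 'rV[R]_m -> R, Cinf g & exists2 c : R, c != 0 &
  pideal (quad_pres R s) (fun x => f x * g x - c).
move=> Cf f0; suff : Q f.
  move=> /(_ f0)[g Cg [c c0 H]]; exists (fun x => c^-1 * g x).
    exact: (CinfM (@Cinf_cst R m c^-1) Cg).
  apply: pideal_eq (quad_idealM (@Cinf_cst R m c^-1) H) => x.
  by rewrite mulrBr mulVf// mulrCA.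
apply: (@Cinf_ind R m (enum 'I_m) pred0 Q) => //.
- move=> h Ch hE h0; exists (fun=> 1); first exact (@Cinf_cst R m 1).
  exists (h 0) => //; apply: pideal_eq (pideal0 _) => x.
  rewrite mulr1 hE (_ : keep _ x = 0) ?subrr//.
  by apply/rowP => j; rewrite !mxE.
- move=> i h _ Ch QA _ h0.
  have z0 : zero_at i 0 = 0 :> 'rV[R]_m by apply/rowP => j; rewrite !mxE if_same.
  have [|g Cg [c c0 Hg]] := QA; first by rewrite z0.
  have [k Ck hE] := hadamard2 i Ch.
  set A := fun x => h (zero_at i x) in Hg; pose B := coef i h.
  have CA : Cinf A by exact: Cinf_zero_at.
  have CB : Cinf B by exact: Cinf_coef.
  have CxB : Cinf (fun x : 'rV_m => x 0 i * B x) by exact: (CinfM (@Cinf_coord R m i) CB).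
  have CAxB := CinfB CA CxB; have Cgg := CinfM Cg Cg.
  exists (fun x => (A x - x 0 i * B x) * (g x * g x)); first exact: (CinfM CAxB Cgg).
  exists (c * c); first by rewrite mulf_neq0.
  have I1 := sq_mem i (CinfM (CinfB (CinfM Ck CAxB) (CinfM CB CB)) Cgg).
  have CAg : Cinf (fun x => A x * g x + c).
    exact: (CinfD (CinfM CA Cg) (@Cinf_cst R m c)).
  apply: pideal_eq (pidealD I1 (quad_idealM CAg Hg)) => x /=.
  rewrite hE -/(A x) -/(B x); ring.
move=> x; congr f; apply/rowP => j; rewrite mxE mem_enum//.
Qed.

Lemma is_weil_quad : is_weil (quad_pres R s).
Proof.
split; last exact: quad_invertible.
exists #|{: {set 'I_m}}|, (fun i => mono (enum_val i)); split.
  by move=> i; exact: Cinf_mono.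
move=> f Cf; pose F (x : 'rV[R]_(m + 0)) := f (lsubmx x).
have [|a Ca Ha] := @quad_expand 0 F.
  apply: (Cinf_comp Cf) => i.
  rewrite (_ : (fun x => _) = fun x : 'rV[R]_(m + 0) => x 0 (lshift 0 i)); first exact: Cinf_coord.
  by apply/funext => x; rewrite mxE.
exists (fun i => a (enum_val i) 0); apply: pideal_eq (Ha 0) => x.
rewrite /F row_mxKl; congr (_ - _).
by rewrite -(big_enum_val (A := {: {set 'I_m}}) (fun S => a S 0 * mono S x)).
Qed.

End Quadratic.

End Ideals.

(** * Taylor coefficients modulo the ideal of D^n *)

Section Coefficients.
Variable R : realType.

Section OneIdeal.
Variable n : nat.
Implicit Types (f g : 'rV[R]_n -> R) (x : 'rV[R]_n) (i j : 'I_n).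

Lemma WD_idealM f g : Cinf f -> pideal (WD R n) g ->
  pideal (WD R n) (fun x : 'rV[R]_n => f x * g x).
Proof. exact: (@pidealMl R (WD R n) f g). Qed.

Lemma WD_idealD f g : pideal (WD R n) f -> pideal (WD R n) g ->
  pideal (WD R n) (fun x : 'rV[R]_n => f x + g x).
Proof. exact: (@pidealD R (WD R n) f g). Qed.

Lemma WD_sq i g : Cinf g -> pideal (WD R n) (fun x : 'rV[R]_n => x 0 i * x 0 i * g x).
Proof. by apply: sq_mem => j; apply/mapP; exists j; rewrite ?mem_enum. Qed.

Lemma WD_ideal0 : pideal (WD R n) (fun _ : 'rV[R]_n => 0).
Proof. exact: (@pideal0 R (WD R n)). Qed.

Lemma zero_at_coord i j x : zero_at i x 0 j = if j == i then 0 else x 0 j.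
Proof. by rewrite mxE. Qed.

(** The generators x_j^2 have this property, and it is inherited by sums and
    multiples. *)
Lemma WD_coefs i f : pideal (WD R n) f ->
  pideal (WD R n) (fun x : 'rV[R]_n => f (zero_at i x)) /\ pideal (WD R n) (coef i f).
Proof.
move=> If; suff [] : [set f : 'rV[R]_n -> R | Cinf f /\
  (pideal (WD R n) (fun x : 'rV[R]_n => f (zero_at i x)) /\ pideal (WD R n) (coef i f))] f by [].
apply: If; first split.
- by move=> g [].
- split; first exact (@Cinf_cst R n 0).
  split; first exact: WD_ideal0.
  have -> : coef i (fun=> 0 : R) = fun _ : 'rV[R]_n => 0; last exact: WD_ideal0.
  by apply/funext => x; apply: is_derive_derive1; exact: is_derive_cst.
- move=> g h [Cg [g1 g2]] [Ch [h1 h2]]; split; first exact: (CinfD Cg Ch).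
  split; first exact: WD_idealD.
  apply: pideal_eq (WD_idealD g2 h2) => x.
  have := coef_lin i 1 x Cg Ch; rewrite mul1r => <-; congr (coef i _ x).
  by apply/funext => y; rewrite mul1r.
- move=> g h Cg [Ch [h1 h2]]; split; first exact: (CinfM Cg Ch).
  split; first exact: (WD_idealM (Cinf_zero_at (i:=i) Cg) h1).
  apply: pideal_eq (WD_idealD (WD_idealM (Cinf_zero_at (i:=i) Cg) h2)
                              (WD_idealM (Cinf_coef (i:=i) Cg) h1)) => x.
  by rewrite coef_mul// [coef i g x * _]mulrC.
move=> _ [[j k] /WD_memP <- ->] /=.
have Cj := @Cinf_coord R n j.
split; first exact: (CinfM Cj Cj).
have [->|ji] := eqVneq j i.
  split; apply: pideal_eq WD_ideal0 => x; first by rewrite zero_at_coord eqxx mul0r.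
  by rewrite (coef_mul i x (@Cinf_coord R n i) (@Cinf_coord R n i)) zero_at_coord eqxx !mul0r addr0.
split.
  by apply: pideal_eq (@WD_mem R n j) => x; rewrite zero_at_coord (negbTE ji).
apply: pideal_eq WD_ideal0 => x.
by rewrite (coef_mul i x Cj Cj) coef_coord (negbTE ji) !mulr0 addr0.
Qed.

End OneIdeal.

(** Expanding in a variable of the first group keeps both coefficients in the
    ideal for all t, and leaves a remainder divisible by x_i^2. *)
Lemma WD_diagonal n (F : 'rV[R]_(n + n) -> R) : Cinf F ->
  (forall t, pideal (WD R n) (fun x : 'rV[R]_n => F (row_mx x t))) ->
  pideal (WD R n) (fun x : 'rV[R]_n => F (row_mx x x)).
Proof.
move=> CF.
pose l := [seq lshift n i | i <- enum 'I_n].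
pose P := [pred j : 'I_(n + n) | (n <= j)%N].
pose Q (F : 'rV[R]_(n + n) -> R) :=
  (forall t, pideal (WD R n) (fun x : 'rV[R]_n => F (row_mx x t))) ->
  pideal (WD R n) (fun x : 'rV[R]_n => F (row_mx x x)).
apply: (@Cinf_ind R (n + n) l P Q) => //.
- move=> f Cf fE If.
  have kE x t : keep P (row_mx x t) = row_mx 0 t :> 'rV[R]_(n + n).
    apply/rowP => j; rewrite mxE -(fintype.splitK j); case: (fintype.split j) => k /=.
      by rewrite leqNgt ltn_ord /= row_mxEl mxE.
    by rewrite leq_addr !row_mxEr.
  apply: pideal_eq (@WD_ideal0 n) => x; have := pideal_at0 (If x).
  by rewrite fE kE -(kE x) -fE.
- move=> _ f /mapP[i _ ->] Cf QA QB If.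
  have [g Cg gE] := hadamard2 (lshift n i) Cf.
  have Cgx : Cinf (fun x : 'rV[R]_n => g (row_mx x x)).
    by apply: (Cinf_comp Cg); apply: Cinf_row_mx; exact: (@Cinf_coord R n).
  have IA := QA _; have IB := QB _.
  apply: pideal_eq (WD_idealD (WD_idealD (QA _) (WD_idealM (@Cinf_coord R n i) (QB _)))
     (WD_sq i Cgx)) => [x|t|t].
  + by rewrite gE row_mxEl.
  + have [H _] := WD_coefs i (If t); apply: pideal_eq H => x.
    by rewrite zero_at_row.
  + have [_ H] := WD_coefs i (If t); apply: pideal_eq H => x.
    rewrite /coef; congr (derive1 _ 0); apply/funext => u; congr f.
    apply/rowP => j; rewrite mxE -(fintype.splitK j); case: (fintype.split j) => k /=.
      by rewrite !row_mxEl mxE eq_lshift.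
    by rewrite !row_mxEr eq_rlshift.
move=> x; congr F; apply/rowP => j; rewrite mxE.
suff -> : (j \in l) || P j by [].
rewrite /= -(fintype.splitK j); case: (fintype.split j) => k /=.
  by rewrite map_f// mem_enum.
by rewrite leq_addr orbT.
Qed.

(** The coefficients of d in an element over D and of d_1 d_2 in an element over
    D^2, computed as derivatives in real variables. *)
Definition D1 (f : R -> R) : R := derive1 f 0.
Definition D2 (F : R -> R -> R) : R := D1 (fun s => D1 (F s)).

Definition vec (s : R) : 'rV[R]_1 := const_mx s.
Definition vec2 (s t : R) : 'rV[R]_2 := \row_i [:: s; t]`_i.

Lemma D1D f g : smooth1 f -> smooth1 g -> D1 (fun s => f s + g s) = D1 f + D1 g.
Proof. by move=> sf sg; rewrite /D1 derive1D_fun. Qed.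

Lemma D1Z (a : R) f : smooth1 f -> D1 (fun s => a * f s) = a * D1 f.
Proof. by move=> sf; have := derive1nZ a 1 sf => /(congr1 (fun h => h 0)). Qed.

(** Two Hadamard divisions exhibit both derivatives as the value H 0 0. *)
Lemma D2_sym F : smooth2 F -> D2 F = D2 (fun s t => F t s).
Proof.
move=> sF; have [G sG GE] := smooth2_quotient sF.
have sG' : smooth2 (fun u t => G t u) by move=> t u st su; exact: (sG u t su st).
have [H sH HE] := smooth2_quotient sG'.
have D1q (c : R) f : smooth1 f -> D1 (fun u => c + u * f u) = f 0.
  move=> sf; apply: is_derive_derive1; have df := smooth1_is_derive sf 0.
  apply: is_derive_eq; rewrite scale0r !add0r mul1r.
  by rewrite -[_ *: _]/(_ * _) mulr1.
have E1 t : D1 (F t) = G 0 0 + t * H 0 t.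
  rewrite (_ : F t = fun u => F t 0 + u * G t u); last by apply/funext => u; rewrite GE.
  by rewrite (D1q _ _ (smooth2_snd (t := t) sG)) HE.
rewrite /D2 (_ : (fun s => D1 (F s)) = fun t => G 0 0 + t * H 0 t); last first.
  by apply/funext => t; rewrite E1.
rewrite (D1q _ _ (smooth2_snd (t := 0) sH)).
have E2 u : D1 (F^~ u) = D1 (F^~ 0) + u * H u 0.
  rewrite (_ : F^~ u = fun t => F t 0 + (u * G 0 u + t * (u * H u t))); last first.
    by apply/funext => t; rewrite GE HE; ring.
  have s1 : smooth1 (fun t => u * H u t).
    exact: (smooth1M (@smooth1_cst R u) (smooth2_snd (t := u) sH)).
  have s2 := smooth1D (@smooth1_cst R (u * G 0 u)) (smooth1M (@smooth1_id R) s1).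
  by rewrite (D1D (smooth2_fst (u := 0) sF) s2) (D1q _ _ s1).
rewrite (_ : (fun s => D1 (F^~ s)) = fun u => D1 (F^~ 0) + u * H u 0); last first.
  by apply/funext => u; rewrite E2.
by rewrite (D1q _ _ (smooth2_fst (u := 0) sH)).
Qed.

Lemma smooth1_vec f : @Cinf R 1 f -> smooth1 (fun s => f (vec s)).
Proof.
move=> Cf; apply: (Cinf_curve Cf) => i; rewrite (_ : (fun s => _) = id).
  exact: smooth1_id.
by apply/funext => s; rewrite mxE.
Qed.

Lemma smooth2_vec2 f : @Cinf R 2 f -> smooth2 (fun s t => f (vec2 s t)).
Proof.
move=> Cf t u st su; apply: (Cinf_curve Cf) => -[[|[|k]] lk]; last by exfalso.
  by move: st; congr smooth1; apply/funext => s; rewrite mxE.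
by move: su; congr smooth1; apply/funext => s; rewrite mxE.
Qed.

Lemma upd_vec s t : upd ord0 s (vec t) = vec s.
Proof. by apply/rowP => j; rewrite !mxE ord1 eqxx. Qed.

Lemma vec0 : vec 0 = 0.
Proof. by apply/rowP => j; rewrite !mxE. Qed.

Lemma D1_coef f : D1 (fun s => f (vec s)) = coef ord0 f 0.
Proof.
rewrite /coef -vec0; congr D1; apply/funext => u; by rewrite upd_vec.
Qed.

Lemma D1_ideal f : pideal (WD R 1) f -> D1 (fun s => f (vec s)) = 0.
Proof.
by move=> If; rewrite D1_coef; have [_ /pideal_at0] := WD_coefs ord0 If.
Qed.

Lemma upd_vec2_1 s t u : upd 1 u (vec2 s t) = vec2 s u.
Proof. by apply/rowP => -[[|[|//]] ?]; rewrite !mxE. Qed.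

Lemma upd_vec2_0 s t u : upd 0 u (vec2 s t) = vec2 u t.
Proof. by apply/rowP => -[[|[|//]] ?]; rewrite !mxE. Qed.

Lemma vec2_00 : vec2 0 0 = 0.
Proof. by apply/rowP => -[[|[|//]] ?]; rewrite !mxE. Qed.

Lemma D2_coef f : D2 (fun s t => f (vec2 s t)) = coef (0 : 'I_2) (coef 1 f) 0.
Proof.
rewrite /D2 /coef -vec2_00; congr D1; apply/funext => s.
rewrite upd_vec2_0; congr D1; apply/funext => u; by rewrite upd_vec2_1.
Qed.

Lemma D2_ideal f : pideal (WD R 2) f -> D2 (fun s t => f (vec2 s t)) = 0.
Proof.
move=> If; rewrite D2_coef; have [_ If1] := WD_coefs 1 If.
by have [_ /pideal_at0] := WD_coefs 0 If1.
Qed.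

Lemma WD1_expand f : @Cinf R 1 f ->
  pideal (WD R 1) (fun x : 'rV[R]_1 => f x - (f 0 + D1 (fun s => f (vec s)) * x 0 0)).
Proof.
move=> Cf; have [g Cg gE] := hadamard2 0 Cf.
apply: pideal_eq (WD_sq 0 Cg) => x; rewrite gE D1_coef.
have -> : zero_at 0 x = 0 by apply/rowP => j; rewrite !mxE ord1 eqxx.
have -> : coef 0 f x = coef ord0 f 0.
  by rewrite /coef; congr (derive1 _ 0); apply/funext => u; congr f;
     apply/rowP => j; rewrite !mxE ord1 eqxx.
ring.
Qed.

End Coefficients.

(** * Pullback squares of Weil algebras *)

Section Congruence.
Variables (R : realType) (W : pres R).
Implicit Types f g h : 'rV[R]_(pdim W) -> R.

Definition eqm f g := pideal W (fun x => f x - g x).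

Lemma eqm_refl f : eqm f f.
Proof. by apply: pideal_eq (pideal0 W) => x; rewrite subrr. Qed.

Lemma eqm_sym f g : eqm f g -> eqm g f.
Proof. by move=> /pidealN; apply: pideal_eq => x; rewrite opprB. Qed.

Lemma eqm_trans g f h : eqm f g -> eqm g h -> eqm f h.
Proof.
by move=> H1 H2; apply: pideal_eq (pidealD H1 H2) => x; rewrite addrA subrK.
Qed.

Lemma eqm_lin (k : R) f f' g g' : eqm f f' -> eqm g g' ->
  eqm (fun x => k * f x + g x) (fun x => k * f' x + g' x).
Proof.
move=> H1 H2.
apply: pideal_eq (pidealD (pidealMl (@Cinf_cst R _ k) H1) H2) => x; ring.
Qed.

Lemma eqmM f f' g g' : Cinf f -> Cinf g' -> eqm f f' -> eqm g g' ->
  eqm (fun x => f x * g x) (fun x => f' x * g' x).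
Proof.
move=> Cf Cg H1 H2.
apply: pideal_eq (pidealD (pidealMl Cf H2) (pidealMl Cg H1)) => x; ring.
Qed.

End Congruence.
Arguments eqm {R} W f g.

Section Pullbacks.
Variable R : realType.

Lemma smap_ext (X Y : frolicher R) (f g : smap X Y) : f =1 g -> f = g.
Proof.
case: f g => [f sf] [g sg] /= /funext fg; rewrite fg in sf *.
by rewrite (Prop_irrelevance sf sg).
Qed.

Lemma pclass_ext (X : frolicher R) (W : pres R) (f g : plot X W) : f =1 g -> pclass f = pclass g.
Proof. by move=> /smap_ext ->. Qed.

Lemma eqm_whom (W W' : pres R) (u : whom W W') f g :
  eqm W f g -> eqm W' (f \o u) (g \o u).
Proof. exact: whom_ideal. Qed.

(** The category i -> k <- j, with k = None. *)
Definition cospan_le (i j : option bool) := (i == j) || (j == None).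

Lemma cospan_refl i : cospan_le i i. Proof. by rewrite /cospan_le eqxx. Qed.

Lemma cospan_trans j i k : cospan_le j k -> cospan_le i j -> cospan_le i k.
Proof. by case: i j k => [[]|] [[]|] [[]|]. Qed.

Definition cospan_hom i j : finType := {x : unit | cospan_le i j}.

Definition cospan_mk i j (H : cospan_le i j) : cospan_hom i j := exist _ tt H.

Lemma cospan_hom_eq i j (a b : cospan_hom i j) : a = b.
Proof. by apply: val_inj; case: (val a) (val b) => -[]. Qed.

Definition cospan : fincat := @FinCat (option bool : finType) cospan_hom
  (fun i => cospan_mk (cospan_refl i))
  (fun i j k b a => cospan_mk (cospan_trans (valP b) (valP a)))
  (fun i j a => cospan_hom_eq _ _) (fun i j a => cospan_hom_eq _ _)
  (fun i j k l c b a => cospan_hom_eq _ _).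

Section Square.
Variables (L W1 W2 W0 : pres R).
Variables (p1 : whom L W1) (p2 : whom L W2) (u1 : whom W1 W0) (u2 : whom W2 W0).
Hypotheses (wL : is_weil L) (w1 : is_weil W1) (w2 : is_weil W2) (w0 : is_weil W0).
Hypothesis commute : whom_eq (whom_comp u1 p1) (whom_comp u2 p2).
Hypothesis joint_inj : forall f, Cinf f ->
  pideal W1 (f \o p1) -> pideal W2 (f \o p2) -> pideal L f.
Hypothesis joint_lift : forall f1 f2, Cinf f1 -> Cinf f2 ->
  eqm W0 (f1 \o u1) (f2 \o u2) ->
  exists f, [/\ Cinf f, eqm W1 (f \o p1) f1 & eqm W2 (f \o p2) f2].

Definition square_ob (i : option bool) : pres R :=
  if i is Some b then (if b then W1 else W2) else W0.

Definition square_map (i j : option bool) :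
    cospan_hom i j -> whom (square_ob i) (square_ob j) :=
  match i, j return cospan_hom i j -> whom (square_ob i) (square_ob j) with
  | Some true, Some true => fun _ => whom_id W1
  | Some false, Some false => fun _ => whom_id W2
  | None, None => fun _ => whom_id W0
  | Some true, None => fun _ => u1
  | Some false, None => fun _ => u2
  | Some true, Some false => fun h => False_rect _ (notF (valP h))
  | Some false, Some true => fun h => False_rect _ (notF (valP h))
  | None, Some b => fun h => False_rect _ (notF (valP h))
  end.

Lemma whom_eq_refl (V V' : pres R) (u : whom V V') : whom_eq u u.
Proof. by move=> f _; exact: eqm_refl. Qed.

Lemma square_id i : whom_eq (@square_map i i (cospan_mk (cospan_refl i))) (whom_id _).
Proof. by case: i => [[]|]; exact: whom_eq_refl. Qed.

Lemma square_comp i j k (b : cospan_hom j k) (a : cospan_hom i j) :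
  whom_eq (square_map (cospan_mk (cospan_trans (valP b) (valP a))))
          (whom_comp (square_map b) (square_map a)).
Proof.
move: b a; case: i j k => [[]|] [[]|] [[]|] b a //=;
  try (by have := valP b); try (by have := valP a); exact: whom_eq_refl.
Qed.

Lemma square_weil i : is_weil (square_ob i).
Proof. by case: i => [[]|]. Qed.

Definition square : wdiagram R cospan :=
  @WDiagram R cospan square_ob square_map square_weil square_id square_comp.

Definition square_leg (i : option bool) : whom L (square_ob i) :=
  match i return whom L (square_ob i) with
  | Some true => p1
  | Some false => p2
  | None => whom_comp u1 p1
  end.

(** Cones are glued value by value with [joint_lift]; by [joint_inj] the result
    is a homomorphism and unique. *)
Lemma square_limit : @is_weil_limit R cospan square L square_leg.
Proof.
split=> //.
  move=> [[]|] [[]|] a //=; try (by have := valP a); try exact: whom_eq_refl.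
  by move=> f Cf; apply: eqm_sym; exact: commute.
move=> A phi Hphi Hcomp.
pose P1 := phi (Some true); pose P2 := phi (Some false).
have [C1 l1 u1' m1] := Hphi (Some true); have [C2 l2 u2' m2] := Hphi (Some false).
have e1 a : eqm W0 (P1 a \o u1) (phi None a).
  exact: (Hcomp (Some true) None (cospan_mk (isT : cospan_le (Some true) None))).
have e2 a : eqm W0 (P2 a \o u2) (phi None a).
  exact: (Hcomp (Some false) None (cospan_mk (isT : cospan_le (Some false) None))).
have /choice[psi Hpsi] a : exists f, [/\ Cinf f, eqm W1 (f \o p1) (P1 a) & eqm W2 (f \o p2) (P2 a)].
  by apply: joint_lift => //; apply: eqm_trans (e1 a) (eqm_sym (e2 a)).
have joint f g : Cinf f -> Cinf g -> eqm W1 (f \o p1) (g \o p1) ->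
    eqm W2 (f \o p2) (g \o p2) -> eqm L f g.
  by move=> Cf Cg H1 H2; exact: (@joint_inj _ (CinfB Cf Cg) H1 H2).
have Cp a : Cinf (psi a) by have [] := Hpsi a.
have Hp1 a : eqm W1 (psi a \o p1) (P1 a) by have [] := Hpsi a.
have Hp2 a : eqm W2 (psi a \o p2) (P2 a) by have [] := Hpsi a.
have Cp1 a : Cinf (psi a \o p1) by exact: (@Cinf_smap R _ _ p1 _ (Cp a)).
have Cp2 a : Cinf (psi a \o p2) by exact: (@Cinf_smap R _ _ p2 _ (Cp a)).
exists psi; split; last first.
  move=> psi' [[Cp' _ _ _] Hl] a; apply: (joint _ _ (Cp a) (Cp' a)).
    by apply: eqm_trans (Hp1 a) _; apply: eqm_sym; exact: (Hl (Some true)).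
  by apply: eqm_trans (Hp2 a) _; apply: eqm_sym; exact: (Hl (Some false)).
split.
  split=> //.
  - move=> k a b; apply: joint => //.
    + by apply: CinfD => //; apply: CinfM => //; exact (@Cinf_cst R _ k).
    + apply: eqm_trans (Hp1 _) _; apply: eqm_trans (l1 k a b) _.
      by apply: eqm_sym; exact: (eqm_lin k (Hp1 a) (Hp1 b)).
    + apply: eqm_trans (Hp2 _) _; apply: eqm_trans (l2 k a b) _.
      by apply: eqm_sym; exact: (eqm_lin k (Hp2 a) (Hp2 b)).
  - apply: (joint (psi 1) (fun=> 1)) => //; first exact (@Cinf_cst R _ 1).
      exact: eqm_trans (Hp1 1) u1'.
    exact: eqm_trans (Hp2 1) u2'.
  - move=> a b; apply: joint => //.
    + exact: (CinfM (Cp a) (Cp b)).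
    + apply: eqm_trans (Hp1 _) _; apply: eqm_trans (m1 a b) _.
      by apply: eqm_sym; exact: (eqmM (Cp1 a) (C1 b) (Hp1 a) (Hp1 b)).
    + apply: eqm_trans (Hp2 _) _; apply: eqm_trans (m2 a b) _.
      by apply: eqm_sym; exact: (eqmM (Cp2 a) (C2 b) (Hp2 a) (Hp2 b)).
move=> [[]|] a; [exact: Hp1|exact: Hp2|].
apply: eqm_trans (e1 a); exact: (eqm_whom u1 (Hp1 a)).
Qed.

(** Microlinear spaces turn such squares into pullbacks. *)
Lemma square_lift X Y (z1 : smap Y (X ⊗ W1)) (z2 : smap Y (X ⊗ W2)) :
  microlinear X -> (forall y, prol_whom X u1 (z1 y) = prol_whom X u2 (z2 y)) ->
  exists z : smap Y (X ⊗ L), (forall y, prol_whom X p1 (z y) = z1 y) /\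
                              (forall y, prol_whom X p2 (z y) = z2 y).
Proof.
move=> HX zz; have [_ H] := HX _ _ _ _ square_limit.
pose z (i : option bool) : smap Y (X ⊗ square_ob i) :=
  match i return smap Y (X ⊗ square_ob i) with
  | Some true => z1 | Some false => z2
  | None => smap_comp (prol_whom X u1) z1 end.
have prol_id (V : pres R) (v : X ⊗ V) : prol_whom X (whom_id V) v = v.
  by rewrite -{2}(preprK v) -[in LHS](preprK v) prol_whomE; exact: pclass_ext.
have [|u [Hu _]] := H Y z.
  move=> [[]|] [[]|] a y; try (by have := valP a).
  - exact: prol_id.
  - exact: prol_id.
  - exact: (esym (zz y)).
  - exact: prol_id.
by exists u; split=> y; [exact: (Hu (Some true))|exact: (Hu (Some false))].
Qed.

End Square.
End Pullbacks.

(** * The squares of D(2) and of D^2 (+) D *)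

Section ConcreteSquares.
Variable R : realType.

Lemma ord2P (P : 'I_2 -> Prop) : P 0 -> P 1 -> forall i, P i.
Proof.
move=> P0 P1 [[|[|//]] ?].
  by rewrite (_ : Ordinal _ = 0)//; exact: val_inj.
by rewrite (_ : Ordinal _ = 1)//; exact: val_inj.
Qed.

Lemma ord3P (P : 'I_3 -> Prop) : P 0 -> P 1 -> P 2 -> forall i, P i.
Proof.
move=> P0 P1 P2 [[|[|[|//]]] ?].
- by rewrite (_ : Ordinal _ = 0)//; exact: val_inj.
- by rewrite (_ : Ordinal _ = 1)//; exact: val_inj.
- by rewrite (_ : Ordinal _ = 2)//; exact: val_inj.
Qed.

Lemma zero1_vec2 (x : 'rV[R]_2) : zero_at 1 x = vec2 (x 0 0) 0.
Proof. by apply/rowP; apply: ord2P; rewrite !mxE. Qed.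

Lemma zero0_vec2 (x : 'rV[R]_2) : zero_at 0 x = vec2 0 (x 0 1).
Proof. by apply/rowP; apply: ord2P; rewrite !mxE. Qed.

Lemma expand2 f : @Cinf R 2 f -> exists g0 g1 g01, [/\ Cinf g0, Cinf g1, Cinf g01 &
  forall x, f x = f 0 + D1 (fun s => f (vec2 s 0)) * x 0 0
    + D1 (fun s => f (vec2 0 s)) * x 0 1
    + D2 (fun s t => f (vec2 s t)) * (x 0 0 * x 0 1)
    + (x 0 0 * x 0 0 * g0 x + x 0 1 * x 0 1 * g1 x + x 0 0 * x 0 1 * (x 0 0 * g01 x))].
Proof.
move=> Cf; have [g1 Cg1 E1] := hadamard2 (1 : 'I_2) Cf.
pose h x := f (zero_at (1 : 'I_2) x); have Ch : Cinf h := Cinf_zero_at (i := 1) Cf.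
have [g0 Cg0 E0] := hadamard2 (0 : 'I_2) Ch.
pose k := coef (1 : 'I_2) f; have Ck : Cinf k := Cinf_coef (i := 1) Cf.
have [g01 Cg01 E01] := hadamard2 (0 : 'I_2) Ck.
exists g0, g1, g01; split=> // x.
have hE : h (zero_at 0 x) = f 0 by rewrite /h zero1_vec2 zero0_vec2 !mxE vec2_00.
have chE : coef 0 h x = D1 (fun s => f (vec2 s 0)).
  by rewrite /coef /h; congr D1; apply/funext => u; rewrite zero1_vec2 !mxE.
have kE : k (zero_at 0 x) = D1 (fun s => f (vec2 0 s)).
  rewrite /k /coef; congr D1; apply/funext => u; congr f.
  by apply/rowP; apply: ord2P; rewrite !mxE.
have ckE : coef 0 k x = D2 (fun s t => f (vec2 s t)).
  rewrite /coef /D2; congr D1; apply/funext => u; rewrite /k /coef; congr D1.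
  by apply/funext => v; congr f; apply/rowP; apply: ord2P; rewrite !mxE.
by rewrite E1 -/(h x) -/(k x) E0 E01 hE chE kE ckE; ring.
Qed.

Lemma quad_ideal n s (i j : 'I_n) (g : 'rV[R]_n -> R) : (i, j) \in s -> Cinf g ->
  pideal (quad_pres R s) (fun x : 'rV[R]_n => x 0 i * x 0 j * g x).
Proof.
move=> ijs Cg.
have := @pidealMl R (quad_pres R s) g _ Cg (quad_mem (R := R) ijs).
by apply: pideal_eq => x; rewrite mulrC.
Qed.

Lemma expand_WD2 f : @Cinf R 2 f -> pideal (WD R 2) (fun x : 'rV[R]_2 => f x -
  (f 0 + D1 (fun s => f (vec2 s 0)) * x 0 0 + D1 (fun s => f (vec2 0 s)) * x 0 1
   + D2 (fun s t => f (vec2 s t)) * (x 0 0 * x 0 1))).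
Proof.
move=> Cf; have [g0 [g1 [g01 [C0 C1 C01 E]]]] := expand2 Cf.
have C' : Cinf (fun x : 'rV[R]_2 => x 0 1 * g01 x) := CinfM (@Cinf_coord R 2 1) C01.
apply: pideal_eq (WD_idealD (WD_idealD (WD_sq 0 C0) (WD_sq 1 C1)) (WD_sq 0 C')) => x.
by rewrite {1}E; ring.
Qed.

Lemma expand_WD_2 f : @Cinf R 2 f -> pideal (WD_2 R) (fun x : 'rV[R]_2 => f x -
  (f 0 + D1 (fun s => f (vec2 s 0)) * x 0 0 + D1 (fun s => f (vec2 0 s)) * x 0 1)).
Proof.
move=> Cf; have [g0 [g1 [g01 [C0 C1 C01 E]]]] := expand2 Cf.
set d := D2 (fun s t => f (vec2 s t)) in E.
have C' : Cinf (fun x : 'rV[R]_2 => d + x 0 0 * g01 x).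
  exact: (CinfD (@Cinf_cst R 2 d) (CinfM (@Cinf_coord R 2 0) C01)).
have I0 := @quad_ideal 2 [:: (0, 0); (1, 1); (0, 1)] 0 0 g0 isT C0.
have I1 := @quad_ideal 2 [:: (0, 0); (1, 1); (0, 1)] 1 1 g1 isT C1.
have I2 := @quad_ideal 2 [:: (0, 0); (1, 1); (0, 1)] 0 1 _ isT C'.
apply: pideal_eq (@pidealD R (WD_2 R) _ _ (@pidealD R (WD_2 R) _ _ I0 I1) I2) => x.
by rewrite {1}E; ring.
Qed.

Lemma line2_vec (b c s : R) : line2_fun b c (vec s) = vec2 (b * s) (c * s) :> 'rV[R]_2.
Proof. by apply/rowP; apply: ord2P; rewrite !mxE. Qed.

Lemma weil_WD n : is_weil (WD R n).
Proof. by apply: is_weil_quad => i; apply/mapP; exists i; rewrite ?mem_enum. Qed.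

Lemma weil_WD_2 : is_weil (WD_2 R).
Proof. by apply: is_weil_quad; apply: ord2P. Qed.

Lemma weil_WD2D : is_weil (WD2D R).
Proof. by apply: is_weil_quad; apply: ord3P. Qed.

Lemma point_ideal (W : pres R) f : pideal W f -> pideal (WD R 0) (f \o smap_cst (rspace R 0) (0 : rspace R (pdim W))).
Proof. by move=> /pideal_at0 f0; apply: pideal_eq (pideal0 (WD R 0)) => x. Qed.

Definition D_point (W : pres R) : whom W (WD R 0) :=
  @WHom R W (WD R 0) (smap_cst (rspace R 0) (0 : rspace R (pdim W))) erefl
    (@point_ideal W).

Lemma WD_2_coeffs f : pideal (WD_2 R) f -> [/\ f 0 = 0,
  D1 (fun s => f (vec2 s 0)) = 0 & D1 (fun s => f (vec2 0 s)) = 0].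
Proof.
move=> If; split; first exact: pideal_at0.
  have := D1_ideal (whom_ideal (D_line2 1 0) If); congr (D1 _ = 0).
  by apply/funext => s; rewrite /= line2_vec mul1r mul0r.
have := D1_ideal (whom_ideal (D_line2 0 1) If); congr (D1 _ = 0).
by apply/funext => s; rewrite /= line2_vec mul1r mul0r.
Qed.

(** D(2) is the pushout of two copies of D under the point. *)
Lemma square_WD_2 X Y (z1 z2 : smap Y (X ⊗ WD R 1)) : microlinear X ->
  (forall y, prol_whom X (D_point (WD R 1)) (z1 y) = prol_whom X (D_point (WD R 1)) (z2 y)) ->
  exists z : smap Y (X ⊗ WD_2 R), (forall y, prol_whom X (D_line2 1 0) (z y) = z1 y) /\
                                   (forall y, prol_whom X (D_line2 0 1) (z y) = z2 y).
Proof.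
apply: square_lift; [exact: weil_WD_2|exact: weil_WD..| | |].
- move=> f Cf; apply: pideal_eq (pideal0 _) => x /=.
  apply/eqP; rewrite subr_eq0; apply/eqP; congr f.
  by apply/rowP; apply: ord2P; rewrite !mxE /= !mulr0.
- move=> f Cf I1 I2.
  have E1 : D1 (fun s => f (vec2 s 0)) = 0.
    have := D1_ideal I1; congr (D1 _ = 0); apply/funext => s.
    by rewrite /= line2_vec mul1r mul0r.
  have E2 : D1 (fun s => f (vec2 0 s)) = 0.
    have := D1_ideal I2; congr (D1 _ = 0); apply/funext => s.
    by rewrite /= line2_vec mul1r mul0r.
  have f0 : f 0 = 0.
    by have := pideal_at0 I1; rewrite /= -vec0 line2_vec mulr0 mulr0 vec2_00.
  by apply: pideal_eq (expand_WD_2 Cf) => x; rewrite E1 E2 f0 !mul0r !addr0 subr0.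
move=> f1 f2 C1 C2 /pideal_at0 /= /eqP; rewrite subr_eq0 => /eqP f12.
have Cc (i : 'I_2) : forall j : 'I_1, Cinf (fun x : 'rV[R]_2 => vec (x 0 i) 0 j).
  move=> j; rewrite (_ : (fun x => _) = fun x : 'rV[R]_2 => x 0 i); first exact: Cinf_coord.
  by apply/funext => x; rewrite mxE.
have vE (x : 'rV[R]_1) : vec (x 0 0) = x by apply/rowP => j; rewrite mxE ord1.
exists (fun x : 'rV[R]_2 => (f1 (vec (x 0 0)) + f2 (vec (x 0 1))) - f1 0); split.
- apply: CinfB; last exact (@Cinf_cst R 2 (f1 0)).
  by apply: CinfD; [exact: (Cinf_comp C1 (Cc 0))|exact: (Cinf_comp C2 (Cc 1))].
- apply: (@pideal_eq R (WD R 1) _ _ _ (pideal0 _)) => x /=; rewrite !mxE /= mul1r mul0r vE vec0 f12.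
  by rewrite addrK subrr.
- apply: (@pideal_eq R (WD R 1) _ _ _ (pideal0 _)) => x /=; rewrite !mxE /= mul1r mul0r vE vec0.
  by rewrite addrAC addrK subrr.
Qed.

Lemma incl_ideal (i j : 'I_2) : (i, j) \in [seq (i, i) | i <- enum 'I_2] ->
  pideal (WD_2 R) (fun x : 'rV[R]_2 => x 0 i * x 0 j).
Proof. by move=> /WD_memP <-; apply: quad_mem; move: i; apply: ord2P. Qed.

Definition D2_incl : whom (WD R 2) (WD_2 R) :=
  @polymap R 2 _ (WD_2 R) (fun x => x) (@Cinf_coord R 2) erefl incl_ideal.

Definition proj3_fun (x : 'rV[R]_3) : 'rV[R]_2 := vec2 (x 0 0) (x 0 1).

Lemma proj3_smooth j : Cinf (fun x => proj3_fun x 0 j).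
Proof.
move: j; apply: ord2P.
  by rewrite (_ : (fun x => _) = fun x : 'rV[R]_3 => x 0 0); [exact: Cinf_coord|apply/funext => x; rewrite mxE].
by rewrite (_ : (fun x => _) = fun x : 'rV[R]_3 => x 0 1); [exact: Cinf_coord|apply/funext => x; rewrite mxE].
Qed.

Lemma proj3_at0 : proj3_fun 0 = 0.
Proof. by rewrite /proj3_fun !mxE vec2_00. Qed.

Lemma proj3_ideal (i j : 'I_2) : (i, j) \in [seq (i, i) | i <- enum 'I_2] ->
  pideal (WD2D R) (fun x : 'rV[R]_3 => proj3_fun x 0 i * proj3_fun x 0 j).
Proof.
move=> /WD_memP <-; move: i; apply: ord2P.
  by apply: pideal_eq (@quad_mem R 3 [:: (0, 0); (1, 1); (2, 2); (0, 2); (1, 2)] 0 0 isT) => x; rewrite !mxE.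
by apply: pideal_eq (@quad_mem R 3 [:: (0, 0); (1, 1); (2, 2); (0, 2); (1, 2)] 1 1 isT) => x; rewrite !mxE.
Qed.

Definition D_proj3 : whom (WD R 2) (WD2D R) :=
  @polymap R 2 _ (WD2D R) proj3_fun proj3_smooth proj3_at0 proj3_ideal.

Lemma graph_proj3 c (x : 'rV[R]_2) : proj3_fun (graph_fun c x) = x.
Proof. by apply/rowP; apply: ord2P; rewrite !mxE. Qed.

Lemma expand_WD2D f : @Cinf R 3 f -> exists e, pideal (WD2D R)
  (fun x : 'rV[R]_3 => f x - (f (D2_graph 0 (D_proj3 x)) + e * x 0 2)).
Proof.
move=> Cf; have [g Cg E] := hadamard2 (2 : 'I_3) Cf.
pose k := coef (2 : 'I_3) f; have Ck : Cinf k := Cinf_coef (i := 2) Cf.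
pose k0 x := k (zero_at 0 x); have Ck0 : Cinf k0 := Cinf_zero_at (i := 0) Ck.
have Cq0 := Cinf_quot (i := 0) Ck; have Cq1 := Cinf_quot (i := 1) Ck0.
exists (k 0).
have I2 := @quad_ideal 3 [:: (0, 0); (1, 1); (2, 2); (0, 2); (1, 2)] 2 2 g isT Cg.
have I0 := @quad_ideal 3 [:: (0, 0); (1, 1); (2, 2); (0, 2); (1, 2)] 0 2 _ isT Cq0.
have I1 := @quad_ideal 3 [:: (0, 0); (1, 1); (2, 2); (0, 2); (1, 2)] 1 2 _ isT Cq1.
apply: pideal_eq (@pidealD R (WD2D R) _ _ I2 (@pidealD R (WD2D R) _ _ I0 I1)) => x.
rewrite E -/(k x) (quotE 0 k x) -/(k0 x) (quotE 1 k0 x).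
have -> : k0 (zero_at 1 x) = k 0.
  rewrite /k0 /k /coef; congr (derive1 _ 0); apply/funext => u; congr f.
  by apply/rowP; apply: ord3P; rewrite !mxE.
have -> : zero_at 2 x = D2_graph 0 (D_proj3 x).
  by apply/rowP; apply: ord3P; rewrite !mxE /= ?mul0r.
by ring.
Qed.

Lemma D2B f g : @Cinf R 2 f -> @Cinf R 2 g ->
  D2 (fun s t => f (vec2 s t) - g (vec2 s t)) =
  D2 (fun s t => f (vec2 s t)) - D2 (fun s t => g (vec2 s t)).
Proof.
move=> Cf Cg; rewrite (@D2_coef R f) (@D2_coef R g) (@D2_coef R (fun x => f x - g x)).
have E (h k : 'rV[R]_2 -> R) (i : 'I_2) : Cinf h -> Cinf k ->
    coef i (fun x => h x - k x) = fun x => coef i h x - coef i k x.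
  move=> Ch Ck; apply/funext => x.
  rewrite (_ : (fun x => h x - k x) = fun x => (-1) * k x + h x).
    by rewrite coef_lin// mulN1r addrC.
  by apply/funext => y; rewrite mulN1r addrC.
rewrite (E f g 1 Cf Cg).
by rewrite (E _ _ 0 (Cinf_coef (i := 1) Cf) (Cinf_coef (i := 1) Cg)).
Qed.

Lemma D2_xy (e : R) : D2 (fun s t => e * (s * t)) = e.
Proof.
have E (c : R) : D1 (fun s => c * s) = c.
  by rewrite (D1Z c (@smooth1_id R)) /D1 derive1_id mulr1.
rewrite /D2 -[RHS]E; congr D1; apply/funext => s.
by rewrite -[RHS]E; congr D1; apply/funext => t; rewrite mulrA.
Qed.

(** D^2 (+) D is the pushout of two copies of D^2 under D(2): two functions on
    D^2 that agree on D(2) differ by a multiple of d_1 d_2, which becomes the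
    coefficient of the third coordinate. *)
Lemma square_WD2D X Y (z1 z2 : smap Y (X ⊗ WD R 2)) : microlinear X ->
  (forall y, prol_whom X D2_incl (z1 y) = prol_whom X D2_incl (z2 y)) ->
  exists z : smap Y (X ⊗ WD2D R), (forall y, prol_whom X (D2_graph 1) (z y) = z1 y) /\
                                   (forall y, prol_whom X (D2_graph 0) (z y) = z2 y).
Proof.
apply: square_lift; [exact: weil_WD2D|exact: weil_WD|exact: weil_WD|exact: weil_WD_2| | |].
- move=> f Cf.
  have Cq := Cinf_quot (i := (2 : 'I_3)) Cf.
  have Cg : Cinf (fun x : 'rV[R]_2 => quot 2 f (D2_graph 1 x)).
    apply: (Cinf_comp Cq); exact: graph_smooth.
  apply: pideal_eq (@quad_ideal 2 [:: (0, 0); (1, 1); (0, 1)] 0 1 _ isT Cg) => x.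
  rewrite /= (quotE 2 f (graph_fun 1 x)).
  have -> : zero_at 2 (graph_fun 1 x) = graph_fun 0 x.
    by apply/rowP; apply: ord3P; rewrite !mxE /= ?mul0r.
  by rewrite [graph_fun 1 x 0 2]mxE /= mul1r; ring.
- move=> f Cf I1 I0.
  have [e H] := expand_WD2D Cf.
  have H1 : pideal (WD R 2) (fun x : 'rV[R]_2 => e * (x 0 0 * x 0 1)).
    have K := @pidealD R (WD R 2) _ _ I1 (@pidealD R (WD R 2) _ _ (pidealN I0) (pidealN (whom_ideal (D2_graph 1) H))).
    apply: pideal_eq K => x /=; rewrite graph_proj3.
    by rewrite [graph_fun 1 x 0 2]mxE /= mul1r; ring.
  have e0 : e = 0.
    rewrite -(D2_ideal H1) -[LHS]D2_xy; congr D2; apply/funext => s; apply/funext => t.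
    by rewrite !mxE.
  have K := @pidealD R (WD2D R) _ _ H (whom_ideal D_proj3 I0).
  by apply: pideal_eq K => x /=; rewrite e0 mul0r addr0 subrK.
move=> f1 f2 C1 C2 H.
have [Ch0 Ch1 Ch2] := WD_2_coeffs H.
have C12 := CinfB C1 C2.
have E12 := expand_WD2 C12.
set c := D2 _ in E12.
have Cp := Cinf_comp C2 proj3_smooth.
exists (fun x : 'rV[R]_3 => f2 (proj3_fun x) + c * x 0 2); split.
- exact: (CinfD Cp (CinfM (@Cinf_cst R 3 c) (@Cinf_coord R 3 2))).
- apply: (@pideal_eq R (WD R 2) _ _ _ (pidealN E12)) => x /=; rewrite graph_proj3.
  rewrite [graph_fun 1 x 0 2]mxE /= mul1r /=.
  have -> : f1 0 - f2 0 = 0 := Ch0.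
  have -> : D1 (fun s => f1 (vec2 s 0) - f2 (vec2 s 0)) = 0 := Ch1.
  have -> : D1 (fun s => f1 (vec2 0 s) - f2 (vec2 0 s)) = 0 := Ch2.
  by ring.
- apply: (@pideal_eq R (WD R 2) _ _ _ (pideal0 _)) => x /=; rewrite graph_proj3.
  by rewrite [graph_fun 0 x 0 2]mxE /= mul0r mulr0 addr0 subrr.
Qed.

(** On the graph of d_1 d_2 the coefficient of the third coordinate is added to
    the mixed one. *)
Lemma D2_strong_diff f : @Cinf R 3 f ->
  D2 (fun s t => f (D2_graph 1 (vec2 s t))) - D2 (fun s t => f (D2_graph 0 (vec2 s t))) =
  D1 (fun s => f (D_axis3 R (vec s))).
Proof.
move=> Cf; have [e H] := expand_WD2D Cf.
have C1 : Cinf (fun x : 'rV[R]_2 => f (D2_graph 1 x)) := Cinf_comp Cf (@graph_smooth R 1).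
have C0 : Cinf (fun x : 'rV[R]_2 => f (D2_graph 0 x)) := Cinf_comp Cf (@graph_smooth R 0).
have Cxy : Cinf (fun x : 'rV[R]_2 => e * (x 0 0 * x 0 1)).
  exact: (CinfM (@Cinf_cst R 2 e) (CinfM (@Cinf_coord R 2 0) (@Cinf_coord R 2 1))).
have E1 : D2 (fun s t => f (D2_graph 1 (vec2 s t))) - D2 (fun s t => f (D2_graph 0 (vec2 s t))) = e.
  rewrite -(D2B C1 C0) -[RHS]D2_xy; apply/eqP; rewrite -subr_eq0; apply/eqP.
  have -> : (fun s t => e * (s * t)) = fun s t : R => e * (vec2 s t 0 0 * vec2 s t 0 1).
    by apply/funext => s; apply/funext => t; rewrite !mxE.
  rewrite -(D2B (CinfB C1 C0) Cxy).
  have := D2_ideal (whom_ideal (D2_graph 1) H); congr (D2 _ = 0).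
  apply/funext => s; apply/funext => t /=.
  rewrite graph_proj3.
  by rewrite [graph_fun 1 _ 0 2]mxE /= mul1r opprD addrA.
rewrite E1; have Ca : Cinf (fun x : 'rV[R]_1 => f (D_axis3 R x)) := Cinf_comp Cf (@axis3_smooth R).
have := D1_ideal (whom_ideal (D_axis3 R) H).
have -> : (fun s => ((fun x : 'rV[R]_3 => f x - (f (D2_graph 0 (D_proj3 x)) + e * x 0 2)) \o D_axis3 R) (vec s)) =
   fun s => (f (D_axis3 R (vec s)) + (- f 0)) + (- e) * s.
  apply/funext => s /=; rewrite [axis3_fun _ 0 2]mxE /= mxE.
  have -> : proj3_fun (axis3_fun (vec s)) = 0 by apply/rowP; apply: ord2P; rewrite !mxE.
  by rewrite graph_at0; ring.
have s1 := smooth1_vec Ca; have s2 := @smooth1_cst R (- f 0).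
have s3 := smooth1M (@smooth1_cst R (- e)) (@smooth1_id R).
rewrite (D1D (smooth1D s1 s2) s3) (D1D s1 s2) (D1Z (- e) (@smooth1_id R)).
rewrite /D1 derive1_id derive1_cst mulr1 addr0 => /eqP; rewrite subr_eq0 => /eqP <- //.
Qed.

End ConcreteSquares.

(** * Prolongations of function spaces *)

Section Exponentials.
Variable R : realType.
Implicit Types X Y Z : frolicher R.

Lemma prol_map_comp X Y Z (g : smap Y Z) (f : smap X Y) W u :
  prol_map g W (prol_map f W u) = prol_map (smap_comp g f) W u.
Proof. by rewrite -(preprK u) !prol_mapE; apply: pclass_ext. Qed.

Lemma prol_whom_comp X (W W' W'' : pres R) (v : whom W' W'') (u : whom W W') a :
  prol_whom X v (prol_whom X u a) = prol_whom X (whom_comp v u) a.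
Proof. by rewrite -(preprK a) !prol_whomE; apply: pclass_ext. Qed.

Lemma prol_map_whom X Y (g : smap X Y) (W W' : pres R) (u : whom W W') a :
  prol_map g W' (prol_whom X u a) = prol_whom Y u (prol_map g W a).
Proof. by rewrite -(preprK a) !(prol_mapE, prol_whomE); apply: pclass_ext. Qed.

Lemma prol_map_idE X (g : smap X X) (W : pres R) u : g =1 id -> prol_map g W u = u.
Proof.
move=> gE; rewrite -{2}(preprK u) -[in LHS](preprK u) prol_mapE.
by apply: pclass_ext => x /=; rewrite gE.
Qed.

Lemma prol_whom_idE X (W : pres R) (v : whom W W) u : v =1 id -> prol_whom X v u = u.
Proof.
move=> vE; rewrite -{2}(preprK u) -[in LHS](preprK u) prol_whomE.
by apply: pclass_ext => x /=; rewrite vE.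
Qed.

Lemma prol_projE X (W : pres R) (f : plot X W) : prol_proj X W (pclass f) = f 0.
Proof. by have [] := pclassP f. Qed.

Lemma postcomp_smooth X Y Z (g : smap Y Z) :
  @is_smooth R (hom_frolicher X Y) (hom_frolicher X Z) (fun f : smap X Y => smap_comp g f).
Proof.
by apply: hom_smooth_intro => z x cz cx; apply: (smapP g); exact: hom_curve_eval.
Qed.
Definition smap_postcomp X Y Z (g : smap Y Z) :
  smap (hom_frolicher X Y) (hom_frolicher X Z) := SMap (@postcomp_smooth X Y Z g).

Lemma cst_smooth X Y : @is_smooth R Y (hom_frolicher X Y) (fun y => smap_cst X y).
Proof. by apply: hom_smooth_intro => z x cz cx. Qed.
Definition smap_csts X Y : smap Y (hom_frolicher X Y) := SMap (@cst_smooth X Y).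

(** The slices of a plot form a smooth family: a linear form on the algebra of
    D^m only sees the Taylor coefficients. *)
Lemma slice_smooth X m (W2 : pres R) (f : plot X (tensor (WD R m) W2)) :
  @is_smooth R (rspace R (pdim W2)) (X ⊗ WD R m) (slice f).
Proof.
apply: smooth_to_init => k [h [l [hh ll kE]]].
pose F (x : 'rV[R]_(m + pdim W2)) := h (f x).
have CF : Cinf F := @Cinf_smap R (m + pdim W2) X f h hh.
have diag (i : 'I_m) : (i, i) \in [seq (i, i) | i <- enum 'I_m].
  by apply/mapP; exists i; rewrite ?mem_enum.
have [a Ca Ha] := @quad_expand R m _ diag (pdim W2) F CF.
have lsum (r : seq {set 'I_m}) t :
    l (fun x => \sum_(S <- r) a S t * mono S x) = \sum_(S <- r) a S t * l (mono S).
  case: ll => lD lI; elim: r => [|S r IH].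
    rewrite big_nil; apply: lI; apply: pideal_eq (pideal0 _) => x.
    by rewrite big_nil.
  rewrite big_cons -IH -(lD _ _ _ (@Cinf_mono R m S)).
    by congr l; apply/funext => x; rewrite big_cons.
  apply: Cinf_sum => T; apply: CinfM; first exact (@Cinf_cst R m (a T t)).
  exact: Cinf_mono.
have -> : k \o slice f = fun t => \sum_S a S t * l (mono S).
  apply/funext => t; rewrite /= kE -lsum; apply: (linform_eq ll).
  - exact: (@Cinf_row_l R m _ F t CF).
  - apply: Cinf_sum => T; apply: CinfM; first exact (@Cinf_cst R m (a T t)).
    exact: Cinf_mono.
  - exact: Ha.
by apply: Cinf_sum => S; apply: CinfM; [exact: Ca|exact (@Cinf_cst R _ (l (mono S)))].
Qed.

Lemma smooth_orE X Y (d : smap X Y) (f : X -> Y) : is_smooth f -> smooth_or d f =1 f.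
Proof. by move=> sf x; rewrite /smooth_or; case: pselect. Qed.

Lemma curry_plotE X m (W2 : pres R) (f : plot X (tensor (WD R m) W2)) :
  curry_plot f =1 slice f.
Proof. by apply: smooth_orE; exact: slice_smooth. Qed.

Section Point.
Variable W : pres R.

(** Tensoring with the algebra of the point changes nothing. *)
Definition unit_smap : smap (rspace R (pdim W)) (rspace R (pdim (tensor (WD R 0) W))) :=
  @SMap R (rspace R (pdim W)) (rspace R (0 + pdim W)) (fun x => row_mx (0 : 'rV[R]_0) x)
    (rspace_smooth (X := rspace R (pdim W))
       (Cinf_row_mx (@Cinf_cst_row R 0 (pdim W) 0) (@Cinf_coord R (pdim W)))).

Lemma unit_at0 : unit_smap 0 = 0.
Proof. exact: row_mx0. Qed.

Lemma unit_ideal f : pideal (tensor (WD R 0) W) f -> pideal W (f \o unit_smap).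
Proof.
apply: gen_ideal_comp; first exact: tensor_gens_sub.
move=> _ [] [g Ig ->].
  by apply: pideal_eq (pideal0 W) => x /=; rewrite row_mxKl; exact: pideal_at0 Ig.
by apply: pideal_eq Ig => x /=; rewrite row_mxKr.
Qed.

Definition tensor_unit : whom (tensor (WD R 0) W) W := WHom unit_at0 unit_ideal.

Definition counit_smap : smap (rspace R (0 + pdim W)) (rspace R (pdim W)) :=
  SMap (@rsubmx_smooth R 0 (pdim W)).

Lemma counit_at0 : counit_smap 0 = 0.
Proof. exact: raddf0. Qed.

Lemma counit_ideal f : pideal W f -> pideal (tensor (WD R 0) W) (f \o counit_smap).
Proof. exact: tensor_memr. Qed.

Definition tensor_counit : whom W (tensor (WD R 0) W) := @WHom R W (tensor (WD R 0) W) counit_smap counit_at0 counit_ideal.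

Lemma tensor_unitK X a : prol_whom X tensor_unit (prol_whom X tensor_counit a) = a.
Proof. by rewrite prol_whom_comp prol_whom_idE// => x /=; rewrite row_mxKr. Qed.

Lemma tensor_counitK X a : prol_whom X tensor_counit (prol_whom X tensor_unit a) = a.
Proof.
rewrite prol_whom_comp prol_whom_idE// => x /=.
by rewrite -[RHS](@hsubmxK R 1 0 (pdim W)); congr row_mx; apply/rowP => -[].
Qed.

End Point.

Lemma prol_cst0K X u : prol_cst X (WD R 0) (prol_proj X (WD R 0) u) = u.
Proof.
rewrite -(preprK u) prol_projE; apply: pclass_ext => x /=; congr (prepr u _).
by apply/rowP => -[].
Qed.

Section WeilExponentiable.
Variable M : frolicher R.
Hypothesis HE : weil_exponentiable M.

(** An element of M^Y (x) W is the same as a smooth map from Y to M (x) W: this is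
    Weil exponentiability with the algebra of the point in the first factor. *)
Lemma exponential_elements Y (W : pres R) : is_weil W ->
  exists T : smap (hom_frolicher Y M ⊗ W) (hom_frolicher Y (M ⊗ W)),
    [/\ forall u y, T u y = prol_map (smap_ev M y) W u,
        injective T & forall z, exists u, T u = z].
Proof.
move=> wW; have [Phi [[Psi [PhiK PsiK]] HPhi]] := HE Y (weil_WD R 0) wW.
pose c := smap_postcomp Y (prol_cst M (WD R 0)).
pose d := smap_postcomp Y (prol_proj M (WD R 0)).
have cd u : c (d u) = u by apply: smap_ext => y; exact: prol_cst0K.
have dc u : d (c u) = u by apply: smap_ext => y; exact: prol_projE.
pose T := smap_comp (smap_postcomp Y (prol_whom M (tensor_unit W)))
            (smap_comp Phi (prol_map c W)).
exists T; split.
- move=> u y; pose v := Phi (prol_map c W u).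
  change (prol_whom M (tensor_unit W) (v y) = prol_map (smap_ev M y) W u).
  have E := HPhi (prol_map c W u) y (prepr (v y)).
  rewrite preprK in E; have {}E := E erefl.
  rewrite -{1}(preprK (v y)) prol_whomE.
  have -> : prol_map (smap_ev M y) W u =
      prol_map (prol_proj M (WD R 0)) W (prol_map (smap_ev (M ⊗ WD R 0) y) W (prol_map c W u)).
    rewrite !prol_map_comp; congr (prol_map _ W u); apply: smap_ext => w.
    exact: (esym (@prol_projE M (WD R 0) (smap_cst _ (w y)))).
  rewrite E prol_mapE; apply: pclass_ext => x.
  change (prepr (v y) (tensor_unit W x) =
    prol_proj M (WD R 0) (curry_plot (prepr (v y)) x)).
  by rewrite curry_plotE prol_projE.
- move=> u v Tuv.
  have cW a : prol_map d W (prol_map c W a) = a.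
    by rewrite prol_map_comp prol_map_idE.
  rewrite -(cW u) -(cW v); congr (prol_map d W _).
  rewrite -(PhiK (prol_map c W u)) -(PhiK (prol_map c W v)); congr (Psi _).
  apply: smap_ext => y; have := congr1 (fun t : smap Y (M ⊗ W) => prol_whom M (tensor_counit W) (t y)) Tuv.
  change (prol_whom M (tensor_counit W) (prol_whom M (tensor_unit W) (Phi (prol_map c W u) y)) =
    prol_whom M (tensor_counit W) (prol_whom M (tensor_unit W) (Phi (prol_map c W v) y)) ->
    Phi (prol_map c W u) y = Phi (prol_map c W v) y).
  by rewrite !tensor_counitK.
- move=> z; exists (prol_map d W (Psi (smap_postcomp Y (prol_whom M (tensor_counit W)) z))).
  apply: smap_ext => y; set w := Psi _.
  change (prol_whom M (tensor_unit W) (Phi (prol_map c W (prol_map d W w)) y) = z y).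
  rewrite prol_map_comp (@prol_map_idE _ (smap_comp c d) W w cd) PsiK.
  exact: tensor_unitK.
Qed.

(** Weil exponentiability for Y the line provides a smooth map with this value on
    all classes, so that the currying map is smooth and is given by its formula. *)
Lemma prol_curryE m (W2 : pres R) (f : plot M (tensor (WD R m) W2)) : is_weil W2 ->
  prol_curry M (WD R m) W2 (pclass f) = pclass (curry_plot f).
Proof.
move=> w2; have [Phi [[Psi [PhiK PsiK]] HPhi]] := HE (real_line R) (weil_WD R m) w2.
pose C := smap_comp (prol_map (smap_ev (M ⊗ WD R m) (0 : real_line R)) W2)
  (smap_comp Psi (smap_csts (real_line R) (M ⊗ tensor (WD R m) W2))).
have CE g : C (pclass g) = pclass (curry_plot g).
  by apply: HPhi; rewrite /= PsiK.
have E u : C u = pclass (curry_plot (prepr u)) by rewrite -CE preprK.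
rewrite /prol_curry smooth_orE; first exact: (etrans (esym (E _)) (CE f)).
rewrite (_ : (fun u => _) = C); first exact: (smapP C).
by apply/funext => u; rewrite E.
Qed.

(** The curve of maps is read as a map from A to the curves of M, which can be
    prolonged by W and applied to u s; the value at s is then taken through
    [exponential_elements] for Y the line. *)
Lemma prol_map_curve A (W : pres R) (c : R -> smap A M) (u : R -> A ⊗ W) : is_weil W ->
  curves (hom_frolicher A M) c -> curves (A ⊗ W) u ->
  curves (M ⊗ W) (fun s => prol_map (c s) W (u s)).
Proof.
move=> wW cc cu; have [T [TE _ _]] := exponential_elements (real_line R) wW.
have se (a : A) : @is_smooth R (real_line R) M (fun t => c t a).
  move=> t /real_line_curveP st.
  by apply: (hom_curve_eval (c := c \o t)); [exact: curve_reparam|exact: curve_cst].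
have see : @is_smooth R A (hom_frolicher (real_line R) M) (fun a => SMap (se a)).
  apply: hom_smooth_intro => z t cz /real_line_curveP st /=.
  by apply: (hom_curve_eval (c := c \o t)); [exact: curve_reparam|].
pose e := SMap see.
have -> : (fun s => prol_map (c s) W (u s)) = fun s => T (prol_map e W (u s)) s.
  apply/funext => s; rewrite TE prol_map_comp; congr (prol_map _ W _).
  exact: smap_ext.
apply: (hom_curve_eval (X := real_line R) (c := fun s => T (prol_map e W (u s)))).
  exact: (smapP (smap_comp T (prol_map e W)) cu).
by apply/real_line_curveP; exact: smooth1_id.
Qed.

Lemma star_smooth p q : @is_smooth R (prod_frolicher (ops M p) (ops M q)) (ops M (p + q))
  (fun eta => star eta.1 eta.2).
Proof.
apply: hom_smooth_intro => z x /prod_curveP[c1 c2] cx; rewrite /star /=.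
apply: (hom_curve_eval c1); apply: (prol_map_curve (weil_WD R p) c2).
apply: (smapP (prol_curry M (WD R q) (WD R p))).
exact: (smapP (prol_whom M (D_swap_split R p q))).
Qed.

Lemma stilde_smooth p q : @is_smooth R (prod_frolicher (ops M p) (ops M q)) (ops M (p + q))
  (fun eta => stilde eta.1 eta.2).
Proof.
apply: hom_smooth_intro => z x /prod_curveP[c1 c2] cx; rewrite /stilde /=.
apply: (hom_curve_eval c2); apply: (prol_map_curve (weil_WD R q) c1).
apply: (smapP (prol_curry M (WD R p) (WD R q))).
exact: (smapP (prol_whom M (D_split R p q))).
Qed.

End WeilExponentiable.
End Exponentials.

(** * Tangent vectors as derivations *)

Section TangentCalculus.
Variable R : realType.
Implicit Types X Y : frolicher R.

(** A tangent vector acts on functions as a derivation. *)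
Definition dd X (k : X -> R) (t : tangent X) : R := D1 (fun s => k (prepr t (vec s))).

Definition dd2 X (k : X -> R) (g : X ⊗ WD R 2) : R :=
  D2 (fun s t => k (prepr g (vec2 s t))).

Lemma D1B (f g : R -> R) : smooth1 f -> smooth1 g -> D1 (fun s => f s - g s) = D1 f - D1 g.
Proof.
move=> sf sg; rewrite (_ : (fun s => f s - g s) = fun s => f s + (-1) * g s).
  by rewrite (D1D sf (smooth1M (@smooth1_cst R (-1)) sg)) (D1Z (-1) sg) mulN1r.
by apply/funext => s; rewrite mulN1r.
Qed.

Lemma D1_scale (a : R) f : smooth1 f -> D1 (fun s => f (a * s)) = a * D1 f.
Proof.
move=> sf; apply: is_derive_derive1.
have d1 : is_derive (0 : R) 1 (fun s => a * s) a.
  by apply: is_derive_eq; rewrite ?mulr1 // -[_ *: _]/(_ * _) mulr1.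
have d2 := smooth1_is_derive sf (a * 0).
have := @is_derive1_comp R f (fun s => a * s) 0 _ _ d2 d1.
by rewrite mulr0 mulrC.
Qed.

Lemma dd_pclass X (k : X -> R) (f : plot X (WD R 1)) : funcs X k ->
  dd k (pclass f) = D1 (fun s => k (f (vec s))).
Proof.
move=> hk; have [_ H] := pclassP f; have K := D1_ideal (H k hk).
apply/eqP; rewrite -subr_eq0; apply/eqP; rewrite -[RHS]K; apply: esym; apply: D1B.
  exact: (smooth1_vec (@Cinf_smap R 1 X (prepr (pclass f)) k hk)).
exact: (smooth1_vec (@Cinf_smap R 1 X f k hk)).
Qed.

Lemma dd2_pclass X (k : X -> R) (f : plot X (WD R 2)) : funcs X k ->
  dd2 k (pclass f) = D2 (fun s t => k (f (vec2 s t))).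
Proof.
move=> hk; have [_ H] := pclassP f; have K := D2_ideal (H k hk).
apply/eqP; rewrite -subr_eq0; apply/eqP; rewrite -[RHS]K; apply: esym.
exact: (D2B (@Cinf_smap R 2 X (prepr (pclass f)) k hk) (@Cinf_smap R 2 X f k hk)).
Qed.

Lemma dd_whom X (W : pres R) (u : whom W (WD R 1)) (k : X -> R) g : funcs X k ->
  dd k (prol_whom X u g) = D1 (fun s => k (prepr g (u (vec s)))).
Proof. by move=> hk; rewrite -{1}(preprK g) prol_whomE; exact: dd_pclass. Qed.

Lemma dd2_whom X (W : pres R) (u : whom W (WD R 2)) (k : X -> R) g : funcs X k ->
  dd2 k (prol_whom X u g) = D2 (fun s t => k (prepr g (u (vec2 s t)))).
Proof. by move=> hk; rewrite -{1}(preprK g) prol_whomE; exact: dd2_pclass. Qed.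

Lemma dd_map X Y (g : smap X Y) (k : Y -> R) t : funcs Y k ->
  dd k (prol_map g (WD R 1) t) = dd (k \o g) t.
Proof. by move=> hk; rewrite -{1}(preprK t) prol_mapE; exact: dd_pclass. Qed.

Lemma foot_map X Y (g : smap X Y) (W : pres R) t :
  prol_proj Y W (prol_map g W t) = g (prol_proj X W t).
Proof. by rewrite -{1}(preprK t) prol_mapE; exact: prol_projE. Qed.

Lemma foot_whom X (W W' : pres R) (u : whom W W') t :
  prol_proj X W' (prol_whom X u t) = prol_proj X W t.
Proof.
rewrite -{1}(preprK t) prol_whomE; apply: etrans (prol_projE _) _ => /=.
by rewrite whom_at0.
Qed.

Lemma smooth_dd X (k : X -> R) (t : tangent X) : funcs X k ->
  smooth1 (fun s => k (prepr t (vec s))).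
Proof. by move=> hk; exact: (smooth1_vec (@Cinf_smap R 1 X (prepr t) k hk)). Qed.

Lemma dd_tscale X (k : X -> R) (a : R) t : funcs X k -> dd k (tscale a t) = a * dd k t.
Proof.
move=> hk; rewrite /tscale (dd_whom _ _ hk) -(D1_scale a (smooth_dd (t:=t) hk)).
congr D1; apply/funext => s; congr (k (prepr t _)).
by apply/rowP => j; rewrite !mxE ord1 eqxx.
Qed.

Lemma dd_tzero X (k : X -> R) x : funcs X k -> dd k (tzero x) = 0.
Proof. by move=> hk; rewrite (dd_pclass _ hk) /= /D1 derive1_cst. Qed.

(** The existence on which the definition of the sum relies. *)
Definition addable X (t1 t2 : tangent X) := exists g : X ⊗ WD_2 R,
  prol_whom X (D_line2 1 0) g = t1 /\ prol_whom X (D_line2 0 1) g = t2.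

Lemma tadd_witness X (t1 t2 : tangent X) : addable t1 t2 -> exists g : X ⊗ WD_2 R,
  [/\ prol_whom X (D_line2 1 0) g = t1, prol_whom X (D_line2 0 1) g = t2 &
      tadd t1 t2 = prol_whom X (D_line2 1 1) g].
Proof.
move=> H; rewrite /tadd; set G := xget _ _; exists G.
by have [] := @xgetPex {classic X ⊗ WD_2 R} (prol_cst X (WD_2 R) (prol_proj X (WD R 1) t1))
  [set g | prol_whom X (D_line2 1 0) g = t1 /\ prol_whom X (D_line2 0 1) g = t2] H.
Qed.

(** On D(2) a function is affine, so the derivative along the diagonal is the sum
    of the derivatives along the axes. *)
Lemma dd_tadd X (k : X -> R) (t1 t2 : tangent X) : funcs X k -> addable t1 t2 ->
  dd k (tadd t1 t2) = dd k t1 + dd k t2.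
Proof.
move=> hk /tadd_witness[g [<- <- ->]]; rewrite !(dd_whom _ _ hk).
have CF := @Cinf_smap R 2 X (prepr g) k hk.
set F := k \o prepr g in CF.
have E (b c s : R) : k (prepr g (D_line2 b c (vec s))) = F (vec2 (b * s) (c * s)).
  by rewrite -line2_vec.
have := D1_ideal (whom_ideal (D_line2 1 1) (expand_WD_2 CF)).
set A := D1 (fun s => F (vec2 s 0)); set B := D1 (fun s => F (vec2 0 s)) => H.
have -> : (fun s => k (prepr g (D_line2 1 0 (vec s)))) = fun s => F (vec2 s 0).
  by apply/funext => s; rewrite E mul1r mul0r.
have -> : (fun s => k (prepr g (D_line2 0 1 (vec s)))) = fun s => F (vec2 0 s).
  by apply/funext => s; rewrite E mul1r mul0r.
have -> : (fun s => k (prepr g (D_line2 1 1 (vec s)))) = fun s => F (vec2 s s).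
  by apply/funext => s; rewrite E mul1r.
rewrite -/A -/B; move: H.
have sF : smooth1 (fun s => F (vec2 s s)).
  exact: (smooth2_vec2 CF (@smooth1_id R) (@smooth1_id R)).
rewrite (_ : (fun s => _) = fun s => F (vec2 s s) - (F 0 + (A + B) * s)); last first.
  by apply/funext => s; rewrite /= line2_vec !mxE /= !mul1r; ring.
have s1 := smooth1M (@smooth1_cst R (A + B)) (@smooth1_id R).
rewrite (D1B sF (smooth1D (@smooth1_cst R (F 0)) s1)) (D1D (@smooth1_cst R (F 0)) s1).
rewrite (D1Z (A + B) (@smooth1_id R)) /D1 derive1_id derive1_cst mulr1 add0r.
by move=> /eqP; rewrite subr_eq0 => /eqP.
Qed.

Lemma foot_tadd X (t1 t2 : tangent X) : addable t1 t2 ->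
  prol_proj X (WD R 1) (tadd t1 t2) = prol_proj X (WD R 1) t1.
Proof. by move=> /tadd_witness[g [<- _ ->]]; rewrite !foot_whom. Qed.

(** The existence on which the definition of the strong difference relies. *)
Definition subtractable X (g1 g2 : X ⊗ WD R 2) := exists g : X ⊗ WD2D R,
  prol_whom X (D2_graph 1) g = g1 /\ prol_whom X (D2_graph 0) g = g2.

Lemma strong_diff_witness X (g1 g2 : X ⊗ WD R 2) : subtractable g1 g2 ->
  exists g : X ⊗ WD2D R,
  [/\ prol_whom X (D2_graph 1) g = g1, prol_whom X (D2_graph 0) g = g2 &
      strong_diff g1 g2 = prol_whom X (D_axis3 R) g].
Proof.
move=> H; rewrite /strong_diff; set G := xget _ _; exists G.
by have [] := @xgetPex {classic X ⊗ WD2D R} (prol_cst X (WD2D R) (prol_proj X (WD R 2) g1))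
  [set g | prol_whom X (D2_graph 1) g = g1 /\ prol_whom X (D2_graph 0) g = g2] H.
Qed.

Lemma dd_strong_diff X (k : X -> R) (g1 g2 : X ⊗ WD R 2) : funcs X k ->
  subtractable g1 g2 -> dd k (strong_diff g1 g2) = dd2 k g1 - dd2 k g2.
Proof.
move=> hk /strong_diff_witness[g [<- <- ->]].
rewrite (dd_whom _ _ hk) !(dd2_whom _ _ hk).
exact: (esym (D2_strong_diff (@Cinf_smap R 3 X (prepr g) k hk))).
Qed.

Lemma foot_strong_diff X (g1 g2 : X ⊗ WD R 2) : subtractable g1 g2 ->
  prol_proj X (WD R 1) (strong_diff g1 g2) = prol_proj X (WD R 2) g1.
Proof. by move=> /strong_diff_witness[g [<- _ ->]]; rewrite !foot_whom. Qed.

Section FunctionSpace.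
Variables (Y M : frolicher R).
Hypotheses (HM : microlinear M) (HE : weil_exponentiable M).
Let X := hom_frolicher Y M.

(** [exponential_elements] turns the data into maps from Y to prolongations of M,
    for which the square lifts. *)
Lemma hom_square (L W1 W2 W0 : pres R) (p1 : whom L W1) (p2 : whom L W2)
    (u1 : whom W1 W0) (u2 : whom W2 W0) (t1 : X ⊗ W1) (t2 : X ⊗ W2) :
  is_weil L -> is_weil W1 -> is_weil W2 ->
  (forall (z1 : smap Y (M ⊗ W1)) (z2 : smap Y (M ⊗ W2)),
     (forall y, prol_whom M u1 (z1 y) = prol_whom M u2 (z2 y)) ->
     exists z : smap Y (M ⊗ L), (forall y, prol_whom M p1 (z y) = z1 y) /\
                                (forall y, prol_whom M p2 (z y) = z2 y)) ->
  prol_whom X u1 t1 = prol_whom X u2 t2 ->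
  exists g : X ⊗ L, prol_whom X p1 g = t1 /\ prol_whom X p2 g = t2.
Proof.
move=> wL w1 w2 lift t12.
have [TL [TLE _ TLsurj]] := exponential_elements HE Y wL.
have [T1 [T1E T1inj _]] := exponential_elements HE Y w1.
have [T2 [T2E T2inj _]] := exponential_elements HE Y w2.
have [y|z [z1 z2]] := lift (T1 t1) (T2 t2).
  rewrite T1E T2E -(prol_map_whom (smap_ev M y) u1) -(prol_map_whom (smap_ev M y) u2).
  by congr (prol_map _ _ _).
have [g gz] := TLsurj z; exists g; split.
  apply: T1inj; apply: smap_ext => y.
  by rewrite T1E prol_map_whom -TLE gz.
apply: T2inj; apply: smap_ext => y.
by rewrite T2E prol_map_whom -TLE gz.
Qed.

Lemma hom_addable (t1 t2 : tangent X) :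
  prol_proj X (WD R 1) t1 = prol_proj X (WD R 1) t2 -> addable t1 t2.
Proof.
move=> t12; apply: (hom_square (u1 := D_point (WD R 1)) (u2 := D_point (WD R 1)) (weil_WD_2 R) (weil_WD R 1) (weil_WD R 1)).
  by move=> z1 z2; exact: square_WD_2.
rewrite -(preprK t1) -(preprK t2) !prol_whomE; apply: pclass_ext => x; exact: t12.
Qed.

Lemma hom_subtractable (g1 g2 : X ⊗ WD R 2) :
  prol_whom X (D2_incl R) g1 = prol_whom X (D2_incl R) g2 -> subtractable g1 g2.
Proof.
apply: (hom_square (weil_WD2D R) (weil_WD R 2) (weil_WD R 2)).
by move=> z1 z2; exact: square_WD2D.
Qed.

(** Modulo the square of the coordinate a function is given by its value and its
    derivative at 0, and [exponential_elements] reduces equality to the points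
    of Y. *)
Lemma hom_tangent_ext (t1 t2 : tangent X) :
  prol_proj X (WD R 1) t1 = prol_proj X (WD R 1) t2 ->
  (forall (h : M -> R) (y : Y), funcs M h ->
     dd (fun f : X => h (f y)) t1 = dd (fun f : X => h (f y)) t2) -> t1 = t2.
Proof.
move=> t12 H; have [T [TE Tinj _]] := exponential_elements HE Y (weil_WD R 1).
apply: Tinj; apply: smap_ext => y; rewrite !TE -(preprK t1) -(preprK t2) !prol_mapE.
apply/pclass_eqP; split=> [|h hh].
  exact: (congr1 (fun f : X => f y) t12).
have hk : funcs X (fun f : X => h (f y)) := funcs_comp (smap_ev M y) hh.
have C1 := @Cinf_smap R 1 X (prepr t1) _ hk.
have C2 := @Cinf_smap R 1 X (prepr t2) _ hk.
have := H h y hh; rewrite /dd => D12.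
have f0 : prepr t1 0 = prepr t2 0 := t12.
apply: pideal_eq (WD_idealD (WD1_expand C1) (pidealN (WD1_expand C2))) => x /=.
rewrite D12 f0; ring.
Qed.

End FunctionSpace.
End TangentCalculus.

(** * Products of operators and the brackets of icons *)

Section Brackets.
Variable R : realType.
Implicit Types X Y : frolicher R.

(** Over D^n the pairing does not depend on representatives; the two factors
    are changed one at a time, and the diagonal is reached at the end. *)
Lemma prol_pairE X Y n (f : plot X (WD R n)) (g : plot Y (WD R n)) :
  prol_pair (pclass f) (pclass g) = pclass (smap_pair f g).
Proof.
have [f0 fh] := pclassP f; have [g0 gh] := pclassP g.
apply/pclass_eqP; set f' := prepr _ in f0 fh *; set g' := prepr _ in g0 gh *.
split=> [/=|h hh]; first by rewrite f0 g0.
pose L : smap (rspace R (n + n)) (rspace R n) := SMap (@lsubmx_smooth R n n).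
pose T : smap (rspace R (n + n)) (rspace R n) := SMap (@rsubmx_smooth R n n).
have C (u : smap (rspace R (n + n)) X) (v : smap (rspace R (n + n)) Y) :
    Cinf (fun x => h (u x, v x)) by exact: (@Cinf_smap R _ _ (smap_pair u v) h hh).
have I1 := WD_diagonal (CinfB (C (smap_comp f' L) (smap_comp g' T)) (C (smap_comp f L) (smap_comp g' T))).
have I2 := WD_diagonal (CinfB (C (smap_comp f T) (smap_comp g' L)) (C (smap_comp f T) (smap_comp g L))).
have H1 t : pideal (WD R n) (fun x : 'rV[R]_n => h (f' x, g' t) - h (f x, g' t)).
  exact: (fh (fun a => h (a, g' t)) (funcs_comp (smap_pair (smap_id X) (smap_cst X (g' t))) hh)).
have H2 t : pideal (WD R n) (fun x : 'rV[R]_n => h (f t, g' x) - h (f t, g x)).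
  exact: (gh (fun b => h (f t, b)) (funcs_comp (smap_pair (smap_cst Y (f t)) (smap_id Y)) hh)).
apply: pideal_eq (WD_idealD (I1 _) (I2 _)) => [x|t|t] /=.
- by rewrite !row_mxKl !row_mxKr addrA subrK.
- by apply: pideal_eq (H1 t) => x /=; rewrite !row_mxKl !row_mxKr.
- by apply: pideal_eq (H2 t) => x /=; rewrite !row_mxKl !row_mxKr.
Qed.

(** A total variant of the class of a map, which lets operators be applied under
    binders without carrying proofs of smoothness. *)
Definition pc X n (w : 'rV[R]_n -> X) : X ⊗ WD R n :=
  @pclass R X (WD R n) (@smooth_or R (rspace R n) X (smap_cst (rspace R n) (w 0)) w).

Lemma pcE X n (w : smap (rspace R n) X) : pc w = @pclass R X (WD R n) w.
Proof. by apply: pclass_ext => x; rewrite smooth_orE//; exact: smapP. Qed.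

Lemma pc_prepr X n (u : X ⊗ WD R n) : u = pc (prepr u).
Proof. by rewrite -{1}(preprK u) -pcE. Qed.

Lemma pc_slice_smooth X m n (w : smap (rspace R (m + n)) X) :
  @is_smooth R (rspace R n) (X ⊗ WD R m) (fun t => pc (fun s => w (row_mx s t))).
Proof.
have := @slice_smooth R X m (WD R n) w; congr (is_smooth _); apply/funext => t.
by rewrite -[slice _ _]pcE.
Qed.

Lemma row_swap_smooth m n : @is_smooth R (rspace R (n + m)) (rspace R (m + n))
  (fun x => row_mx (rsubmx x) (lsubmx x)).
Proof. exact: (rspace_smooth (@swap_smooth R m n)). Qed.

Lemma pc_slice_smooth2 X m n (w : smap (rspace R (m + n)) X) :
  @is_smooth R (rspace R m) (X ⊗ WD R n) (fun t => pc (fun s => w (row_mx t s))).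
Proof.
have := @pc_slice_smooth X n m (smap_comp w (SMap (@row_swap_smooth m n))).
congr (is_smooth _); apply/funext => t; congr pc; apply/funext => s /=.
by rewrite row_mxKl row_mxKr.
Qed.

Section Ops.
Variable M : frolicher R.
Hypotheses (HM : microlinear M) (HE : weil_exponentiable M).

(** An operator acting on one group of variables, the other being parameters. *)
Definition in_slice_l m n (e : ops M m) (w : smap (rspace R (m + n)) M) : smap (rspace R n) M :=
  smap_comp e (SMap (@pc_slice_smooth M m n w)).
Definition in_slice_r m n (e : ops M n) (w : smap (rspace R (m + n)) M) : smap (rspace R m) M :=
  smap_comp e (SMap (@pc_slice_smooth2 M m n w)).

(** The two products are the two orders of composition of operators acting on
    separate groups of variables. *)
Lemma star_pc p q (e1 : ops M p) (e2 : ops M q) (w : smap (rspace R (p + q)) M) :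
  star e1 e2 (pc w) = e1 (pc (in_slice_r e2 w)).
Proof.
rewrite /star /= pcE.
change (e1 (prol_map e2 (WD R p) (prol_curry M (WD R q) (WD R p)
  (prol_whom M (D_swap_split R p q) (@pclass R M (WD R (p + q)) w)))) = e1 (pc (in_slice_r e2 w))).
rewrite prol_whomE (prol_curryE HE _ (weil_WD R p)) prol_mapE pcE; congr (e1 _).
apply: pclass_ext => t; change (e2 (curry_plot (smap_comp w (D_swap_split R p q)) t) = e2 (pc (fun s => w (row_mx t s)))).
rewrite curry_plotE; congr (e2 _); rewrite -[slice _ _]pcE; congr pc; apply/funext => s /=.
by rewrite /swap_fun row_mxKl row_mxKr.
Qed.

Lemma stilde_pc p q (e1 : ops M p) (e2 : ops M q) (w : smap (rspace R (p + q)) M) :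
  stilde e1 e2 (pc w) = e2 (pc (in_slice_l e1 w)).
Proof.
rewrite /stilde /= pcE.
change (e2 (prol_map e1 (WD R q) (prol_curry M (WD R p) (WD R q)
  (prol_whom M (D_split R p q) (@pclass R M (WD R (p + q)) w)))) = e2 (pc (in_slice_l e1 w))).
rewrite prol_whomE (prol_curryE HE _ (weil_WD R q)) prol_mapE pcE; congr (e2 _).
apply: pclass_ext => t; change (e1 (curry_plot (smap_comp w (D_split R p q)) t) = e1 (pc (fun s => w (row_mx s t)))).
by rewrite curry_plotE; congr (e1 _); rewrite -[slice _ _]pcE.
Qed.

Lemma delta_pc n (w : 'rV[R]_n -> M) : delta M n (pc w) = w 0.
Proof.
apply: etrans (prol_projE _) _; rewrite /smooth_or; by case: pselect.
Qed.

Lemma op_perm_pc n (sigma : 'S_n) (e : ops M n) (w : smap (rspace R n) M) :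
  op_perm M sigma e (pc w) = e (pc (smap_comp w (D_perm R sigma))).
Proof.
rewrite (pcE w) (@pcE M n (smap_comp w (D_perm R sigma))).
change (e (prol_whom M (D_perm R sigma) (@pclass R M (WD R n) w)) =
  e (@pclass R M (WD R n) (smap_comp w (D_perm R sigma)))).
by rewrite prol_whomE.
Qed.

Lemma star_delta p q (e : ops M p) : star e (delta M q) = stilde e (delta M q).
Proof.
apply: smap_ext => u; rewrite (pc_prepr u) star_pc stilde_pc delta_pc.
by congr (e _); congr pc; apply/funext => t; exact: delta_pc.
Qed.

Lemma delta_star p q (e : ops M q) : star (delta M p) e = stilde (delta M p) e.
Proof.
apply: smap_ext => u; rewrite (pc_prepr u) star_pc stilde_pc delta_pc.
by congr (e _); congr pc; apply/funext => t; apply: esym; exact: delta_pc.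
Qed.

Lemma delta_stilde p q : stilde (delta M p) (delta M q) = delta M (p + q).
Proof.
apply: smap_ext => u; rewrite (pc_prepr u) stilde_pc !delta_pc.
by apply: etrans (delta_pc _) _; rewrite row_mx0.
Qed.

Lemma op_perm_delta n (sigma : 'S_n) : op_perm M sigma (delta M n) = delta M n.
Proof.
apply: smap_ext => u; rewrite (pc_prepr u) op_perm_pc !delta_pc.
by rewrite /= perm_at0.
Qed.

(** The families of operators that represent the two products of icons. *)
Definition star_plot p q (x1 : tangent (ops M p)) (x2 : tangent (ops M q)) : plot (ops M (p + q)) (WD R 2) :=
  smap_comp (star_smap M p q) (smap_pair (smap_comp (prepr x1) (D2_coord R 0)) (smap_comp (prepr x2) (D2_coord R 1))).
Definition stilde_plot p q (x1 : tangent (ops M p)) (x2 : tangent (ops M q)) : plot (ops M (p + q)) (WD R 2) :=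
  smap_comp (stilde_smap M p q) (smap_pair (smap_comp (prepr x1) (D2_coord R 0)) (smap_comp (prepr x2) (D2_coord R 1))).

Lemma icon_pairE p q (x1 : tangent (ops M p)) (x2 : tangent (ops M q)) :
  icon_pair x1 x2 = @pclass R (prod_frolicher (ops M p) (ops M q)) (WD R 2)
    (smap_pair (smap_comp (prepr x1) (D2_coord R 0)) (smap_comp (prepr x2) (D2_coord R 1))).
Proof. by rewrite /icon_pair -{1}(preprK x1) -{1}(preprK x2) !prol_whomE prol_pairE. Qed.

Lemma circledastE p q (x1 : tangent (ops M p)) (x2 : tangent (ops M q)) :
  circledast x1 x2 = pclass (star_plot x1 x2).
Proof. by rewrite /circledast icon_pairE prol_mapE. Qed.

Lemma tcircledastE p q (x1 : tangent (ops M p)) (x2 : tangent (ops M q)) :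
  tcircledast x1 x2 = pclass (stilde_plot x1 x2).
Proof. by rewrite /tcircledast icon_pairE prol_mapE. Qed.

Lemma coord_vec (i : 'I_2) (x : 'rV[R]_2) : coord_fun i x = vec (x 0 i).
Proof. by apply/rowP => j; rewrite !mxE. Qed.

Lemma star_plotE p q (x1 : tangent (ops M p)) (x2 : tangent (ops M q)) x :
  star_plot x1 x2 x = star (prepr x1 (vec (x 0 0))) (prepr x2 (vec (x 0 1))).
Proof.
rewrite /star_plot /= smooth_orE; last exact: star_smooth.
by rewrite /= !coord_vec.
Qed.

Lemma stilde_plotE p q (x1 : tangent (ops M p)) (x2 : tangent (ops M q)) x :
  stilde_plot x1 x2 x = stilde (prepr x1 (vec (x 0 0))) (prepr x2 (vec (x 0 1))).
Proof.
rewrite /stilde_plot /= smooth_orE; last exact: stilde_smooth.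
by rewrite /= !coord_vec.
Qed.

Lemma icon_at0 p (x : tangent (ops M p)) : is_icon x -> prepr x (vec 0) = delta M p.
Proof. by rewrite vec0. Qed.

(** On the axes of D^2 one of the two operators is the projection, and then the
    order of composition is irrelevant. *)
Lemma circled_subtractable p q (x1 : tangent (ops M p)) (x2 : tangent (ops M q)) :
  is_icon x1 -> is_icon x2 -> subtractable (tcircledast x1 x2) (circledast x1 x2).
Proof.
move=> i1 i2; apply: (@hom_subtractable R (M ⊗ WD R (p + q)) M HM HE).
have E1 := etrans (congr1 (prol_whom _ (D2_incl R)) (tcircledastE x1 x2)) (prol_whomE (D2_incl R) (stilde_plot x1 x2)).
have E2 := etrans (congr1 (prol_whom _ (D2_incl R)) (circledastE x1 x2)) (prol_whomE (D2_incl R) (star_plot x1 x2)).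
apply: etrans E1 (etrans _ (esym E2)); apply/pclass_eqP.
have fst0 s : stilde_plot x1 x2 (vec2 s 0) = star_plot x1 x2 (vec2 s 0).
  apply: etrans (stilde_plotE _ _ _) (etrans _ (esym (star_plotE _ _ _))).
  by rewrite !mxE /= (icon_at0 i2) star_delta.
have snd0 s : stilde_plot x1 x2 (vec2 0 s) = star_plot x1 x2 (vec2 0 s).
  apply: etrans (stilde_plotE _ _ _) (etrans _ (esym (star_plotE _ _ _))).
  by rewrite !mxE /= (icon_at0 i1) delta_star.
split=> [|h hh]; first by have := fst0 0; rewrite vec2_00.
pose F (x : 'rV[R]_2) := h (stilde_plot x1 x2 x) - h (star_plot x1 x2 x).
have CF : Cinf F.
  exact: (CinfB (@Cinf_smap R 2 _ (stilde_plot x1 x2) h hh) (@Cinf_smap R 2 _ (star_plot x1 x2) h hh)).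
have F1 s : F (vec2 s 0) = 0.
  exact: (etrans (congr1 (fun e => h e - h (star_plot x1 x2 (vec2 s 0))) (fst0 s)) (subrr _)).
have F2 s : F (vec2 0 s) = 0.
  exact: (etrans (congr1 (fun e => h e - h (star_plot x1 x2 (vec2 0 s))) (snd0 s)) (subrr _)).
have D0 (f : R -> R) : (forall s, f s = 0) -> D1 f = 0.
  by move=> /funext ->; rewrite /D1 derive1_cst.
apply: pideal_eq (expand_WD_2 CF) => x.
rewrite (D0 _ F1) (D0 _ F2) -vec2_00 F1 !mul0r !addr0 subr0.
reflexivity.
Qed.

Lemma lie_icon p q (x1 : tangent (ops M p)) (x2 : tangent (ops M q)) :
  is_icon x1 -> is_icon x2 -> is_icon (lie_bracket x1 x2).
Proof.
move=> i1 i2; rewrite /is_icon /lie_bracket (foot_strong_diff (circled_subtractable i1 i2)).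
rewrite tcircledastE; apply: etrans (prol_projE _) _; rewrite stilde_plotE !mxE.
by rewrite (icon_at0 i1) (icon_at0 i2) delta_stilde.
Qed.

(** The bracket is an infinitesimal commutator. *)
Lemma dd_lie p q (x1 : tangent (ops M p)) (x2 : tangent (ops M q)) (k : ops M (p + q) -> R) :
  is_icon x1 -> is_icon x2 -> funcs (ops M (p + q)) k ->
  dd k (lie_bracket x1 x2) = D2 (fun s t =>
    k (stilde (prepr x1 (vec s)) (prepr x2 (vec t))) - k (star (prepr x1 (vec s)) (prepr x2 (vec t)))).
Proof.
move=> i1 i2 hk; rewrite (dd_strong_diff hk (circled_subtractable i1 i2)).
have E1 := etrans (congr1 (dd2 k) (tcircledastE x1 x2)) (dd2_pclass (stilde_plot x1 x2) hk).
have E2 := etrans (congr1 (dd2 k) (circledastE x1 x2)) (dd2_pclass (star_plot x1 x2) hk).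
apply: etrans (congr2 (fun a b : R => a - b) E1 E2) _.
rewrite -(D2B (@Cinf_smap R 2 _ (stilde_plot x1 x2) k hk) (@Cinf_smap R 2 _ (star_plot x1 x2) k hk)).
congr D2; apply/funext => s; apply/funext => t.
change (k (stilde_plot x1 x2 (vec2 s t)) - k (star_plot x1 x2 (vec2 s t)) =
  k (stilde (prepr x1 (vec s)) (prepr x2 (vec t))) - k (star (prepr x1 (vec s)) (prepr x2 (vec t)))).
have K1 := stilde_plotE x1 x2 (vec2 s t); have K2 := star_plotE x1 x2 (vec2 s t).
apply: etrans (congr2 (fun a b => k a - k b) K1 K2) _.
by rewrite !mxE.
Qed.

Lemma tscale_icon n a (x : tangent (ops M n)) : is_icon x -> is_icon (tscale a x).
Proof. by rewrite /is_icon /tscale foot_whom. Qed.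

Lemma icon_perm_icon n (sigma : 'S_n) (x : tangent (ops M n)) : is_icon x -> is_icon (icon_perm sigma x).
Proof. by rewrite /is_icon /icon_perm foot_map => ->; exact: op_perm_delta. Qed.

Lemma icon_addable n (x y : tangent (ops M n)) : is_icon x -> is_icon y -> addable x y.
Proof. by move=> ix iy; apply: (@hom_addable R (M ⊗ WD R n) M HM HE); rewrite ix iy. Qed.

Lemma dd_alternate n (x : tangent (ops M n)) : is_icon x ->
  is_icon (alternate x) /\ forall k, funcs (ops M n) k ->
    dd k (alternate x) = \sum_(sigma : 'S_n) (-1) ^+ sigma * dd (k \o op_perm M sigma) x.
Proof.
move=> ix; rewrite /alternate; elim: (index_enum _) => [|sigma l [IH1 IH2]].
  rewrite big_nil; split=> [|k hk]; first exact: prol_projE.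
  by rewrite big_nil (dd_tzero _ hk).
rewrite big_cons; have i1 := tscale_icon ((-1) ^+ sigma) (icon_perm_icon sigma ix).
have ad := icon_addable i1 IH1; split=> [|k hk].
  by rewrite /is_icon (foot_tadd ad).
by rewrite (dd_tadd hk ad) (IH2 k hk) big_cons (dd_tscale _ _ hk) /icon_perm (dd_map _ _ hk).
Qed.

Lemma dd_fn p q (x1 : tangent (ops M p)) (x2 : tangent (ops M q)) :
  is_icon x1 -> is_icon x2 ->
  is_icon (fn_bracket x1 x2) /\ forall k, funcs (ops M (p + q)) k ->
    dd k (fn_bracket x1 x2) = (p`! * q`!)%:R^-1 *
      \sum_(sigma : 'S_(p + q)) (-1) ^+ sigma * dd (k \o op_perm M sigma) (lie_bracket x1 x2).
Proof.
move=> i1 i2; have [ia H] := dd_alternate (lie_icon i1 i2).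
split=> [|k hk]; first exact: tscale_icon.
by rewrite /fn_bracket (dd_tscale _ _ hk) (H k hk).
Qed.

End Ops.
End Brackets.

(** * Third mixed derivatives *)

Section ThreeVariables.
Variable R : realType.
Implicit Types F G : R -> R -> R -> R.

Definition smooth3 F := forall s t u : R -> R, smooth1 s -> smooth1 t -> smooth1 u ->
  smooth1 (fun x => F (s x) (t x) (u x)).

Definition D3 F : R := D1 (fun s => D2 (F s)).

Lemma smooth1_D1 (F : R -> R -> R) : smooth2 F -> smooth1 (fun s => D1 (F s)).
Proof. exact: d2_smooth_fst. Qed.

Lemma smooth3_D1 F : smooth3 F -> smooth2 (fun s t => D1 (F s t)).
Proof.
move=> sF s t ss st; apply: (@smooth1_D1 (fun x u => F (s x) (t x) u)) => x u sx su.
exact: (sF (s \o x) (t \o x) u (smooth1_comp ss sx) (smooth1_comp st sx) su).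
Qed.

Lemma smooth3_fix F s : smooth3 F -> smooth2 (F s).
Proof. by move=> sF t u st su; exact: (sF (fun=> s) t u (@smooth1_cst R s) st su). Qed.

Lemma smooth3_rot F : smooth3 F -> smooth3 (fun s t u => F u s t).
Proof. by move=> sF s t u ss st su; exact: (sF u s t su ss st). Qed.

Lemma smooth3B F G : smooth3 F -> smooth3 G -> smooth3 (fun s t u => F s t u - G s t u).
Proof.
by move=> sF sG s t u ss st su; exact: (smooth1B (sF s t u ss st su) (sG s t u ss st su)).
Qed.

(** The derivatives in the three variables commute. *)
Lemma D3_rot F : smooth3 F -> D3 (fun s t u => F u s t) = D3 F.
Proof.
move=> sF; rewrite /D3.
have E s : D2 (fun t u => F u s t) = D2 (fun u t => F u s t).
  apply: D2_sym => t u st su.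
  exact: (sF u (fun=> s) t su (@smooth1_cst R s) st).
transitivity (D1 (fun s => D2 (fun u t => F u s t))).
  apply: (congr1 (@D1 R)).
  apply/funext => s.
  exact: (E s).
exact: (@D2_sym R (fun s u => D1 (F u s)) (fun s u ss su => smooth3_D1 sF su ss)).
Qed.

Lemma D2_sub (F G : R -> R -> R) : smooth2 F -> smooth2 G ->
  D2 (fun s t => F s t - G s t) = D2 F - D2 G.
Proof.
move=> sF sG; rewrite /D2 -(D1B (smooth1_D1 sF) (smooth1_D1 sG)).
congr D1; apply/funext => s.
exact: (D1B (smooth2_snd (t := s) sF) (smooth2_snd (t := s) sG)).
Qed.

Lemma smooth1_D2 F : smooth3 F -> smooth1 (fun s => D2 (F s)).
Proof. by move=> sF; exact: (smooth1_D1 (smooth3_D1 sF)). Qed.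

Lemma D3_sub F G : smooth3 F -> smooth3 G ->
  D3 (fun s t u => F s t u - G s t u) = D3 F - D3 G.
Proof.
move=> sF sG; rewrite /D3 -(D1B (smooth1_D2 sF) (smooth1_D2 sG)).
congr D1; apply/funext => s.
exact: (D2_sub (smooth3_fix (s := s) sF) (smooth3_fix (s := s) sG)).
Qed.

Lemma smooth1_sum_scaled (I : Type) (r : seq I) (c : I -> R) (f : I -> R -> R) :
  (forall i, smooth1 (f i)) -> smooth1 (fun s => \sum_(i <- r) c i * f i s).
Proof.
move=> sf; elim: r => [|i r IH].
  rewrite (_ : (fun s => _) = fun=> 0); last by apply/funext => s; rewrite big_nil.
  exact (@smooth1_cst R 0).
rewrite (_ : (fun s => _) = fun s => c i * f i s + \sum_(i <- r) c i * f i s).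
  exact: (smooth1D (smooth1M (@smooth1_cst R (c i)) (sf i)) IH).
by apply/funext => s; rewrite big_cons.
Qed.

Lemma D1_sum (I : Type) (r : seq I) (c : I -> R) (f : I -> R -> R) :
  (forall i, smooth1 (f i)) ->
  D1 (fun s => \sum_(i <- r) c i * f i s) = \sum_(i <- r) c i * D1 (f i).
Proof.
move=> sf; elim: r => [|i r IH].
  rewrite (_ : (fun s => _) = fun=> 0); last by apply/funext => s; rewrite big_nil.
  by rewrite big_nil /D1 derive1_cst.
rewrite (_ : (fun s => _) = fun s => c i * f i s + \sum_(i <- r) c i * f i s).
  rewrite (D1D (smooth1M (@smooth1_cst R (c i)) (sf i)) (smooth1_sum_scaled (r := r) (c := c) sf)).
  by rewrite (D1Z _ (sf i)) IH big_cons.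
by apply/funext => s; rewrite big_cons.
Qed.

End ThreeVariables.

(** * The Jacobi identity before alternation *)

Section IteratedBrackets.
Variable R : realType.
Variable M : frolicher R.
Hypotheses (HM : microlinear M) (HE : weil_exponentiable M).

Lemma row_smooth m n (t : 'rV[R]_m) : @is_smooth R (rspace R n) (rspace R (m + n)) (fun s => row_mx t s).
Proof.
exact: (rspace_smooth (X := rspace R n) (Cinf_row_mx (@Cinf_cst_row R m n t) (@Cinf_coord R n))).
Qed.

Definition row_smap m n (t : 'rV[R]_m) : smap (rspace R n) (rspace R (m + n)) :=
  SMap (@row_smooth m n t).

(** The permutation that acts by tau on the last m indices, defined by recursion
    on p so that its sign is immediate. *)
Fixpoint block_perm p m (tau : 'S_m) : 'S_(p + m) :=
  if p is p'.+1 then lift0_perm (block_perm p' tau) else tau.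

Lemma odd_block_perm p m (tau : 'S_m) : odd_perm (block_perm p tau) = odd_perm tau.
Proof. by elim: p => //= p IH; rewrite odd_lift_perm. Qed.

Lemma block_perm_l p m (tau : 'S_m) (i : 'I_p) : block_perm p tau (lshift m i) = lshift m i.
Proof.
elim: p i => [[]//|p IH] i /=; case: (unliftP ord0 i) => [j|] ->.
  rewrite (_ : lshift m (lift ord0 j) = lift ord0 (lshift m j)); last exact: val_inj.
  by rewrite lift_perm_lift IH.
by rewrite (_ : lshift m ord0 = ord0) ?lift_perm_id//; exact: val_inj.
Qed.

Lemma block_perm_r p m (tau : 'S_m) (i : 'I_m) : block_perm p tau (rshift p i) = rshift p (tau i).
Proof.
elim: p i => [|p IH] i /=; first by rewrite !(_ : forall j, rshift 0 j = j)// => j; exact: val_inj.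
rewrite (_ : rshift p.+1 i = lift ord0 (rshift p i)); last exact: val_inj.
by rewrite lift_perm_lift IH; exact: val_inj.
Qed.

Lemma block_perm_row p m (tau : 'S_m) (t : 'rV[R]_p) (s : 'rV[R]_m) :
  perm_fun (block_perm p tau) (row_mx t s) = row_mx t (perm_fun tau s).
Proof.
apply/rowP => j; rewrite mxE -(fintype.splitK j); case: (fintype.split j) => k /=.
  by rewrite block_perm_l !row_mxEl.
by rewrite block_perm_r !row_mxEr mxE.
Qed.

Lemma perm_funM n (sigma tau : 'S_n) (x : 'rV[R]_n) :
  perm_fun sigma (perm_fun tau x) = perm_fun (sigma * tau)%g x.
Proof. by apply/rowP => j; rewrite !mxE permM. Qed.

Lemma op_permM n (sigma tau : 'S_n) (e : ops M n) :
  op_perm M sigma (op_perm M tau e) = op_perm M (sigma * tau)%g e.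
Proof.
apply: smap_ext => u; rewrite (pc_prepr u) (op_perm_pc sigma (op_perm M tau e)).
rewrite (op_perm_pc tau e) (op_perm_pc _ e); congr (e (pc _)); apply/funext => x.
by congr (prepr u _); exact: perm_funM.
Qed.

Lemma star_op_perm p m (tau : 'S_m) (e1 : ops M p) (e2 : ops M m) :
  star e1 (op_perm M tau e2) = op_perm M (block_perm p tau) (star e1 e2).
Proof.
apply: smap_ext => u; rewrite (pc_prepr u) (star_pc HE) (op_perm_pc _ (star e1 e2)) (star_pc HE).
congr (e1 (pc _)); apply/funext => t.
apply: etrans (op_perm_pc tau e2 (smap_comp (prepr u) (row_smap m t))) _.
congr (e2 (pc _)); apply/funext => s; congr (prepr u _).
by apply: esym; exact: block_perm_row.
Qed.

Lemma stilde_op_perm p m (tau : 'S_m) (e1 : ops M p) (e2 : ops M m) :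
  stilde e1 (op_perm M tau e2) = op_perm M (block_perm p tau) (stilde e1 e2).
Proof.
apply: smap_ext => u; rewrite (pc_prepr u) (stilde_pc HE) (op_perm_pc _ (stilde e1 e2)) (stilde_pc HE).
rewrite (op_perm_pc tau e2); congr (e2 (pc _)); apply/funext => s.
congr (e1 (pc _)); apply/funext => t; congr (prepr u _).
by apply: esym; exact: block_perm_row.
Qed.

(** This identity and the next one are the associativity of composition: on both
    sides the three operators act in the same order. *)
Lemma stilde_stilde p q r (e1 : ops M p) (e2 : ops M q) (e3 : ops M r)
    (w : smap (rspace R (p + (q + r))) M) (w' : smap (rspace R (r + (p + q))) M) :
  (forall x y z, w (row_mx x (row_mx y z)) = w' (row_mx z (row_mx x y))) ->
  stilde e1 (stilde e2 e3) (pc w) = star e3 (stilde e1 e2) (pc w').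
Proof.
move=> ww; rewrite (stilde_pc HE) (stilde_pc HE) (star_pc HE); congr (e3 (pc _)).
apply/funext => z; apply: esym.
apply: etrans (stilde_pc HE e1 e2 (smap_comp w' (row_smap (p + q) z))) _.
congr (e2 (pc _)); apply/funext => y; congr (e1 (pc _)); apply/funext => x.
exact: (esym (ww x y z)).
Qed.

Lemma stilde_star p q r (e1 : ops M p) (e2 : ops M q) (e3 : ops M r)
    (w : smap (rspace R (p + (q + r))) M) (w' : smap (rspace R (q + (r + p))) M) :
  (forall x y z, w (row_mx x (row_mx y z)) = w' (row_mx y (row_mx z x))) ->
  stilde e1 (star e2 e3) (pc w) = star e2 (star e3 e1) (pc w').
Proof.
move=> ww; rewrite (stilde_pc HE) (star_pc HE) (star_pc HE); congr (e2 (pc _)).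
apply/funext => y; apply: esym.
apply: etrans (star_pc HE e3 e1 (smap_comp w' (row_smap (r + p) y))) _.
congr (e3 (pc _)); apply/funext => z; congr (e1 (pc _)); apply/funext => x.
exact: (esym (ww x y z)).
Qed.

Definition bilinear_smooth p q (A : ops M p -> ops M q -> ops M (p + q)) :=
  @is_smooth R (prod_frolicher (ops M p) (ops M q)) (ops M (p + q)) (fun e => A e.1 e.2).

Definition triple p q r (A : ops M p -> ops M (q + r) -> ops M (p + (q + r)))
    (B : ops M q -> ops M r -> ops M (q + r)) (k : ops M (p + (q + r)) -> R)
    (x1 : tangent (ops M p)) (x2 : tangent (ops M q)) (x3 : tangent (ops M r)) (s t u : R) : R :=
  k (A (prepr x1 (vec s)) (B (prepr x2 (vec t)) (prepr x3 (vec u)))).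

Lemma vec_curve (s : R -> R) : smooth1 s -> curves (rspace R 1) (fun x => vec (s x)).
Proof.
move=> ss; apply/rspace_curveP => i; rewrite (_ : (fun x => _) = s); first exact: ss.
by apply/funext => x; rewrite mxE.
Qed.

Lemma icon_curve n (x : tangent (ops M n)) (s : R -> R) : smooth1 s ->
  curves (ops M n) (fun v => prepr x (vec (s v))).
Proof. by move=> ss; exact: (smapP (prepr x) (vec_curve ss)). Qed.

Lemma pair_curve p q (A : ops M p -> ops M q -> ops M (p + q)) c1 c2 : bilinear_smooth A ->
  curves (ops M p) c1 -> curves (ops M q) c2 -> curves (ops M (p + q)) (fun v => A (c1 v) (c2 v)).
Proof. by move=> sA H1 H2; apply: (sA (fun v => (c1 v, c2 v))); apply/prod_curveP. Qed.

Lemma triple_smooth p q r (A : ops M p -> ops M (q + r) -> ops M (p + (q + r)))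
    (B : ops M q -> ops M r -> ops M (q + r)) k x1 x2 x3 :
  bilinear_smooth A -> bilinear_smooth B -> funcs (ops M (p + (q + r))) k ->
  smooth3 (triple A B k x1 x2 x3).
Proof.
move=> sA sB hk s t u ss st su.
exact: (proj1 (funcsE _) hk _ (pair_curve sA (icon_curve (x:=x1) ss)
         (pair_curve sB (icon_curve (x:=x2) st) (icon_curve (x:=x3) su)))).
Qed.

(** The derivative of k along the iterated Lie bracket of three icons, in terms of
    triple composites. *)
Definition jac p q r (k : ops M (p + (q + r)) -> R)
    (x1 : tangent (ops M p)) (x2 : tangent (ops M q)) (x3 : tangent (ops M r)) : R :=
  (D3 (triple (@stilde R M p (q + r)) (@stilde R M q r) k x1 x2 x3) -
   D3 (triple (@stilde R M p (q + r)) (@star R M q r) k x1 x2 x3)) -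
  (D3 (triple (@star R M p (q + r)) (@stilde R M q r) k x1 x2 x3) -
   D3 (triple (@star R M p (q + r)) (@star R M q r) k x1 x2 x3)).

Lemma jac_D3 p q r (k : ops M (p + (q + r)) -> R) x1 x2 x3 : funcs (ops M (p + (q + r))) k ->
  D3 (fun s t u => (triple (@stilde R M p (q + r)) (@stilde R M q r) k x1 x2 x3 s t u -
                    triple (@star R M p (q + r)) (@stilde R M q r) k x1 x2 x3 s t u) -
                   (triple (@stilde R M p (q + r)) (@star R M q r) k x1 x2 x3 s t u -
                    triple (@star R M p (q + r)) (@star R M q r) k x1 x2 x3 s t u)) =
  jac k x1 x2 x3.
Proof.
move=> hk.
have s1 := triple_smooth (x1:=x1) (x2:=x2) (x3:=x3) (stilde_smooth HE (p:=p) (q:=q + r)) (stilde_smooth HE (p:=q) (q:=r)) hk.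
have s2 := triple_smooth (x1:=x1) (x2:=x2) (x3:=x3) (stilde_smooth HE (p:=p) (q:=q + r)) (star_smooth HE (p:=q) (q:=r)) hk.
have s3 := triple_smooth (x1:=x1) (x2:=x2) (x3:=x3) (star_smooth HE (p:=p) (q:=q + r)) (stilde_smooth HE (p:=q) (q:=r)) hk.
have s4 := triple_smooth (x1:=x1) (x2:=x2) (x3:=x3) (star_smooth HE (p:=p) (q:=q + r)) (star_smooth HE (p:=q) (q:=r)) hk.
apply: etrans (D3_sub (smooth3B s1 s3) (smooth3B s2 s4)) _.
apply: etrans (congr2 (fun a b : R => a - b) (D3_sub s1 s3) (D3_sub s2 s4)) _.
have regroup (a b c d : R) : a - b - (c - d) = a - c - (b - d) by ring.
exact: regroup.
Qed.

(** The functions that separate tangent vectors of the space of operators. *)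
Definition at_pc n (h : M -> R) (w : smap (rspace R n) M) (e : ops M n) : R := h (e (pc w)).

Lemma at_pc_funcs n (h : M -> R) (w : smap (rspace R n) M) : funcs M h -> funcs (ops M n) (at_pc h w).
Proof. by move=> hh; exact: (funcs_comp (smap_ev M (pc w)) hh). Qed.

Section Cyclic.
Variables (p q r : nat) (h : M -> R).
Variables (x1 : tangent (ops M p)) (x2 : tangent (ops M q)) (x3 : tangent (ops M r)).
Hypothesis hh : funcs M h.

Lemma D3_stilde_stilde (w : smap (rspace R (p + (q + r))) M) (w' : smap (rspace R (r + (p + q))) M) :
  (forall x y z, w (row_mx x (row_mx y z)) = w' (row_mx z (row_mx x y))) ->
  D3 (triple (@stilde R M p (q + r)) (@stilde R M q r) (at_pc h w) x1 x2 x3) =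
  D3 (triple (@star R M r (p + q)) (@stilde R M p q) (at_pc h w') x3 x1 x2).
Proof.
move=> ww; have sm := triple_smooth (x1:=x3) (x2:=x1) (x3:=x2) (star_smooth HE (p:=r) (q:=p + q)) (stilde_smooth HE (p:=p) (q:=q)) (at_pc_funcs (w:=w') hh).
rewrite -(D3_rot sm); congr D3; apply/funext => s; apply/funext => t; apply/funext => u.
by congr h; exact: stilde_stilde.
Qed.

Lemma D3_stilde_star (w : smap (rspace R (p + (q + r))) M) (w' : smap (rspace R (q + (r + p))) M) :
  (forall x y z, w (row_mx x (row_mx y z)) = w' (row_mx y (row_mx z x))) ->
  D3 (triple (@stilde R M p (q + r)) (@star R M q r) (at_pc h w) x1 x2 x3) =
  D3 (triple (@star R M q (r + p)) (@star R M r p) (at_pc h w') x2 x3 x1).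
Proof.
move=> ww; have sm := triple_smooth (x1:=x2) (x2:=x3) (x3:=x1) (star_smooth HE (p:=q) (q:=r + p)) (star_smooth HE (p:=r) (q:=p)) (at_pc_funcs (w:=w') hh).
rewrite -(D3_rot sm) -(D3_rot (smooth3_rot sm)); congr D3.
apply/funext => s; apply/funext => t; apply/funext => u.
by congr h; exact: stilde_star.
Qed.

End Cyclic.

(** Each of the six orders of composition occurs twice in the cyclic sum, with
    opposite signs. *)
Lemma jac_cyclic p q r (h : M -> R) (x1 : tangent (ops M p)) (x2 : tangent (ops M q)) (x3 : tangent (ops M r))
    (w1 : smap (rspace R (p + (q + r))) M) (w2 : smap (rspace R (q + (r + p))) M)
    (w3 : smap (rspace R (r + (p + q))) M) : funcs M h ->
  (forall x y z, w1 (row_mx x (row_mx y z)) = w2 (row_mx y (row_mx z x))) ->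
  (forall x y z, w1 (row_mx x (row_mx y z)) = w3 (row_mx z (row_mx x y))) ->
  jac (at_pc h w1) x1 x2 x3 + jac (at_pc h w2) x2 x3 x1 + jac (at_pc h w3) x3 x1 x2 = 0.
Proof.
move=> hh w12 w13.
have w23 x y z : w2 (row_mx x (row_mx y z)) = w3 (row_mx y (row_mx z x)) by rewrite -w12 w13.
have w21 x y z : w2 (row_mx x (row_mx y z)) = w1 (row_mx z (row_mx x y)) by rewrite -w12.
have w31 x y z : w3 (row_mx x (row_mx y z)) = w1 (row_mx y (row_mx z x)) by rewrite -w13.
have w32 x y z : w3 (row_mx x (row_mx y z)) = w2 (row_mx z (row_mx x y)) by rewrite -w12 -w13.
have cancel (t1 t2 t3 u1 u2 u3 a b c d e f : R) : t1 = c -> t2 = a -> t3 = b ->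
    u1 = e -> u2 = f -> u3 = d ->
    (t1 - u1) - (a - d) + ((t2 - u2) - (b - e)) + ((t3 - u3) - (c - f)) = 0.
  by move=> -> -> -> -> -> ->; ring.
exact: (cancel _ _ _ _ _ _ _ _ _ _ _ _
  (D3_stilde_stilde x1 x2 x3 hh w13) (D3_stilde_stilde x2 x3 x1 hh w21) (D3_stilde_stilde x3 x1 x2 hh w32)
  (D3_stilde_star x1 x2 x3 hh w12) (D3_stilde_star x2 x3 x1 hh w23) (D3_stilde_star x3 x1 x2 hh w31)).
Qed.

End IteratedBrackets.

(** * Alternating sums and rotations of blocks *)

Section Alternation.
Variable R : realType.

Lemma alternating_shift n (rho : 'S_n) (G : 'S_n -> R) :
  \sum_(sigma : 'S_n) (-1) ^+ sigma * G (sigma * rho)%g =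
  (-1) ^+ rho * \sum_(sigma : 'S_n) (-1) ^+ sigma * G sigma.
Proof.
rewrite [in RHS](reindex_inj (mulIg rho)) mulr_sumr; apply: eq_bigr => sigma _ /=.
rewrite odd_permM signr_addb mulrA; congr (_ * _).
by rewrite mulrCA -expr2 sqrr_sign mulr1.
Qed.

Lemma alternating_cast m n (e : m = n) (G : 'S_m -> R) :
  \sum_(sigma : 'S_m) (-1) ^+ sigma * G sigma =
  \sum_(sigma : 'S_n) (-1) ^+ sigma * G (cast_perm (esym e) sigma).
Proof. by case: _ / e; apply: eq_bigr => sigma _; rewrite cast_perm_id. Qed.

Definition rot n : 'S_n := perm (@ordS_inj n).

Lemma odd_rot n : odd_perm (rot n.+1) = odd n.
Proof.
rewrite (_ : rot n.+1 = lift_perm ord_max ord0 1%g).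
  by rewrite odd_lift_perm odd_perm1 /= addbF addbF.
apply/permP => i; rewrite permE; case: (unliftP ord_max i) => [j|] ->.
  rewrite lift_perm_lift perm1; apply: val_inj => /=.
  by rewrite /bump leqNgt ltn_ord add0n modn_small// ltnS.
by rewrite lift_perm_id; apply: val_inj; rewrite /= modnn.
Qed.

Lemma rotX_val n k (j : 'I_n) : val ((rot n ^+ k)%g j) = ((j + k) %% n)%N.
Proof.
rewrite permX; elim: k => [|k IH]; first by rewrite /= addn0 modn_small.
by rewrite iterS permE /= IH -addn1 modnDml addn1 addnS.
Qed.

Lemma odd_permX (T : finType) (s : {perm T}) k : odd_perm (s ^+ k)%g = odd k && odd_perm s.
Proof.
elim: k => [|k IH]; first by rewrite expg0 odd_perm1.
by rewrite expgS odd_permM IH /=; case: (odd k); case: (odd_perm s).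
Qed.

(** The rotation is the k-th power of a cycle of length k + m, and k (k - 1) is
    even. *)
Lemma sign_rot k m : (-1) ^+ (odd_perm (rot (k + m) ^+ k)%g) = (-1) ^+ (k * m) :> R.
Proof.
rewrite -[RHS]signr_odd oddM odd_permX; congr (_ ^+ (nat_of_bool _)).
case: k => [//|k]; rewrite addSn odd_rot oddD /=.
by case: (odd k); case: (odd m).
Qed.

Definition cast_smap m n (e : m = n) : smap (rspace R m) (rspace R n) :=
  ecast k (smap (rspace R m) (rspace R k)) e (smap_id (rspace R m)).

Lemma cast_smapE m n (e : m = n) (x : 'rV[R]_m) j :
  (cast_smap e x : 'rV[R]_n) 0 j = x 0 (cast_ord (esym e) j).
Proof. by case: _ / e j => j; rewrite cast_ord_id. Qed.

Lemma cast_perm_fun m n (e : m = n) (sigma : 'S_n) (x : 'rV[R]_m) :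
  cast_smap e (perm_fun (cast_perm (esym e) sigma) x) = perm_fun sigma (cast_smap e x).
Proof. by case: _ / e sigma => sigma; rewrite cast_perm_id. Qed.

Lemma rot_blocks1 p q r (x : 'rV[R]_p) (y : 'rV[R]_q) (z : 'rV[R]_r) :
  cast_smap (addn_rot p q r) (row_mx y (row_mx z x)) =
  perm_fun (rot (p + (q + r)) ^+ p)%g (row_mx x (row_mx y z)).
Proof.
suff H (i : 'I_(q + (r + p))) (k : 'I_(p + (q + r))) :
    val k = ((i + p) %% (p + (q + r)))%N ->
    row_mx y (row_mx z x) 0 i = row_mx x (row_mx y z) 0 k.
  by apply/rowP => j; rewrite cast_smapE [RHS]mxE; apply: H; rewrite rotX_val.
rewrite -(fintype.splitK i); case: (fintype.split i) => [a|i'] /= vk.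
  have -> : k = rshift p (lshift r a).
    apply: val_inj; rewrite /= vk addnC modn_small// ltn_add2l.
    by rewrite (leq_trans (ltn_ord a))// leq_addr.
  by rewrite row_mxEl row_mxEr row_mxEl.
move: vk; rewrite row_mxEr -(fintype.splitK i'); case: (fintype.split i') => [b|c] /= vk.
  have -> : k = rshift p (rshift q b).
    by apply: val_inj; rewrite /= vk addnC modn_small// ltn_add2l ltn_add2l.
  by rewrite row_mxEl !row_mxEr.
have -> : k = lshift (q + r) c.
  apply: val_inj; rewrite /= vk addnA addnAC [(_ + p)%N]addnC modnDl modn_small//.
  by rewrite (leq_trans (ltn_ord c))// leq_addr.
by rewrite row_mxEr row_mxEl.
Qed.

Lemma rot_blocks2 p q r (x : 'rV[R]_p) (y : 'rV[R]_q) (z : 'rV[R]_r) :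
  cast_smap (esym (addn_rot r p q)) (row_mx z (row_mx x y)) =
  perm_fun (rot (p + (q + r)) ^+ (p + q))%g (row_mx x (row_mx y z)).
Proof.
suff H (i : 'I_(r + (p + q))) (k : 'I_(p + (q + r))) :
    val k = ((i + (p + q)) %% (p + (q + r)))%N ->
    row_mx z (row_mx x y) 0 i = row_mx x (row_mx y z) 0 k.
  by apply/rowP => j; rewrite cast_smapE [RHS]mxE; apply: H; rewrite rotX_val.
rewrite -(fintype.splitK i); case: (fintype.split i) => [a|i'] /= vk.
  have -> : k = rshift p (rshift q a).
    by apply: val_inj; rewrite /= vk addnC -addnA modn_small// !ltn_add2l.
  by rewrite row_mxEl !row_mxEr.
have {}vk : val k = val i'.
  apply: etrans vk _; rewrite (_ : (r + i' + (p + q) = p + (q + r) + i')%N); last first.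
    by rewrite [LHS]addnC !addnA.
  by rewrite modnDl modn_small// addnA (leq_trans (ltn_ord i'))// leq_addr.
move: vk; rewrite row_mxEr -(fintype.splitK i'); case: (fintype.split i') => [b|c] /= vk.
  have -> : k = lshift (q + r) b by apply: val_inj.
  by rewrite !row_mxEl.
have -> : k = rshift p (lshift r c) by apply: val_inj.
by rewrite !row_mxEr row_mxEl.
Qed.

End Alternation.
(** * The Jacobi identity for alternated brackets *)

Section GradedJacobi.
Variables (R : realType) (M : frolicher R).
Hypotheses (HM : microlinear M) (HE : weil_exponentiable M).

Lemma funcsB (X : frolicher R) (f g : X -> R) : funcs X f -> funcs X g -> funcs X (fun x => f x - g x).
Proof.
move=> hf hg; apply/funcsE => c cc.
exact: (smooth1B (proj1 (funcsE _) hf c cc) (proj1 (funcsE _) hg c cc)).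
Qed.

(** The function of e2 whose derivative along a second icon, differentiated in e1
    along a first one, is the derivative of k along their bracket. *)
Definition commutator_with p m (k : ops M (p + m) -> R) (e1 : ops M p) (e2 : ops M m) : R :=
  k (stilde e1 e2) - k (star e1 e2).

Lemma commutator_with_funcs p m (k : ops M (p + m) -> R) (e : ops M p) :
  funcs (ops M (p + m)) k -> funcs (ops M m) (commutator_with k e).
Proof.
move=> hk; apply: funcsB.
  exact: (funcs_comp (smap_comp (SMap (stilde_smooth HE (p:=p) (q:=m))) (smap_pair (smap_cst _ e) (smap_id _))) hk).
exact: (funcs_comp (smap_comp (SMap (star_smooth HE (p:=p) (q:=m))) (smap_pair (smap_cst _ e) (smap_id _))) hk).
Qed.

Lemma smooth1_dd_commutator p m (k : ops M (p + m) -> R) (x1 : tangent (ops M p)) (x : tangent (ops M m)) :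
  funcs (ops M (p + m)) k -> smooth1 (fun s => dd (commutator_with k (prepr x1 (vec s))) x).
Proof.
move=> hk; apply: (@smooth1_D1 R (fun s t => commutator_with k (prepr x1 (vec s)) (prepr x (vec t)))).
move=> s t ss st; apply: smooth1B.
  exact: (proj1 (funcsE _) hk _ (pair_curve (stilde_smooth HE (p:=p) (q:=m)) (icon_curve (x:=x1) ss) (icon_curve (x:=x) st))).
exact: (proj1 (funcsE _) hk _ (pair_curve (star_smooth HE (p:=p) (q:=m)) (icon_curve (x:=x1) ss) (icon_curve (x:=x) st))).
Qed.

(** Permuting the variables of the second factor permutes the last variables of
    both products, so the inner alternation can be moved outside. *)
Lemma dd_lie_fn p q r (k : ops M (p + (q + r)) -> R)
    (x1 : tangent (ops M p)) (x2 : tangent (ops M q)) (x3 : tangent (ops M r)) :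
  is_icon x1 -> is_icon x2 -> is_icon x3 -> funcs (ops M (p + (q + r))) k ->
  dd k (lie_bracket x1 (fn_bracket x2 x3)) = (q`! * r`!)%:R^-1 *
    \sum_(tau : 'S_(q + r)) (-1) ^+ tau * jac (k \o op_perm M (block_perm p tau)) x1 x2 x3.
Proof.
move=> i1 i2 i3 hk; have [iL HL] := dd_fn HM HE i2 i3.
apply: etrans (dd_lie HM HE i1 iL hk) _.
change (D1 (fun s => dd (commutator_with k (prepr x1 (vec s))) (fn_bracket x2 x3)) =
  (q`! * r`!)%:R^-1 * \sum_(tau : 'S_(q + r)) (-1) ^+ tau * jac (k \o op_perm M (block_perm p tau)) x1 x2 x3).
pose kt (tau : 'S_(q + r)) := k \o op_perm M (block_perm p tau).
have hkt tau : funcs (ops M (p + (q + r))) (kt tau) by exact: (funcs_comp (op_perm M (block_perm p tau)) hk).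
pose d tau s := dd (commutator_with (kt tau) (prepr x1 (vec s))) (lie_bracket x2 x3).
pose c (tau : 'S_(q + r)) : R := (q`! * r`!)%:R^-1 * (-1) ^+ tau.
have E s : dd (commutator_with k (prepr x1 (vec s))) (fn_bracket x2 x3) = \sum_tau c tau * d tau s.
  apply: etrans (HL _ (commutator_with_funcs (e := prepr x1 (vec s)) hk)) _.
  rewrite mulr_sumr; apply: eq_bigr => tau _; rewrite mulrA; congr (_ * _).
  apply: (congr1 (fun f => dd f (lie_bracket x2 x3))); apply/funext => e.
  have E1 := stilde_op_perm HE tau (prepr x1 (vec s)) e.
  have E2 := star_op_perm HE tau (prepr x1 (vec s)) e.
  exact: (congr2 (fun a b => k a - k b) E1 E2).
have sd tau : smooth1 (d tau).
  exact: (smooth1_dd_commutator (x1:=x1) (x:=lie_bracket x2 x3) (hkt tau)).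
rewrite (_ : (fun s => _) = fun s => \sum_tau c tau * d tau s); last by apply/funext.
rewrite (D1_sum _ _ sd) mulr_sumr; apply: eq_bigr => tau _; rewrite mulrA; congr (_ * _).
rewrite -(jac_D3 HE x1 x2 x3 (hkt tau)); apply: (congr1 (@D1 R)); apply/funext => s.
exact: (dd_lie HM HE i2 i3 (commutator_with_funcs (e := prepr x1 (vec s)) (hkt tau))).
Qed.

Lemma at_pc_perm n (h : M -> R) (w : smap (rspace R n) M) (sigma : 'S_n) :
  at_pc h w \o op_perm M sigma = at_pc h (smap_comp w (D_perm R sigma)).
Proof. by apply/funext => e; congr h; exact: op_perm_pc. Qed.

(** The outer alternation absorbs the inner one: after reindexing, each tau
    contributes the same sum over sigma, which cancels the factor (q + r)!. *)
Lemma dd_fn_fn p q r (h : M -> R) (w : smap (rspace R (p + (q + r))) M)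
    (x1 : tangent (ops M p)) (x2 : tangent (ops M q)) (x3 : tangent (ops M r)) :
  is_icon x1 -> is_icon x2 -> is_icon x3 -> funcs M h ->
  dd (at_pc h w) (fn_bracket x1 (fn_bracket x2 x3)) = (p`! * q`! * r`!)%:R^-1 *
    \sum_(sigma : 'S_(p + (q + r)))
      (-1) ^+ sigma * jac (at_pc h (smap_comp w (D_perm R sigma))) x1 x2 x3.
Proof.
move=> i1 i2 i3 hh; have hk := at_pc_funcs (w:=w) hh; set k := at_pc h w in hk *.
have [iL _] := dd_fn HM HE i2 i3; have [_ H] := dd_fn HM HE i1 iL.
apply: etrans (H k hk) _.
pose G (sigma : 'S_(p + (q + r))) := jac (k \o op_perm M sigma) x1 x2 x3.
pose S := \sum_sigma (-1) ^+ odd_perm sigma * G sigma.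
have -> : \sum_(sigma : 'S_(p + (q + r)))
    (-1) ^+ sigma * jac (at_pc h (smap_comp w (D_perm R sigma))) x1 x2 x3 = S.
  apply: eq_bigr => sigma _; apply: (congr1 (fun a => _ * a)).
  exact: (congr1 (fun f => jac f x1 x2 x3) (esym (at_pc_perm h w sigma))).
have -> : \sum_(sigma : 'S_(p + (q + r)))
    (-1) ^+ sigma * dd (k \o op_perm M sigma) (lie_bracket x1 (fn_bracket x2 x3)) =
    (q`! * r`!)%:R^-1 * ((q + r)`!%:R * S).
  transitivity (\sum_(sigma : 'S_(p + (q + r))) \sum_(tau : 'S_(q + r))
      (q`! * r`!)%:R^-1 * ((-1) ^+ tau * ((-1) ^+ sigma * G (sigma * block_perm p tau)%g))).
    apply: eq_bigr => sigma _.
    rewrite (dd_lie_fn i1 i2 i3 (funcs_comp (op_perm M sigma) hk)) mulrCA mulr_sumr mulr_sumr.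
    apply: eq_bigr => tau _.
    have E : jac ((k \o op_perm M sigma) \o op_perm M (block_perm p tau)) x1 x2 x3 =
        G (sigma * block_perm p tau)%g.
      apply: (congr1 (fun f => jac f x1 x2 x3)); apply/funext => e.
      exact: (congr1 k (op_permM _ _ _)).
    have swap (a b c u v : R) : u = v -> a * (b * (c * u)) = a * (c * (b * v)).
      by move=> ->; ring.
    exact: (swap _ _ _ _ _ E).
  have -> : (q + r)`!%:R * S = \sum_(tau : 'S_(q + r)) S.
    by rewrite sumr_const card_Sn mulr_natl.
  rewrite exchange_big /= mulr_sumr.
  apply: eq_bigr => tau _; rewrite -mulr_sumr -mulr_sumr; apply: (congr1 (fun a => _ * a)).
  rewrite (alternating_shift (block_perm p tau) G) odd_block_perm mulrA -expr2 sqrr_sign.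
  exact: mul1r.
have nz m : (m`!)%:R != 0 :> R by rewrite pnatr_eq0 -lt0n fact_gt0.
have := (nz p, nz q, nz r, nz (q + r)%N) => -[[[n1 n2] n3] n4].
rewrite !natrM; move: n1 n2 n3 n4.
move: (p`!%:R : R) (q`!%:R : R) (r`!%:R : R) ((q + r)`!%:R : R) S => a b c d S n1 n2 n3 n4.
by field; rewrite n1 n2 n3 n4.
Qed.

Lemma icon_cast_icon m n (e : m = n) (x : tangent (ops M m)) : is_icon x -> is_icon (icon_cast e x).
Proof. by case: _ / e. Qed.

Lemma dd_icon_cast m n (e : m = n) (h : M -> R) (w : smap (rspace R n) M) (x : tangent (ops M m)) :
  dd (at_pc h w) (icon_cast e x) = dd (at_pc h (smap_comp w (cast_smap R e))) x.
Proof.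
case: _ / e w => w; apply: (congr1 (fun f => dd f x)); apply/funext => a.
by congr (h (a (pc _))).
Qed.

(** Reindexing by rho brings a double bracket in another order of its arguments
    to the same powers of D; the sign of rho appears in front. *)
Lemma dd_fn_fn_rot p q r (h : M -> R) n (w : smap (rspace R n) M) (e : (p + (q + r))%N = n) (rho : 'S_n)
    (x1 : tangent (ops M p)) (x2 : tangent (ops M q)) (x3 : tangent (ops M r)) :
  is_icon x1 -> is_icon x2 -> is_icon x3 -> funcs M h ->
  (-1) ^+ rho * dd (at_pc h w) (icon_cast e (fn_bracket x1 (fn_bracket x2 x3))) = (p`! * q`! * r`!)%:R^-1 *
    \sum_(sigma : 'S_n) (-1) ^+ sigma *
      jac (at_pc h (smap_comp w (smap_comp (D_perm R (sigma * rho^-1)%g) (cast_smap R e)))) x1 x2 x3.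
Proof.
move=> i1 i2 i3 hh; rewrite dd_icon_cast (dd_fn_fn _ i1 i2 i3 hh) mulrCA; congr (_ * _).
pose G (sigma : 'S_n) := jac (at_pc h (smap_comp w (smap_comp (D_perm R sigma) (cast_smap R e)))) x1 x2 x3.
apply: etrans _ (esym (alternating_shift (rho^-1)%g G)).
rewrite odd_permV (alternating_cast e); apply: (congr1 (fun a => _ * a)).
apply: eq_bigr => sigma _; apply: (congr1 (fun a => _ * a)).
apply: (congr1 (fun v => jac (at_pc h v) x1 x2 x3)); apply: smap_ext => x.
exact: (congr1 w (cast_perm_fun e sigma x)).
Qed.

Lemma graded_jacobi (p q r : nat)
    (x1 : tangent (ops M p)) (x2 : tangent (ops M q)) (x3 : tangent (ops M r)) :
  is_icon x1 -> is_icon x2 -> is_icon x3 ->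
  tadd
    (tadd (fn_bracket x1 (fn_bracket x2 x3))
          (tscale ((-1) ^+ (p * (q + r)))
             (icon_cast (addn_rot p q r)
                (fn_bracket x2 (fn_bracket x3 x1)))))
    (tscale ((-1) ^+ (r * (p + q)))
       (icon_cast (esym (addn_rot r p q))
          (fn_bracket x3 (fn_bracket x1 x2))))
  = tzero (X := ops M (p + (q + r))) (delta M (p + (q + r))).
Proof.
move=> i1 i2 i3.
have iB a b c (y1 : tangent (ops M a)) (y2 : tangent (ops M b)) (y3 : tangent (ops M c)) :
    is_icon y1 -> is_icon y2 -> is_icon y3 -> is_icon (fn_bracket y1 (fn_bracket y2 y3)).
  move=> j1 j2 j3; have [jL _] := dd_fn HM HE j2 j3.
  by have [j _] := dd_fn HM HE j1 jL.
have j1 := iB _ _ _ _ _ _ i1 i2 i3.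
have j2 := tscale_icon ((-1) ^+ (p * (q + r))) (icon_cast_icon (addn_rot p q r) (iB _ _ _ _ _ _ i2 i3 i1)).
have j3 := tscale_icon ((-1) ^+ (r * (p + q))) (icon_cast_icon (esym (addn_rot r p q)) (iB _ _ _ _ _ _ i3 i1 i2)).
have a12 := icon_addable HM HE j1 j2.
have j12 := etrans (foot_tadd a12) j1.
have a123 := icon_addable HM HE j12 j3.
have t0 : prol_proj (ops M (p + (q + r))) (WD R 1)
    (tzero (X := ops M (p + (q + r))) (delta M (p + (q + r)))) = delta M (p + (q + r)).
  exact: (@prol_projE R (ops M (p + (q + r))) (WD R 1) (smap_cst _ (delta M (p + (q + r))))).
apply: (hom_tangent_ext HE).
  exact: (etrans (etrans (foot_tadd a123) j12) (esym t0)).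
move=> h y hh; pose w : smap (rspace R (p + (q + r))) M := prepr y.
rewrite (_ : (fun f => _) = at_pc h w); last first.
  by apply/funext => f; congr (h (f _)); exact: pc_prepr.
have hk := at_pc_funcs (w:=w) hh.
apply: etrans (dd_tadd hk a123) _; apply: etrans (congr1 (fun a => a + _) (dd_tadd hk a12)) _.
apply: etrans (congr2 (fun a b => dd (at_pc h w) _ + a + b) (dd_tscale _ _ hk) (dd_tscale _ _ hk)) _.
rewrite (dd_tzero _ hk).
rewrite (dd_fn_fn w i1 i2 i3 hh).
rewrite -(sign_rot R p (q + r)) (dd_fn_fn_rot w (addn_rot p q r) _ i2 i3 i1 hh).
rewrite [(r * (p + q))%N]mulnC -(sign_rot R (p + q) r) -addnA.
rewrite (dd_fn_fn_rot w (esym (addn_rot r p q)) _ i3 i1 i2 hh).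
rewrite (_ : (q`! * r`! * p`!)%N = (p`! * q`! * r`!)%N); last by rewrite mulnC mulnA.
rewrite (_ : (r`! * p`! * q`!)%N = (p`! * q`! * r`!)%N); last by rewrite -mulnA mulnC.
rewrite -!mulrDr -!big_split /= big1 ?mulr0// => sigma _.
rewrite -!mulrDr (jac_cyclic HE _ _ _ hh) ?mulr0// => x z t /=; congr (w _).
  by rewrite rot_blocks1 perm_funM fingroup.mulgKV.
by rewrite rot_blocks2 perm_funM fingroup.mulgKV.
Qed.

End GradedJacobi.

Theorem theorem60 (R : realType) (M : frolicher R)
    (HM : microlinear M) (HE : weil_exponentiable M)
    (p q r : nat)
    (xi1 : tangent (ops M p)) (xi2 : tangent (ops M q)) (xi3 : tangent (ops M r))
    (H1 : is_form xi1) (H2 : is_form xi2) (H3 : is_form xi3) :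
  tadd
    (tadd (fn_bracket xi1 (fn_bracket xi2 xi3))
          (tscale ((-1) ^+ (p * (q + r)))
             (icon_cast (addn_rot p q r)
                (fn_bracket xi2 (fn_bracket xi3 xi1)))))
    (tscale ((-1) ^+ (r * (p + q)))
       (icon_cast (esym (addn_rot r p q))
          (fn_bracket xi3 (fn_bracket xi1 xi2))))
  = tzero (X := ops M (p + (q + r))) (delta M (p + (q + r))).
Proof.
exact: (graded_jacobi HM HE (proj1 (proj1 H1)) (proj1 (proj1 H2)) (proj1 (proj1 H3))).
Qed.
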